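(* Let $\mathcal A_n\hookrightarrow\mathcal A_{n+1}=\mathcal A_n\cup\{\binom{n+1}{pq}\}$ be a direct filiation for a simple path of weights with initialization $n_0\le n$, let $\varphi_n\in\mathfrak L_n^{\mathrm T,\mathcal A_n}(\mathbb K)$ and $\nu_n:=\dim\mathrm H_2(\varphi_n)_{\alpha_{n+1}}$. Each point $\varphi_{n+1}$ of the fiber of $\varphi_n$ in $\mathfrak L_{n+1}^{\mathrm T,\mathcal A_{n+1}}(\mathbb K)$ verifies the following properties, where $\mathcal O_n$ and $\mathcal O_{n+1}$ are the local rings of $\mathfrak L_n^{\mathrm T,\mathcal A_n}$ at $\varphi_n$ and of $\mathfrak L_{n+1}^{\mathrm T,\mathcal A_{n+1}}$ at $\varphi_{n+1}$: 1. If $\nu_n=0$, the fiber is empty. 2. If $\nu_n=1$, then $\varphi_{n+1}$ is unique in the fiber and $\mathcal O_{n+1}$ is a quotient of $\mathcal O_n$. Moreover, if $\varphi_n$ is rigid then $\varphi_{n+1}$ is rigid. 3. If $\nu_n>1$, then $\mathcal O_{n+1}$ is the localization at the point $(T_1,\dots,T_{\nu_n-1})=(0,\dots,0)$ of the quotient of $\mathcal O_n[T_1,\dots,T_{\nu_n-1}]$ by the ideal generated by expressions $$c_0^\lambda+\sum_{0<k<\nu_n}c_k^\lambda T_k,\qquad\lambda\in\Lambda\setminus\Lambda_1,\quad c_l^\lambda\in\mathfrak m(\mathcal O_n)\ (0\le l<\nu_n).$$ The Krull dimension of the scheme $\mathfrak L_{n+1}^{\mathrm T,\mathcal A_{n+1}}$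 at $\varphi_{n+1}$ is at least $\nu_n-1$; in particular $\varphi_{n+1}$ is not rigid.
   Context: $\mathbb K$ is an algebraically closed field of characteristic $0$. $\mathrm T$ is a torus (finite-dimensional $\mathbb K$-vector space) and $(\alpha_p)$ a sequence in $\mathrm T^*$; $\mathrm T$ acts on $\mathbb K^n$ by $t\cdot e_i=\alpha_i(t)e_i$. $\mathrm P_n=\{\alpha_1,\dots,\alpha_n\}$, $r=\dim\mathrm T$. $\mathfrak L_n^{\mathrm T}$ is the scheme of $\mathrm T$-invariant Lie laws on $\mathbb K^n$ ($\varphi^k_{ij}=0$ unless $\alpha_i+\alpha_j=\alpha_k$). $\Sigma_n(\mathrm T)$ is the set of $\varphi\in\mathfrak L_n^{\mathrm T}(\mathbb K)$ for which $\mathrm T$ is a maximal torus of derivations. Path of weights with initialization $n_0$: (1) $\alpha_1,\dots,\alpha_{n_0}$ span $\mathrm T^*$ and for some $t\in\mathrm T$ all $\alpha_i(t)\in\mathbb Q_{>0}$, $i\le n_0$; (2) $\Sigma_n(\mathrm T)\ne\emptyset$ for $n\ge n_0$; (3) $\alpha_{n+1}\notin\mathrm P_n-\mathrm P_n$ for $n\ge n_0$. Simple: all weights distinct. Under these hypotheses $e_{n+1}$ is central for every law of $\mathfrak L_{n+1}^{\mathrm T}$ and forgetting the coordinates $X^{n+1}_{ij}$ (quotient by $\mathbb Ke_{n+1}$) gives a morphism $\pi_{n+1}:\mathfrak L_{n+1}^{\mathrm T}\to\mathfrak L_n^{\mathrm T}$; ''fiber'' refers to $\pi_{n+1}$. Admissible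 sets: $\mathcal J$ is the set of multi-indices $\binom k{ij}$, $i<j$, $\alpha_i+\alpha_j=\alpha_k$. $\mathcal A\subset\mathcal J$ is admissible at $\varphi\in\mathfrak L_n^{\mathrm T}(\mathbb K)$ if it is minimal such that the forms $L\mapsto(d_\varphi L)^\alpha$, $\alpha\in\mathcal A$, on $\mathrm C^1(\mathbb K^n,\mathbb K^n)^{\mathrm T}$ ($d_\varphi$ the Chevalley–Eilenberg differential, adjoint coefficients) have maximal rank $\dim\mathrm B^2(\varphi,\varphi)^{\mathrm T}$. When $|\mathcal A|=n-r$, $\mathfrak L_n^{\mathrm T,\mathcal A}$ is the closed subscheme of $\mathfrak L_n^{\mathrm T}$ with $X^k_{ij}=1$ for $\binom k{ij}\in\mathcal A$. A direct filiation $\mathcal A_n\hookrightarrow\mathcal A_{n+1}$ is an inclusion $\mathcal A_{n+1}=\mathcal A_n\cup\{\binom{n+1}{pq}\}$, for some $p<q$, of admissible sets with $|\mathcal A_n|=n-r$, $|\mathcal A_{n+1}|=n+1-r$, at a law of $\Sigma_n(\mathrm T)$ and at a nontrivial central extension of it in $\Sigma_{n+1}(\mathrm T)$, respectively. $\mathrm H_2(\varphi_n)_{\alpha_{n+1}}$ is the weight space of weight $\alpha_{n+1}$ in the second homology (trivial coefficients) of $(\mathbb K^n,\varphi_n)$. $\mathfrak m(\cdot)$ is the maximal ideal. $\Lambda$ is the set of triples $(ijk)$, $i<j<k\le n$, with $\alpha_i+\alpha_j+\alpha_k=\alpha_{n+1}$; it indexes the new Jacobi polynomials $\mathrm J^{n+1}_{ijk}=\oint_{ijk}\sum_lY^l_{ij}X^{n+1}_{lk}$,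 $Y^l_{ij}$ being the coordinates of $\mathfrak L_n^{\mathrm T,\mathcal A_n}$ (elements of $\mathcal O_n$). Setting $X^{n+1}_{pq}=1$ these become $a_0^\lambda(Y)+\sum_{\mu\in M}a_\mu^\lambda(Y)X_\mu$, $\lambda\in\Lambda$, where $M$ is the set of pairs $i<j$ with $\alpha_i+\alpha_j=\alpha_{n+1}$, $(i,j)\ne(p,q)$. Let $(B)$ be the linear system over $\mathbb K$ obtained by evaluating at $Y=\varphi_n$ and equating to zero; $\Lambda_1\subset\Lambda$ is a minimal subset such that the subsystem of $(B)$ indexed by $\Lambda_1$ is equivalent to $(B)$. Localization at $T=0$ means localization at the image of the maximal ideal $\mathfrak m(\mathcal O_n)[T]+\sum_kT_k\mathcal O_n[T]$. Rigid means formally rigid in $\mathfrak L_n^{\mathrm T}$ (resp. $\mathfrak L_{n+1}^{\mathrm T}$): every $\mathbb K[[t]]$-point of the scheme reducing to the law at $t=0$ is conjugate to the constant one, under $s*\varphi=s\circ\varphi\circ(s^{-1}\times s^{-1})$, by an $s\equiv\mathrm{id}$ mod $t$ commuting with $\mathrm T$. *)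

(* Defs.v *)
From HB Require Import structures.
From mathcomp Require Import all_boot all_order all_algebra.
From mathcomp Require Import boolp.
From mathcomp Require Import ring.
From mathcomp Require Import mpoly.

Set Implicit Arguments.
Unset Strict Implicit.
Unset Printing Implicit Defensive.

Import GRing.Theory.
Local Open Scope ring_scope.

Record fps (K : Type) := Fps { fps_coef : nat -> K }.

HB.instance Definition _ (K : Type) := gen_eqMixin (fps K).
HB.instance Definition _ (K : Type) := gen_choiceMixin (fps K).

Section FormalPowerSeries.
Variable K : comNzRingType.
Implicit Types f g h : fps K.

Definition fpsC (a : K) : fps K := Fps (fun m => if m == 0%N then a else 0).
Definition fps_add f g : fps K := Fps (fun m => fps_coef f m + fps_coef g m).
Definition fps_opp f : fps K := Fps (fun m => - fps_coef f m).
Definition fps_mul f g : fps K :=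
  Fps (fun m => \sum_(i < m.+1) fps_coef f i * fps_coef g (m - i)%N).

Lemma fpsP f g : fps_coef f =1 fps_coef g -> f = g.
Proof. by case: f g => [f] [g] /= /funext ->. Qed.

Lemma fps_addA : associative fps_add.
Proof. by move=> f g h; apply/fpsP => m /=; rewrite addrA. Qed.

Lemma fps_addC : commutative fps_add.
Proof. by move=> f g; apply/fpsP => m /=; rewrite addrC. Qed.

Lemma fps_add0 : left_id (fpsC 0) fps_add.
Proof. by move=> f; apply/fpsP => m /=; rewrite if_same add0r. Qed.

Lemma fps_addN : left_inverse (fpsC 0) fps_opp fps_add.
Proof. by move=> f; apply/fpsP => m /=; rewrite if_same addNr. Qed.

HB.instance Definition _ :=
  GRing.isZmodule.Build (fps K) fps_addA fps_addC fps_add0 fps_addN.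

Definition fps_trunc (m : nat) f : {poly K} := \poly_(i < m.+1) fps_coef f i.

Lemma fps_coef_mul f g m k : (k <= m)%N ->
  fps_coef (fps_mul f g) k = (fps_trunc m f * fps_trunc m g)`_k.
Proof.
move=> km; rewrite coefM /=; apply: eq_bigr => i _; rewrite !coef_poly !ltnS.
by rewrite (leq_trans _ km) ?leq_ord // (leq_trans (leq_subr _ _) km).
Qed.

Lemma fps_mulA : associative fps_mul.
Proof.
move=> f g h; apply/fpsP => m.
have tr k u : (k <= m)%N -> (fps_trunc m u)`_k = fps_coef u k.
  by move=> km; rewrite coef_poly ltnS km.
transitivity ((fps_trunc m f * (fps_trunc m g * fps_trunc m h))`_m).
  rewrite (fps_coef_mul _ _ (leqnn m)) !coefM; apply: eq_bigr => i _.
  by rewrite (tr _ (fps_mul _ _)) ?leq_subr // (@fps_coef_mul _ _ m) ?leq_subr.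
rewrite mulrA (fps_coef_mul _ _ (leqnn m)) !coefM; apply: eq_bigr => i _.
by rewrite (tr _ (fps_mul _ _)) ?leq_ord // (@fps_coef_mul _ _ m) ?leq_ord.
Qed.

Lemma fps_mulC : commutative fps_mul.
Proof.
by move=> f g; apply/fpsP => m; rewrite !(@fps_coef_mul _ _ m) // mulrC.
Qed.

Lemma fps_mul1 : left_id (fpsC 1) fps_mul.
Proof.
move=> f; apply/fpsP => m /=; rewrite big_ord_recl /= mul1r subn0.
by rewrite big1 ?addr0 // => i _; rewrite mul0r.
Qed.

Lemma fps_mulD : left_distributive fps_mul fps_add.
Proof.
move=> f g h; apply/fpsP => m /=; rewrite -big_split /=.
by apply: eq_bigr => i _; rewrite mulrDl.
Qed.

Lemma fps_1neq0 : fpsC 1 != fpsC 0.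
Proof.
by apply/eqP => /(congr1 (fun f => fps_coef f 0)) /eqP; rewrite /= oner_eq0.
Qed.

HB.instance Definition _ := GRing.Zmodule_isComNzRing.Build (fps K)
  fps_mulA fps_mulC fps_mul1 fps_mulD fps_1neq0.

End FormalPowerSeries.

Section CommutativeAlgebra.

Definition ideal_gen (A : comNzRingType) (G : A -> Prop) (p : A) : Prop :=
  exists s : seq (A * A),
    (forall u, u \in s -> G u.2) /\ p = \sum_(u <- s) u.1 * u.2.

(* [f] exhibits [O] as the localization of the quotient ring [A / I] at the
   image of the prime ideal [M]; this determines [(O, f)] up to a unique
   isomorphism under [A], see [quotient_localization_exists]. *)
Definition is_quotient_localization (A : comNzRingType) (I M : A -> Prop)
    (O : comUnitRingType) (f : {rmorphism A -> O}) : Prop :=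
  [/\ forall s, ~ M s -> f s \is a GRing.unit,
      forall y : O, exists a s, ~ M s /\ y = f a / f s
    & forall a, f a = 0 <-> exists s, ~ M s /\ I (s * a)].

(* The set of non-units; it is the maximal ideal when [O] is local. *)
Definition max_ideal (O : comUnitRingType) (c : O) : Prop :=
  c \isn't a GRing.unit.

Definition krull_dim_ge (O : comNzRingType) (d : nat) : Prop :=
  exists P : nat -> {pred O},
    (forall i, (i <= d)%N -> idealr_closed (P i) /\ prime_idealr_closed (P i)) /\
    (forall i, (i < d)%N ->
       {subset P i <= P i.+1} /\ exists2 x, x \in P i.+1 & x \notin P i).

End CommutativeAlgebra.

Module QuotientLocalization.
Section Construction.
Local Open Scope quotient_scope.
Variables (A : comNzRingType) (I M : A -> Prop).
Hypothesis I0 : I 0.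
Hypothesis ID : forall a b, I a -> I b -> I (a + b).
Hypothesis IM : forall a b, I b -> I (a * b).
Hypothesis M1 : ~ M 1.
Hypothesis MM : forall a b, ~ M a -> ~ M b -> ~ M (a * b).
Hypothesis IsubM : forall a, I a -> M a.

Record frac := Frac { num : A; den : A; denP : ~ M den }.
HB.instance Definition _ := gen_eqMixin frac.
HB.instance Definition _ := gen_choiceMixin frac.

Definition rel : rel frac := fun x y =>
  `[< exists2 u, ~ M u & I (u * (num x * den y - num y * den x)) >].

Lemma rel_refl : reflexive rel.
Proof. by move=> x; apply/asboolP; exists 1; rewrite // subrr mulr0. Qed.

Lemma rel_sym : ssrbool.symmetric rel.
Proof.
have H x y : rel x y -> rel y x.
  move=> /asboolP[u Mu Iu]; apply/asboolP; exists u => //.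
  by rewrite -[X in I X](_ : -1 * (u * (num x * den y - num y * den x)) = _);
    [apply: IM | ring].
by move=> x y; apply/idP/idP; apply: H.
Qed.

Lemma rel_trans : transitive rel.
Proof.
move=> y x z /asboolP[u Mu Iu] /asboolP[v Mv Iv]; apply/asboolP.
exists (u * v * den y); first by do !apply: MM => //; apply: denP.
rewrite (_ : _ * _ = v * den z * (u * (num x * den y - num y * den x))
  + u * den x * (v * (num y * den z - num z * den y))); last by ring.
by apply: ID; apply: IM.
Qed.

Canonical rel_equiv := EquivRel rel rel_refl rel_sym rel_trans.
Definition loc := {eq_quot rel}.
HB.instance Definition _ := EqQuotient.on loc.
HB.instance Definition _ := Choice.on loc.

Definition mk (x : frac) : loc := \pi_loc x.

Lemma mk_eq x y : num x * den y = num y * den x -> mk x = mk y.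
Proof.
move=> e; apply/eqmodP/asboolP; exists 1 => //.
by rewrite e subrr mulr0.
Qed.

Lemma mkP x y : mk x = mk y <->
  exists2 u, ~ M u & I (u * (num x * den y - num y * den x)).
Proof. by split=> [/eqmodP/asboolP|h] //; apply/eqmodP/asboolP. Qed.

Lemma mk_surj (q : loc) : exists x, q = mk x.
Proof. by exists (repr q); rewrite /mk reprK. Qed.

Definition addf x y :=
  Frac (num x * den y + num y * den x) (MM (@denP x) (@denP y)).
Definition mulf x y := Frac (num x * num y) (MM (@denP x) (@denP y)).
Definition oppf x := Frac (- num x) (@denP x).

Definition addq (p q : loc) := mk (addf (repr p) (repr q)).
Definition mulq (p q : loc) := mk (mulf (repr p) (repr q)).
Definition oppq (p : loc) := mk (oppf (repr p)).

Lemma repr_mk x : exists2 u, ~ M u &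
  I (u * (num (repr (mk x)) * den x - num x * den (repr (mk x)))).
Proof. by apply/mkP; rewrite /mk reprK. Qed.

Lemma addE x y : addq (mk x) (mk y) = mk (addf x y).
Proof.
apply/mkP; have [u Mu Iu] := repr_mk x; have [v Mv Iv] := repr_mk y.
move: (repr (mk x)) (repr (mk y)) Iu Iv => x' y' Iu Iv.
exists (u * v); [exact: MM | rewrite /=].
rewrite (_ : _ * _ = v * den y' * den y * (u * (num x' * den x - num x * den x'))
  + u * den x' * den x * (v * (num y' * den y - num y * den y'))); last by ring.
by apply: ID; apply: IM.
Qed.

Lemma mulE x y : mulq (mk x) (mk y) = mk (mulf x y).
Proof.
apply/mkP; have [u Mu Iu] := repr_mk x; have [v Mv Iv] := repr_mk y.
move: (repr (mk x)) (repr (mk y)) Iu Iv => x' y' Iu Iv.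
exists (u * v); [exact: MM | rewrite /=].
rewrite (_ : _ * _ = v * num y' * den y * (u * (num x' * den x - num x * den x'))
  + u * num x * den x' * (v * (num y' * den y - num y * den y'))); last by ring.
by apply: ID; apply: IM.
Qed.

Lemma oppE x : oppq (mk x) = mk (oppf x).
Proof.
apply/mkP; have [u Mu Iu] := repr_mk x; exists u => //=.
rewrite (_ : _ * _ =
  -1 * (u * (num (repr (mk x)) * den x - num x * den (repr (mk x))))); last by ring.
exact: IM.
Qed.

Definition inj a := mk (Frac (a) M1).

Ltac go := rewrite ?(addE, mulE, oppE); apply: mk_eq => /=; ring.

Lemma addqA : associative addq.
Proof.
move=> p q r; have [[[x ->] [y ->]] [z ->]] := (mk_surj p, mk_surj q, mk_surj r).
go.
Qed.
Lemma addqC : commutative addq.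
Proof. by move=> p q; have [[x ->] [y ->]] := (mk_surj p, mk_surj q); go. Qed.
Lemma add0q : left_id (inj 0) addq.
Proof. by move=> p; have [x ->] := mk_surj p; go. Qed.
Lemma addNq : left_inverse (inj 0) oppq addq.
Proof. by move=> p; have [x ->] := mk_surj p; go. Qed.
HB.instance Definition _ := GRing.isZmodule.Build loc addqA addqC add0q addNq.

Lemma mulqA : associative mulq.
Proof.
move=> p q r; have [[[x ->] [y ->]] [z ->]] := (mk_surj p, mk_surj q, mk_surj r).
go.
Qed.
Lemma mulqC : commutative mulq.
Proof. by move=> p q; have [[x ->] [y ->]] := (mk_surj p, mk_surj q); go. Qed.
Lemma mul1q : left_id (inj 1) mulq.
Proof. by move=> p; have [x ->] := mk_surj p; go. Qed.
Lemma mulqDl : left_distributive mulq addq.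
Proof.
move=> p q r; have [[[x ->] [y ->]] [z ->]] := (mk_surj p, mk_surj q, mk_surj r).
go.
Qed.
Lemma inj_eq0 a : inj a = inj 0 <-> exists s, ~ M s /\ I (s * a).
Proof.
rewrite /inj mkP /=; split=> [[u Mu]|[u [Mu]]]; rewrite ?(mulr1, mul0r, subr0).
  by exists u.
by exists u; rewrite ?mulr1 ?subr0.
Qed.
Lemma oneq_neq0 : inj 1 != inj 0.
Proof.
by apply/eqP => /inj_eq0[s [Ms]]; rewrite mulr1 => /IsubM.
Qed.
HB.instance Definition _ :=
  GRing.Zmodule_isComNzRing.Build loc mulqA mulqC mul1q mulqDl oneq_neq0.

Definition unitq : pred loc := fun x => `[< exists y, y * x = 1 >].
Definition invq (x : loc) : loc :=
  if pselect (exists y, y * x = 1) is left e then sval (cid e) else x.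
Lemma mulVq : {in unitq, left_inverse 1 invq *%R}.
Proof.
move=> x /asboolP e; rewrite /invq; case: pselect => // e'.
exact: svalP (cid e').
Qed.
Lemma unitqP (x y : loc) : y * x = 1 -> unitq x.
Proof. by move=> e; apply/asboolP; exists y. Qed.
Lemma invq_out : {in [predC unitq], invq =1 id}.
Proof.
by move=> x nux; rewrite /invq; case: pselect => // e; case/asboolP: nux.
Qed.
HB.instance Definition _ :=
  GRing.ComNzRing_hasMulInverse.Build loc mulVq unitqP invq_out.

Lemma addlE x y : mk x + mk y = mk (addf x y). Proof. exact: addE. Qed.
Lemma mullE x y : mk x * mk y = mk (mulf x y). Proof. exact: mulE. Qed.
Lemma opplE x : - mk x = mk (oppf x). Proof. exact: oppE. Qed.

Lemma inj_additive : zmod_morphism inj.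
Proof. by move=> a b; rewrite /inj opplE addlE; apply: mk_eq => /=; ring. Qed.
Lemma inj_multiplicative : monoid_morphism inj.
Proof. by split=> // a b; rewrite /inj mullE; apply: mk_eq => /=; ring. Qed.
HB.instance Definition _ := GRing.isZmodMorphism.Build A loc inj inj_additive.
HB.instance Definition _ :=
  GRing.isMonoidMorphism.Build A loc inj inj_multiplicative.

Lemma injP : is_quotient_localization I M (inj : {rmorphism A -> loc}).
Proof.
have U s : ~ M s -> inj s \is a GRing.unit.
  move=> Ms; apply/asboolP; exists (mk (Frac (1) Ms)).
  by rewrite /inj mullE; apply: mk_eq => /=; ring.
split=> //; last exact: inj_eq0.
move=> y; have [x ->] := mk_surj y; exists (num x), (den x); split.
  exact: denP.
apply: (canRL (mulrK (U _ (@denP x)))).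
by rewrite /inj mullE; apply: mk_eq => /=; ring.
Qed.
Lemma loc_exists : exists (O : comUnitRingType) (f : {rmorphism A -> O}),
  is_quotient_localization I M f.
Proof. by exists (loc : comUnitRingType), inj; apply: injP. Qed.

End Construction.
End QuotientLocalization.

Lemma quotient_localization_exists (A : comNzRingType) (I M : A -> Prop) :
  I 0 -> (forall a b, I a -> I b -> I (a + b)) ->
  (forall a b, I b -> I (a * b)) -> (forall a, I a -> M a) ->
  ~ M 1 -> (forall a b, M (a * b) -> M a \/ M b) ->
  exists (O : comUnitRingType) (f : {rmorphism A -> O}),
    is_quotient_localization I M f.
Proof.
move=> I0 ID IM IsubM M1 MM.
have MM' a b : ~ M a -> ~ M b -> ~ M (a * b) by move=> ? ? /MM[].
exact: (QuotientLocalization.loc_exists I0 ID IM M1 MM' IsubM).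
Qed.

Lemma ideal_gen_ideal (A : comNzRingType) (G : A -> Prop) :
  [/\ ideal_gen G 0,
      forall a b, ideal_gen G a -> ideal_gen G b -> ideal_gen G (a + b)
    & forall a b, ideal_gen G b -> ideal_gen G (a * b)].
Proof.
split=> [|a b [s [sG ->]] [t [tG ->]]|a b [s [sG ->]]].
- by exists [::]; rewrite big_nil.
- exists (s ++ t); rewrite big_cat; split=> // u; rewrite mem_cat => /orP[].
    exact: sG.
  exact: tG.
- exists [seq (a * u.1, u.2) | u <- s]; split.
    by move=> _ /mapP[u us ->] /=; exact: sG.
  by rewrite big_map mulr_sumr; apply: eq_bigr => u _; rewrite mulrA.
Qed.

(* A law is given by structure constants: c i j k is the coefficient of e_k in
   [e_i, e_j].  Vectors are row vectors and matrices act on the right. *)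

Section Brackets.
Variables (R : comNzRingType) (n : nat).
Implicit Types (c : 'I_n -> 'I_n -> 'I_n -> R) (u v w : 'rV[R]_n).

Definition bracket c u v : 'rV[R]_n :=
  \row_k \sum_i \sum_j u 0 i * v 0 j * c i j k.

Definition jacobi c (i j k l : 'I_n) : R :=
  \sum_m (c i j m * c m k l + c j k m * c m i l + c k i m * c m j l).

(* Structure constants of s o c o (s^-1 x s^-1), for s' = s^-1. *)
Definition conj_law (s s' : 'M[R]_n) c (i j k : 'I_n) : R :=
  (bracket c (row i s') (row j s') *m s) 0 k.

Definition is_derivation c (D : 'M[R]_n) : Prop :=
  forall u v,
    bracket c u v *m D = bracket c (u *m D) v + bracket c u (v *m D).

(* Chevalley-Eilenberg differential C^1 -> C^2 with adjoint coefficients. *)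
Definition ce_diff c (L : 'M[R]_n) u v : 'rV[R]_n :=
  bracket c u (v *m L) + bracket c (u *m L) v - bracket c u v *m L.

(* Second exterior power of R^n as skew-symmetric matrices (2 is invertible
   in all uses). *)
Definition wedge u v : 'M[R]_n := u^T *m v - v^T *m u.

End Brackets.

Section TorusOfDerivations.
Variables (K : fieldType) (n : nat) (c : 'I_n -> 'I_n -> 'I_n -> K).

Definition is_torus_of_der (U : {vspace 'M[K]_n}) : Prop :=
  (forall D, D \in U -> is_derivation c D /\ diagonalizable D) /\
  (forall D D', D \in U -> D' \in U -> D *m D' = D' *m D).

Definition is_max_torus_of_der (U : {vspace 'M[K]_n}) : Prop :=
  is_torus_of_der U /\
  forall V : {vspace 'M[K]_n}, is_torus_of_der V -> (U <= V)%VS -> V = U.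

End TorusOfDerivations.

(* Indices start at 0: the weight alpha_p is [alpha p.-1], the weights of K^n
   are the [alpha i] for i : 'I_n, and alpha_(n+1) is [alpha n]. *)

Section Weights.
Variables (K : closedFieldType) (T : vectType K) (alpha : nat -> 'Hom(T, K^o)).

Definition weight_act (n : nat) (t : T) : 'M[K]_n :=
  diag_mx (\row_(i < n) (alpha i t : K)).

Definition weight_torus (n : nat) : {vspace 'M[K]_n} :=
  limg (linfun (weight_act n)).

(* The multi-index (i, j, k) stands for the coordinate X^k_ij. *)
Definition mindex_pred (n : nat) : pred ('I_n * 'I_n * 'I_n) :=
  fun x => (x.1.1 < x.1.2)%N && (alpha x.1.1 + alpha x.1.2 == alpha x.2).

Definition mindex (n : nat) := {x : 'I_n * 'I_n * 'I_n | mindex_pred x}.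
HB.instance Definition _ n := Finite.on (mindex n).
HB.instance Definition _ n := SubType.on (mindex n).

Definition target n (a : mindex n) : 'I_n := (val a).2.

(* Structure constants of the law with coordinates x. *)
Definition sc (R : comNzRingType) n (x : mindex n -> R) (i j k : 'I_n) : R :=
  if (insub (i, j, k) : option (mindex n)) is Some a then x a
  else if (insub (j, i, k) : option (mindex n)) is Some a then - x a
  else 0.

(* R-points of the scheme of T-invariant Lie laws. *)
Definition is_law (R : comNzRingType) n (x : {ffun mindex n -> R}) : Prop :=
  forall i j k l, jacobi (sc x) i j k l = 0.

(* K-points of the closed subscheme defined by X_a = 1 for a in A. *)
Definition is_law_on n (A : {set mindex n}) (x : {ffun mindex n -> K}) : Prop :=
  is_law x /\ forall a, a \in A -> x a = 1.

Definition Sigma n (phi : {ffun mindex n -> K}) : Prop :=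
  is_law phi /\ is_max_torus_of_der (sc phi) (weight_torus n).

Definition weight_path (n0 : nat) : Prop :=
  [/\ <<[seq alpha i | i <- iota 0 n0]>>%VS = fullv,
      exists t : T, forall i, (i < n0)%N ->
        exists2 q : rat, 0 < q & (alpha i t : K) = ratr q,
      forall n, (n0 <= n)%N -> exists phi : {ffun mindex n -> K}, Sigma phi
    & forall n, (n0 <= n)%N -> forall i j, (i < n)%N -> (j < n)%N ->
        alpha n <> alpha i - alpha j].

Definition simple_path (n0 : nat) : Prop := weight_path n0 /\ injective alpha.

Definition widen n (i : 'I_n) : 'I_n.+1 := widen_ord (leqnSn n) i.

Definition mindex_widen n (a : mindex n) : mindex n.+1 :=
  exist (@mindex_pred n.+1)
    (widen (val a).1.1, widen (val a).1.2, widen (val a).2) (valP a).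

Definition law_proj n (psi : {ffun mindex n.+1 -> K}) : {ffun mindex n -> K} :=
  [ffun a => psi (mindex_widen a)].

(* The cocycle X^(n+1)_ij of the central extension psi of phi by K e_(n+1)
   is a coboundary. *)
Definition trivial_extension n (phi : {ffun mindex n -> K})
    (psi : {ffun mindex n.+1 -> K}) : Prop :=
  exists f : 'I_n -> K, forall i j,
    sc psi (widen i) (widen j) ord_max = \sum_l f l * sc phi i j l.

Local Notation cochain2 n := {ffun 'I_n * 'I_n * 'I_n -> K^o}.

Definition ce_coord n (phi : {ffun mindex n -> K}) (L : 'M[K]_n) : cochain2 n :=
  [ffun x : 'I_n * 'I_n * 'I_n => ce_diff (sc phi) L (delta_mx 0 x.1.1) (delta_mx 0 x.1.2) 0 x.2].

Definition B2 n (phi : {ffun mindex n -> K}) : {vspace cochain2 n} :=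
  limg (linfun (ce_coord phi)).

Definition inv_cochain1 n : {vspace 'M[K]_n} :=
  (\bigcap_(t <- vbasis (fullv : {vspace T}))
    lker (linfun (fun L : 'M[K]_n =>
      L *m weight_act n t - weight_act n t *m L)))%VS.

Definition inv_cochain2 n : {vspace cochain2 n} :=
  lker (linfun (fun f : cochain2 n =>
    [ffun x : 'I_n * 'I_n * 'I_n => if alpha x.1.1 + alpha x.1.2 == alpha x.2 then 0 else f x]
      : cochain2 n)).

(* Rank of the family of forms L |-> (d_phi L)^a, a in A, on (C^1)^T. *)
Definition forms_rank n (phi : {ffun mindex n -> K}) (A : {set mindex n}) :
    nat :=
  \dim (linfun (fun L : 'M[K]_n =>
          [ffun a : mindex n => if a \in A then ce_coord phi L (val a) else 0]
            : {ffun mindex n -> K^o})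
        @: inv_cochain1 n)%VS.

Definition admissible n (phi : {ffun mindex n -> K}) (A : {set mindex n}) :
    bool :=
  minset (fun A' => forms_rank phi A' == \dim (B2 phi :&: inv_cochain2 n)%VS) A.

(* [a] is the multi-index (n+1; pq). *)
Definition direct_filiation n (A : {set mindex n}) (A1 : {set mindex n.+1})
    (a : mindex n.+1) : Prop :=
  [/\ target a = ord_max,
      A1 = a |: [set mindex_widen b | b in A],
      #|A| = (n - \dim {:T})%N,
      #|A1| = (n.+1 - \dim {:T})%N
    & exists (phi : {ffun mindex n -> K}) (psi : {ffun mindex n.+1 -> K}),
      [/\ Sigma phi /\ admissible phi A, Sigma psi /\ admissible psi A1,
          law_proj psi = phi & ~ trivial_extension phi psi]].

Local Notation e i := (delta_mx 0 i).

(* d : Lambda^2 -> Lambda^1, x /\ y |-> [x, y]. *)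
Definition d_2 n (phi : {ffun mindex n -> K}) (W : 'M[K]_n) : 'rV[K]_n :=
  \sum_(i < n) \sum_(j < n | (i < j)%N) W i j *: bracket (sc phi) (e i) (e j).

(* d : Lambda^3 -> Lambda^2 on the basis vectors e_i /\ e_j /\ e_k. *)
Definition d_3 n (phi : {ffun mindex n -> K}) (i j k : 'I_n) : 'M[K]_n :=
  wedge (bracket (sc phi) (e i) (e j)) (e k)
  + wedge (bracket (sc phi) (e j) (e k)) (e i)
  + wedge (bracket (sc phi) (e k) (e i)) (e j).

Definition Z_2 n (phi : {ffun mindex n -> K}) : {vspace 'M[K]_n} :=
  (<<[seq wedge (e x.1) (e x.2) | x : 'I_n * 'I_n]>>
   :&: lker (linfun (d_2 phi)))%VS.

Definition B_2 n (phi : {ffun mindex n -> K}) : {vspace 'M[K]_n} :=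
  <<[seq d_3 phi x.1.1 x.1.2 x.2 | x : 'I_n * 'I_n * 'I_n]>>%VS.

(* x /\ y |-> tx /\ y + x /\ ty. *)
Definition wedge_act n (t : T) (W : 'M[K]_n) : 'M[K]_n :=
  weight_act n t *m W + W *m weight_act n t.

(* The cycles whose class in H_2 = Z_2 / B_2 has weight beta. *)
Definition Z_2_weight n (phi : {ffun mindex n -> K}) (beta : 'Hom(T, K^o)) :
    {vspace 'M[K]_n} :=
  (Z_2 phi :&:
   \bigcap_(t <- vbasis (fullv : {vspace T}))
     (linfun (fun W : 'M[K]_n => wedge_act t W - (beta t : K) *: W)
      @^-1: B_2 phi))%VS.

Definition dim_H_2_weight n (phi : {ffun mindex n -> K})
    (beta : 'Hom(T, K^o)) : nat :=
  (\dim (Z_2_weight phi beta) - \dim (B_2 phi))%N.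

Local Notation coord_ring n := {mpoly K[#|{: mindex n}|]}.

Definition coordX n (a : mindex n) : coord_ring n := 'X_(enum_rank a).

Inductive scheme_eq n (A : {set mindex n}) : coord_ring n -> Prop :=
| JacobiEq i j k l : scheme_eq A (jacobi (sc (@coordX n)) i j k l)
| OneEq a : a \in A -> scheme_eq A (coordX a - 1).

Definition point_ideal n (phi : {ffun mindex n -> K}) (p : coord_ring n) :
    Prop :=
  p.@[fun i => phi (enum_val i)] = 0.

(* f : K[X] -> O makes O the local ring at phi of the scheme of T-invariant
   laws with X_a = 1 for a in A. *)
Definition is_local_ring n (A : {set mindex n}) (phi : {ffun mindex n -> K})
    (O : comUnitRingType) (f : {rmorphism coord_ring n -> O}) : Prop :=
  is_quotient_localization (ideal_gen (scheme_eq A)) (point_ideal phi) f.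

Lemma local_ring_exists n (A : {set mindex n}) (phi : {ffun mindex n -> K}) :
  is_law_on A phi ->
  exists (O : comUnitRingType) (f : {rmorphism coord_ring n -> O}),
    is_local_ring A phi f.
Proof.
case=> philaw phi1.
have [I0 ID IM] := ideal_gen_ideal (scheme_eq A).
have ev a : (coordX a).@[fun i => phi (enum_val i)] = phi a.
  by rewrite mevalXU enum_rankK.
have evsc i j k :
    (sc (@coordX n) i j k).@[fun i => phi (enum_val i)] = sc phi i j k.
  by rewrite /sc; do 2?[case: insub => [a|]]; rewrite ?mevalN ?ev ?meval0.
apply: quotient_localization_exists => //.
- move=> p [s [sG ->]]; rewrite /point_ideal rmorph_sum big_seq big1 // => u us.
  rewrite /= mevalM; case: u.2 / (sG u us) => [i j k l|a aA].
    suff -> : (jacobi (sc (@coordX n)) i j k l).@[fun i => phi (enum_val i)]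
        = jacobi (sc phi) i j k l by rewrite philaw mulr0.
    rewrite rmorph_sum; apply: eq_bigr => m _ /=.
    by rewrite !mevalD !mevalM !evsc.
  by rewrite mevalB ev meval1 phi1 // subrr mulr0.
- by rewrite /point_ideal meval1; apply/eqP; rewrite oner_eq0.
- move=> p q /eqP; rewrite /point_ideal mevalM mulf_eq0.
  by case/orP => /eqP; [left|right].
Qed.

(* The morphism of coordinate rings underlying pi_(n+1). *)
Definition proj_comorph n (p : coord_ring n) : coord_ring n.+1 :=
  mmap (@mpolyC _ K) (fun i => coordX (mindex_widen (enum_val i))) p.

Definition Lambda n : {set 'I_n * 'I_n * 'I_n} :=
  [set x : 'I_n * 'I_n * 'I_n |
     [&& (x.1.1 < x.1.2)%N, (x.1.2 < x.2)%N
             & alpha x.1.1 + alpha x.1.2 + alpha x.2 == alpha n]].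

(* Equation of index x of (B): the new Jacobi polynomial at Y = phi, with X_a
   set to 1.  Only the values of X at the multi-indices of target n+1 other
   than a matter, since l and m range over 'I_n. *)
Definition B_lhs n (phi : {ffun mindex n -> K}) (a : mindex n.+1)
    (X : mindex n.+1 -> K) (x : 'I_n * 'I_n * 'I_n) : K :=
  let Xn (l m : 'I_n) :=
    sc (fun b => if b == a then 1 else X b) (widen l) (widen m) ord_max in
  let: (i, j, k) := x in
  \sum_l (sc phi i j l * Xn l k + sc phi j k l * Xn l i + sc phi k i l * Xn l j).

Definition B_equiv n (phi : {ffun mindex n -> K}) (a : mindex n.+1)
    (L1 : {set 'I_n * 'I_n * 'I_n}) : Prop :=
  forall X : mindex n.+1 -> K,
    (forall x, x \in L1 -> B_lhs phi a X x = 0) <->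
    (forall x, x \in Lambda n -> B_lhs phi a X x = 0).

Definition min_subsystem n (phi : {ffun mindex n -> K}) (a : mindex n.+1)
    (L1 : {set 'I_n * 'I_n * 'I_n}) : Prop :=
  [/\ L1 \subset Lambda n, B_equiv phi a L1
    & forall L2 : {set 'I_n * 'I_n * 'I_n}, L2 \subset L1 -> B_equiv phi a L2 -> L2 = L1].

Definition rigid n (phi : {ffun mindex n -> K}) : Prop :=
  forall psi : {ffun mindex n -> fps K},
    is_law psi -> (forall a, fps_coef (psi a) 0 = phi a) ->
    exists s s' : 'M[fps K]_n,
      [/\ s *m s' = 1%:M /\ s' *m s = 1%:M,
          map_mx (fun f => fps_coef f 0) s = 1%:M,
          forall t, s *m map_mx (@fpsC K) (weight_act n t)
                    = map_mx (@fpsC K) (weight_act n t) *m s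
        & forall i j k,
            conj_law s s' (sc (fun a => fpsC (phi a))) i j k = sc psi i j k].

End Weights.

Section AffineEquations.
Variables (O : comUnitRingType) (d : nat).

(* The ideal m(O)[T] + sum_k T_k O[T]. *)
Definition origin_ideal : {mpoly O[d]} -> Prop :=
  ideal_gen (fun p => (exists2 c, max_ideal c & p = c%:MP) \/
                      (exists k, p = 'X_k)).

(* The ideal generated by the c0 x + sum_k c x k T_k, x in S. *)
Definition affine_ideal (I : finType) (S : {set I}) (c0 : I -> O)
    (c : I -> 'I_d -> O) : {mpoly O[d]} -> Prop :=
  ideal_gen (fun p => exists2 x, x \in S &
    p = (c0 x)%:MP + \sum_(k < d) (c x k)%:MP * 'X_k).

End AffineEquations.

(* Main.v *)
Require Import Defs.
From HB Require Import structures.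
From mathcomp Require Import all_boot all_order all_algebra.
From mathcomp Require Import boolp.
From mathcomp Require Import ring.
From mathcomp Require Import mpoly.

Set Implicit Arguments.
Unset Strict Implicit.
Unset Printing Implicit Defensive.

Import GRing.Theory.
Local Open Scope ring_scope.

(* The weight conditions make e_(n+1) central in every law of dimension n+1, so
   such a law is a law of dimension n together with a 2-cocycle of weight
   alpha_(n+1), and its new Jacobi equations are linear in the new coordinates.
   Over the residue field, these equations are the pairings with the boundaries
   of weight alpha_(n+1), so that H_2 measures their solutions: once X_pq = 1,
   the solutions form an affine space of dimension nu - 1, and the equations of
   Lambda_1 have independent linear parts.  Over the local ring O_n, the latter
   can then be solved for all but nu - 1 coordinates T_k; substituting in the
   remaining equations gives the presentation of O_(n+1).  The fiber is an
   affine space, whence a flag of linear subspaces bounding the Krull dimension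
   below.  Since the weights are distinct, conjugations commuting with T are
   diagonal.  For nu = 1 a cocycle over K[[t]] is determined by its coordinate
   at pq, which a rescaling of e_(n+1) corrects; for nu > 1 a line in the fiber
   is a deformation whose triviality at first order is excluded by the
   admissibility of A_(n+1) and the maximality of the torus. *)

(** * Central extensions and cocycles *)

(** The system (B) is affine, and minimality of Lambda_1 does not make its linear parts independent
    when it is inconsistent. Independence is drawn from a given point of the fiber, subtracted from
    every solution; hence nu = 0 is treated by assuming a point and deriving nu > 0. The parameters
    are T = N (X - phi_(n+1)) with N constant, so that the origin corresponds to phi_(n+1). The
    c^lambda lie in the maximal ideal because, over the residue field, solutions of the subsystem
    Lambda_1 solve all of (B). A local ring is known only through the clauses of
    [is_quotient_localization]. The delicate one is the kernel of O_n[T] -> O_(n+1): it is found by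
    mapping O_(n+1) to an auxiliary localization of O_n[T], that is, by writing down a law with
    values in the latter. The same identities thus serve over K, O_n, O_n[T], K[T] and K[[t]], which
    is why coordinates and cocycles are taken over an arbitrary commutative ring. *)

Section StructureConstants.
Variables (K : closedFieldType) (T : vectType K) (alpha : nat -> 'Hom(T, K^o)).
Variables (R : comNzRingType) (n : nat).
Implicit Types (x y : mindex alpha n -> R) (i j k : 'I_n).

Lemma insub_mindex (a : mindex alpha n) :
  insub ((val a).1.1, (val a).1.2, (val a).2) = Some a.
Proof. by case: a => [[[i j] k] h]; rewrite insubT. Qed.

Lemma sc_mindex x (a : mindex alpha n) :
  sc x (val a).1.1 (val a).1.2 (val a).2 = x a.
Proof. by rewrite /sc insub_mindex. Qed.

Lemma sc_antisym x i j k : sc x i j k = - sc x j i k.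
Proof.
rewrite /sc; case: insubP => [a /andP[/= ij _] _|_].
  rewrite insubN ?opprK //.
  by rewrite /mindex_pred /= negb_and -leqNgt ltnW.
by case: insubP => [a _ _|_]; rewrite ?opprK // oppr0.
Qed.

Lemma sc_diag x i k : sc x i i k = 0.
Proof. by rewrite /sc insubN ?insubN // /mindex_pred /= ltnn. Qed.

Lemma sc_eq0 x i j k : alpha i + alpha j != alpha k -> sc x i j k = 0.
Proof.
move=> h; rewrite /sc !insubN // /mindex_pred /= negb_and ?h ?orbT //.
by rewrite addrC h orbT.
Qed.

Lemma eq_sc x y i j k : x =1 y -> sc x i j k = sc y i j k.
Proof. by move=> e; rewrite /sc; do 2?case: insub => [?|]; rewrite ?e. Qed.

Lemma sc_combine x y (r s : R) i j k :
  sc (fun a => r * x a + s * y a) i j k = r * sc x i j k + s * sc y i j k.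
Proof.
by rewrite /sc; do 2?case: insub => [?|]; rewrite ?mulrN ?opprD ?mulr0 ?addr0.
Qed.

Lemma sc_sum (I : finType) (r : I -> R) (z : I -> mindex alpha n -> R) i j k :
  sc (fun a => \sum_b r b * z b a) i j k = \sum_b r b * sc (z b) i j k.
Proof.
rewrite /sc; do 2?case: insub => [a|] //; last by rewrite big1 // => b; rewrite mulr0.
by rewrite -sumrN; apply: eq_bigr => b _; rewrite mulrN.
Qed.

End StructureConstants.

Lemma sc_rmorph (K : closedFieldType) (T : vectType K)
    (alpha : nat -> 'Hom(T, K^o)) (R S : comNzRingType) (f : {rmorphism R -> S}) n
    (x : mindex alpha n -> R) i j k :
  f (sc x i j k) = sc (fun a => f (x a)) i j k.
Proof. by rewrite /sc; do 2?case: insub => [?|]; rewrite ?rmorphN ?rmorph0. Qed.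

Lemma jacobi_rmorph (R S : comNzRingType) (f : {rmorphism R -> S}) n
    (c : 'I_n -> 'I_n -> 'I_n -> R) i j k l :
  f (jacobi c i j k l) = jacobi (fun i j k => f (c i j k)) i j k l.
Proof.
by rewrite /jacobi rmorph_sum; apply: eq_bigr => m _; rewrite !rmorphD !rmorphM.
Qed.

Lemma eq_jacobi (R : comNzRingType) n (c d : 'I_n -> 'I_n -> 'I_n -> R) i j k l :
  (forall i j k, c i j k = d i j k) -> jacobi c i j k l = jacobi d i j k l.
Proof. by move=> e; rewrite /jacobi; apply: eq_bigr => m _; rewrite !e. Qed.

(* The 2-cochain X is a cocycle of the law c (trivial coefficients) iff these
   expressions vanish. *)
Definition cocycle_lhs (R : comNzRingType) n (c : 'I_n -> 'I_n -> 'I_n -> R)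
    (X : 'I_n -> 'I_n -> R) (t : 'I_n * 'I_n * 'I_n) : R :=
  \sum_l (c t.1.1 t.1.2 l * X l t.2 + c t.1.2 t.2 l * X l t.1.1
          + c t.2 t.1.1 l * X l t.1.2).

Lemma eq_cocycle_lhs (R : comNzRingType) n (c d : 'I_n -> 'I_n -> 'I_n -> R)
    (X Y : 'I_n -> 'I_n -> R) t :
  (forall i j k, c i j k = d i j k) -> (forall i j, X i j = Y i j) ->
  cocycle_lhs c X t = cocycle_lhs d Y t.
Proof. by move=> e e'; apply: eq_bigr => l _; rewrite !e !e'. Qed.

Lemma cocycle_lhs_rmorph (R S : comNzRingType) (f : {rmorphism R -> S}) n
    (c : 'I_n -> 'I_n -> 'I_n -> R) X t :
  f (cocycle_lhs c X t) =
  cocycle_lhs (fun i j k => f (c i j k)) (fun i j => f (X i j)) t.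
Proof. by rewrite rmorph_sum; apply: eq_bigr => l _; rewrite !rmorphD !rmorphM. Qed.

Section ExtensionLaws.
Variables (K : closedFieldType) (T : vectType K) (alpha : nat -> 'Hom(T, K^o)).
Variables (n : nat).
Hypothesis alpha_neq0 : forall i, (i <= n)%N -> alpha i != 0.
Hypothesis alpha_new : forall i j, (i < n)%N -> (j < n)%N ->
  alpha n <> alpha i - alpha j.

Local Notation mx a := (mindex_widen a).

(** This is the centrality of e_(n+1): a source equal to n would force alpha i = 0 (when k = n) or
    alpha n = alpha k - alpha i (when k < n). *)
Lemma mindex_source_lt (a : mindex alpha n.+1) :
  ((val a).1.1 < n)%N && ((val a).1.2 < n)%N.
Proof.
case: a => [[[i j] k] /andP[/= ij /eqP e]].
have jn : (j < n)%N.
  have : (j <= n)%N by rewrite -ltnS.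
  rewrite leq_eqVlt => /orP[/eqP jn|//].
  have := ltn_ord k; rewrite ltnS leq_eqVlt => /orP[/eqP kn|kn].
    have := alpha_neq0 (ltnW (leq_trans ij (leq_ord j))).
    by rewrite -(inj_eq (addIr (alpha j))) e add0r jn kn eqxx.
  case: (@alpha_new k i); rewrite ?kn ?(leq_trans ij (leq_ord j)) //.
  by rewrite -e jn addrAC subrr add0r.
by rewrite jn (ltn_trans ij jn).
Qed.

Lemma mindex_widen_inj : injective (@mindex_widen _ _ alpha n).
Proof.
move=> a b [] /(@ord_inj _ _ _) h1 /ord_inj h2 /ord_inj h3; apply: val_inj.
by case: a b h1 h2 h3 => [[[? ?] ?] ?] [[[? ?] ?] ?] /= -> -> ->.
Qed.

Lemma target_widen (a : mindex alpha n) : target (mindex_widen a) != ord_max.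
Proof. by rewrite -(inj_eq val_inj) neq_ltn (ltn_ord (target a)). Qed.

Lemma mindex_cases (a : mindex alpha n.+1) :
  target a != ord_max -> exists b, a = mindex_widen b.
Proof.
have := mindex_source_lt a; rewrite /target.
case: a => [[[i j] k] h] /= /andP[hi hj] nk.
have hk : (k < n)%N by rewrite ltn_neqAle -ltnS ltn_ord andbT.
exists (exist (@mindex_pred _ _ alpha n)
  (Ordinal hi, Ordinal hj, Ordinal hk) h).
by apply: val_inj; congr (_, _, _); apply: val_inj.
Qed.

Variable R : comNzRingType.
Implicit Types x : mindex alpha n.+1 -> R.

Definition old_part x (a : mindex alpha n) : R := x (mindex_widen a).
(** Seen as a bilinear form on the quotient by e_(n+1), this is the cocycle of the central
    extension. *)
Definition new_part x (i j : 'I_n) : R := sc x (widen i) (widen j) ord_max.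

Lemma sc_maxl x j k : sc x ord_max j k = 0.
Proof.
rewrite /sc; case: insubP => [a _ e|_].
  by have := mindex_source_lt a; rewrite e /= ltnn.
by case: insubP => [a _ e|//]; have := mindex_source_lt a; rewrite e /= ltnn andbF.
Qed.

Lemma sc_maxr x i k : sc x i ord_max k = 0.
Proof. by rewrite sc_antisym sc_maxl oppr0. Qed.

Lemma insub_widen i j k :
  (insub (widen i, widen j, widen k) : option (mindex alpha n.+1)) =
  omap (@mindex_widen _ _ alpha n) (insub (i, j, k)).
Proof.
case: (boolP (mindex_pred alpha (i, j, k))) => h.
  by rewrite (insubT _ h) insubT /=; congr Some; apply: val_inj.
by rewrite (insubN _ h) insubN.
Qed.

Lemma sc_widen x i j k :
  sc x (widen i) (widen j) (widen k) = sc (old_part x) i j k.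
Proof. by rewrite /sc !insub_widen; case: insub => //=; case: insub. Qed.

Lemma ord_max_or_widen (i : 'I_n.+1) : i = ord_max \/ exists j, i = widen j.
Proof.
have := leq_ord i; rewrite leq_eqVlt => /orP[/eqP e|lt].
  by left; apply: val_inj.
by right; exists (Ordinal lt); apply: val_inj.
Qed.

Lemma jacobi_widen x i j k l :
  jacobi (sc x) (widen i) (widen j) (widen k) (widen l) =
  jacobi (sc (old_part x)) i j k l.
Proof.
rewrite /jacobi big_ord_recr /= !sc_maxl !mulr0 !addr0.
by apply: eq_bigr => m _; rewrite -!sc_widen.
Qed.

Lemma jacobi_new x i j k :
  jacobi (sc x) (widen i) (widen j) (widen k) ord_max =
  cocycle_lhs (sc (old_part x)) (new_part x) (i, j, k).
Proof.
rewrite /jacobi big_ord_recr /= !sc_maxl !mulr0 !addr0.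
by apply: eq_bigr => m _ /=; rewrite -!sc_widen.
Qed.

Lemma jacobi_max x i j k l :
  [|| i == ord_max, j == ord_max | k == ord_max] -> jacobi (sc x) i j k l = 0.
Proof.
move=> h; apply: big1 => m _; case/or3P: h => /eqP ->;
  by rewrite !(sc_maxl, sc_maxr) ?(mul0r, mulr0) !addr0.
Qed.

Lemma new_part_antisym x i j : new_part x i j = - new_part x j i.
Proof. exact: sc_antisym. Qed.

Lemma new_part_diag x i : new_part x i i = 0.
Proof. exact: sc_diag. Qed.

Lemma new_part_eq0 x (i j : 'I_n) : alpha i + alpha j != alpha n -> new_part x i j = 0.
Proof. by move=> h; apply: sc_eq0. Qed.

Section Cocycle.
Variables (c : mindex alpha n -> R) (X : 'I_n -> 'I_n -> R).
Hypothesis X_weight : forall i j : 'I_n, alpha i + alpha j != alpha n -> X i j = 0.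
Local Notation F := (cocycle_lhs (sc c) X).

Lemma cocycle_lhs_weight (t : 'I_n * 'I_n * 'I_n) :
  alpha t.1.1 + alpha t.1.2 + alpha t.2 != alpha n -> F t = 0.
Proof.
case: t => [[i j] k] /= h; apply: big1 => l _ /=.
have z (a b d : 'I_n) : alpha a + alpha b + alpha d != alpha n ->
    sc c a b l * X l d = 0.
  move=> h'; have [e|e] := eqVneq (alpha a + alpha b) (alpha l).
    by rewrite (X_weight (i := l)) ?mulr0 -?e.
  by rewrite (sc_eq0 _ e) mul0r.
rewrite !z ?addr0 //; first by rewrite -addrA addrC.
by rewrite addrC addrA.
Qed.

Lemma cocycle_lhs_swap i j k : F (i, j, k) = - F (j, i, k).
Proof.
rewrite /cocycle_lhs -sumrN; apply: eq_bigr => l _ /=.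
rewrite (sc_antisym c i j) (sc_antisym c j k) (sc_antisym c k i); ring.
Qed.

Lemma cocycle_lhs_rot i j k : F (i, j, k) = F (j, k, i).
Proof. by apply: eq_bigr => l _ /=; ring. Qed.

Lemma cocycle_lhs_diag i k : F (i, i, k) = 0.
Proof.
apply: big1 => l _ /=; rewrite sc_diag (sc_antisym c k i); ring.
Qed.

(** The expression is alternating in its three indices and vanishes unless their weights add up to
    alpha_(n+1), so only the increasing triples of [Lambda] matter. *)
Lemma cocycle_lhs_Lambda :
  (forall t, t \in Lambda alpha n -> F t = 0) -> forall t, F t = 0.
Proof.
move=> h.
have inc (i j k : 'I_n) : (i < j)%N -> (j < k)%N -> F (i, j, k) = 0.
  move=> ij jk; have [e|e] := eqVneq (alpha i + alpha j + alpha k) (alpha n).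
    by apply: h; rewrite inE /= ij jk e eqxx.
  exact: cocycle_lhs_weight.
have inc2 (i j k : 'I_n) : (i < j)%N -> F (i, j, k) = 0.
  move=> ij; case: (ltngtP j k) => [jk|kj|/ord_inj <-]; first exact: inc.
    case: (ltngtP i k) => [ik|ki|/ord_inj <-].
    - by rewrite cocycle_lhs_rot cocycle_lhs_rot cocycle_lhs_swap inc ?oppr0.
    - by rewrite -cocycle_lhs_rot inc.
    - by rewrite -cocycle_lhs_rot cocycle_lhs_diag.
  by rewrite cocycle_lhs_rot cocycle_lhs_diag.
move=> [[i j] k]; case: (ltngtP i j) => [ij|ji|/ord_inj <-].
- exact: inc2.
- by rewrite cocycle_lhs_swap inc2 ?oppr0.
- exact: cocycle_lhs_diag.
Qed.

End Cocycle.

(** Converse of [jacobi_old] and [cocycle_new]: this produces laws of dimension n+1 over a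
    localization of O_n[T], over K[T] and over K[[t]]. *)
Lemma jacobi_extension x :
  (forall i j k l, jacobi (sc (old_part x)) i j k l = 0) ->
  (forall t, t \in Lambda alpha n ->
     cocycle_lhs (sc (old_part x)) (new_part x) t = 0) ->
  forall i j k l, jacobi (sc x) i j k l = 0.
Proof.
move=> J C i j k l.
have [->|[i' ->]] := ord_max_or_widen i; first by rewrite jacobi_max ?eqxx.
have [->|[j' ->]] := ord_max_or_widen j; first by rewrite jacobi_max ?eqxx ?orbT.
have [->|[k' ->]] := ord_max_or_widen k; first by rewrite jacobi_max ?eqxx ?orbT.
have [->|[l' ->]] := ord_max_or_widen l; last by rewrite jacobi_widen.
rewrite jacobi_new; exact: (cocycle_lhs_Lambda (@new_part_eq0 x)).
Qed.

Lemma jacobi_old x :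
  (forall i j k l, jacobi (sc x) i j k l = 0) ->
  forall i j k l, jacobi (sc (old_part x)) i j k l = 0.
Proof. by move=> J i j k l; rewrite -jacobi_widen. Qed.

Lemma cocycle_new x :
  (forall i j k l, jacobi (sc x) i j k l = 0) ->
  forall t, cocycle_lhs (sc (old_part x)) (new_part x) t = 0.
Proof. by move=> J [[i j] k]; rewrite -jacobi_new. Qed.

End ExtensionLaws.

(** * Coordinates on the fiber and coefficients of the new Jacobi equations *)

Section NewCoordinates.
Variables (K : closedFieldType) (T : vectType K) (alpha : nat -> 'Hom(T, K^o)).
Variables (n : nat) (pq : mindex alpha n.+1).
Hypothesis pq_new : target pq = ord_max.

Definition free_coords : {set mindex alpha n.+1} :=
  [set b | (target b == ord_max) && (b != pq)].
Local Notation M := free_coords.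

Lemma enum_val_free (j : 'I_#|M|) :
  (target (enum_val j) == ord_max) && (enum_val j != pq).
Proof. by have := enum_valP j; rewrite inE. Qed.

Section Ring.
Variable R : comNzRingType.
Implicit Types (x : mindex alpha n -> R) (z : mindex alpha n.+1 -> R).

(* The coordinates with X_pq = 1, old part x and free new coordinates Y. *)
Definition assemble x (Y : 'I_#|M| -> R) (b : mindex alpha n.+1) : R :=
  (b == pq)%:R + \sum_j Y j * (enum_val j == b)%:R
  + \sum_a x a * (mindex_widen a == b)%:R.

Lemma assemble_pq x Y : assemble x Y pq = 1.
Proof.
rewrite /assemble eqxx !big1 ?addr0 // => [a|j] _.
  have := target_widen a; have [->|_ _] := eqVneq (mindex_widen a) pq.
    by rewrite pq_new eqxx.
  by rewrite mulr0.
by have /andP[_ /negbTE ->] := enum_val_free j; rewrite mulr0.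
Qed.

Lemma assemble_free x Y j : assemble x Y (enum_val j) = Y j.
Proof.
have /andP[t /negbTE p] := enum_val_free j.
rewrite /assemble p add0r (bigD1 j) //= eqxx mulr1 !big1 ?addr0 // => [a|i ij].
  rewrite (_ : _ == _ = false) ?mulr0 //.
  by apply/eqP => e; have := target_widen a; rewrite e t.
by rewrite (inj_eq enum_val_inj) (negbTE ij) mulr0.
Qed.

Lemma assemble_old x Y : old_part (assemble x Y) =1 x.
Proof.
move=> a; rewrite /old_part /assemble (_ : _ == _ = false) ?add0r.
  rewrite big1 ?add0r => [|j _].
    rewrite (bigD1 a) //= eqxx mulr1 big1 ?addr0 // => b ba.
    by rewrite (inj_eq (@mindex_widen_inj _ _ _ _)) (negbTE ba) mulr0.
  have /andP[t _] := enum_val_free j.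
  rewrite (_ : _ == _ = false) ?mulr0 //.
  by apply/eqP => e; have := target_widen a; rewrite -e t.
by apply/eqP => e; have := target_widen a; rewrite e pq_new eqxx.
Qed.

(** By linearity, the value at the unit vector of b is the coefficient of X_b in the new Jacobi
    polynomial of index t; b = pq gives the constant term once X_pq = 1. *)
Definition cocycle_coef (c : 'I_n -> 'I_n -> 'I_n -> R) (b : mindex alpha n.+1)
    (t : 'I_n * 'I_n * 'I_n) : R :=
  cocycle_lhs c (new_part (fun b' => (b' == b)%:R)) t.

Lemma new_part_delta (b : mindex alpha n.+1) i j : target b != ord_max ->
  new_part (fun b' => (b' == b)%:R : R) i j = 0.
Proof.
rewrite /new_part /sc => h.
case: insubP => [a _ e|_].
  case: eqP => // ab; case/eqP: h; by rewrite -ab /target e.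
case: insubP => [a _ e|//].
case: eqP => [ab|]; last by rewrite oppr0.
by case/eqP: h; rewrite -ab /target e.
Qed.

Lemma cocycle_lhs_coef c z t :
  cocycle_lhs c (new_part z) t =
  \sum_(b | target b == ord_max) z b * cocycle_coef c b t.
Proof.
have e i j : new_part z i j =
    \sum_(b | target b == ord_max) z b * new_part (fun b' => (b' == b)%:R) i j.
  transitivity (\sum_b z b * new_part (fun b' => (b' == b)%:R) i j).
    rewrite /new_part -sc_sum; apply: eq_sc => a.
    rewrite (bigD1 a) //= eqxx mulr1 big1 ?addr0 // => b ba.
    by rewrite eq_sym (negbTE ba) mulr0.
  rewrite [RHS]big_mkcond; apply: eq_bigr => b _.
  by case: ifP => // /negbT h; rewrite new_part_delta ?mulr0.
under [RHS]eq_bigr => b _ do rewrite /cocycle_coef mulr_sumr.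
rewrite exchange_big /=; apply: eq_bigr => l _.
rewrite !e !mulr_sumr -!big_split /=; apply: eq_bigr => b _; ring.
Qed.

Lemma sum_target_max (F : mindex alpha n.+1 -> R) :
  \sum_(b | target b == ord_max) F b = F pq + \sum_(j < #|M|) F (enum_val j).
Proof.
rewrite (bigD1 pq) ?pq_new //=; congr (_ + _).
by rewrite -(big_enum_val F); apply: eq_bigl => b; rewrite inE.
Qed.

Lemma cocycle_assemble c x Y t :
  cocycle_lhs c (new_part (assemble x Y)) t =
  cocycle_coef c pq t + \sum_j Y j * cocycle_coef c (enum_val j) t.
Proof.
rewrite cocycle_lhs_coef sum_target_max assemble_pq mul1r; congr (_ + _).
by apply: eq_bigr => j _; rewrite assemble_free.
Qed.

End Ring.

Section Morphism.
Variables (R S : comNzRingType) (f : {rmorphism R -> S}).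

Lemma new_part_rmorph (z : mindex alpha n.+1 -> R) i j :
  f (new_part z i j) = new_part (fun b => f (z b)) i j.
Proof. exact: sc_rmorph. Qed.

Lemma cocycle_coef_rmorph c b t :
  f (cocycle_coef c b t) = cocycle_coef (fun i j k => f (c i j k)) b t.
Proof.
rewrite /cocycle_coef cocycle_lhs_rmorph; apply: eq_cocycle_lhs => // i j.
by rewrite new_part_rmorph; apply: eq_sc => a; rewrite rmorph_nat.
Qed.

Lemma assemble_rmorph (x : mindex alpha n -> R) Y b :
  f (assemble x Y b) = assemble (fun a => f (x a)) (fun j => f (Y j)) b.
Proof.
rewrite /assemble !rmorphD !rmorph_sum rmorph_nat.
by congr (_ + _ + _); apply: eq_bigr => ? _; rewrite rmorphM rmorph_nat.
Qed.

End Morphism.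

Lemma eq_assemble (R : comNzRingType) (x x' : mindex alpha n -> R) Y Y' b :
  x =1 x' -> Y =1 Y' -> assemble x Y b = assemble x' Y' b.
Proof.
move=> ex eY; rewrite /assemble; congr (_ + _ + _);
  by apply: eq_bigr => ? _; rewrite ?ex ?eY.
Qed.

(** Centrality of e_(n+1) leaves three kinds of multi-indices: pq, the free ones and the widened
    ones. *)
Lemma assembleK (R : comNzRingType) (z : mindex alpha n.+1 -> R)
    (alpha_neq0 : forall i, (i <= n)%N -> alpha i != 0)
    (alpha_new : forall i j, (i < n)%N -> (j < n)%N ->
       alpha n <> alpha i - alpha j) :
  z pq = 1 -> assemble (old_part z) (fun j => z (enum_val j)) =1 z.
Proof.
move=> z1 b; have [->|bpq] := eqVneq b pq; first by rewrite assemble_pq.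
have [bM|] := boolP (b \in M).
  by rewrite -(enum_rankK_in bM bM) assemble_free.
rewrite inE bpq andbT => /(mindex_cases alpha_neq0 alpha_new) [a ->].
exact: assemble_old.
Qed.

Lemma B_lhsE (phi : {ffun mindex alpha n -> K}) X t :
  B_lhs phi pq X t =
  cocycle_lhs (sc phi) (new_part (fun b => if b == pq then 1 else X b)) t.
Proof. by case: t => [[i j] k]. Qed.

End NewCoordinates.

(** * Second homology *)

Section VectorSpaces.
Variables (K : fieldType) (aT rT : vectType K).

(** [linfun] accepts a bare function, and the spaces of chains and cochains are defined that way;
    its values are known only once linearity is supplied. *)
Lemma linfunE (f : aT -> rT) : linear f -> linfun f =1 f.
Proof.
by move=> lf; pose F : {linear aT -> rT} := HB.pack f
  (GRing.isLinear.Build K aT rT *:%R f lf); exact: (lfunE F).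
Qed.

Lemma span_ind (P : aT -> Prop) (s : seq aT) :
  P 0 -> (forall a u v, P u -> P v -> P (a *: u + v)) ->
  (forall u, u \in s -> P u) -> forall v, v \in <<s>>%VS -> P v.
Proof.
move=> P0 PD Ps v vs; rewrite (@coord_span _ _ _ (in_tuple s) v) //.
apply: (big_ind P) => // [u w Pu Pw|i _].
  by rewrite -[u]scale1r; apply: PD.
by rewrite -[_ *: _]addr0; apply: PD => //; apply: Ps; apply: mem_nth.
Qed.

Lemma memv_bigcap_seq (I : eqType) (s : seq I) (U : I -> {vspace aT}) v :
  reflect (forall t, t \in s -> v \in U t) (v \in \bigcap_(t <- s) U t)%VS.
Proof.
elim: s => [|t s IH]; first by rewrite big_nil memvf; apply: ReflectT.
rewrite big_cons memv_cap; apply: (iffP andP) => [[vt /IH vs] t'|h].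
  by rewrite inE => /predU1P[->|/vs].
by split; [apply: h; rewrite mem_head | apply/IH => t' ts; apply: h; rewrite inE ts orbT].
Qed.

Lemma eq_lfun_vbasis (f g : 'Hom(aT, rT)) :
  (forall t, t \in vbasis {:aT} -> f t = g t) -> f = g.
Proof.
move=> e; apply/lfunP => t; rewrite (coord_vbasis (memvf t)) !linear_sum /=.
by apply: eq_bigr => i _; rewrite !linearZ /= e ?mem_nth ?size_tuple.
Qed.

End VectorSpaces.

Section Alternating.
Variables (K : fieldType) (n : nat).
Implicit Types (W : 'M[K]_n) (u v : 'rV[K]_n).
Local Notation e i := (delta_mx 0 i : 'rV[K]_n).

Definition alternating W : Prop :=
  (forall i, W i i = 0) /\ (forall i j, W i j = - W j i).

Lemma wedgeE u v i j : wedge u v i j = u 0 i * v 0 j - v 0 i * u 0 j.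
Proof. by rewrite /wedge !mxE !big_ord1 !mxE. Qed.

Lemma wedge_alternating u v : alternating (wedge u v).
Proof. by split=> [i|i j]; rewrite !wedgeE; ring. Qed.

Lemma alternatingD a W W' :
  alternating W -> alternating W' -> alternating (a *: W + W').
Proof.
move=> [W1 W2] [W1' W2']; split=> [i|i j]; rewrite !mxE.
  by rewrite W1 W1' mulr0 addr0.
by rewrite W2 W2'; ring.
Qed.

Lemma alternating0 : alternating 0.
Proof. by split=> [i|i j]; rewrite !mxE ?oppr0. Qed.

Lemma alternating_decomp W : alternating W ->
  W = \sum_(i < n) \sum_(j < n | (i < j)%N) W i j *: wedge (e i) (e j).
Proof.
move=> [W1 W2]; apply/matrixP => p q; rewrite summxE.
have T (i : 'I_n) : (\sum_(j < n | (i < j)%N) W i j *: wedge (e i) (e j)) p q =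
    \sum_(j < n | (i < j)%N) W i j * ((p == i)%:R * (q == j)%:R - (p == j)%:R * (q == i)%:R).
  by rewrite summxE; apply: eq_bigr => j _; rewrite mxE wedgeE !mxE.
under eq_bigr => i _ do rewrite T.
have Z i j : (i == p) || (i == q) = false ->
    W i j * ((p == i)%:R * (q == j)%:R - (p == j)%:R * (q == i)%:R) = 0.
  by move/norP=> [a b]; rewrite eq_sym (negbTE a) [q == i]eq_sym (negbTE b) mul0r mulr0 subrr mulr0.
have main (p' q' : 'I_n) (pq : (p' < q')%N) : \sum_(i < n) \sum_(j < n | (i < j)%N)
    W i j * ((p' == i)%:R * (q' == j)%:R - (p' == j)%:R * (q' == i)%:R) = W p' q'.
  rewrite (bigD1 p') //= (bigD1 q') //= !eqxx big1 ?addr0 => [|j /andP[pj jq]]; last first.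
    rewrite [q' == j]eq_sym (negbTE jq) [q' == p']eq_sym.
    have -> : (p' == q') = false by apply/eqP => E; rewrite E ltnn in pq.
    by rewrite !mulr0 subrr mulr0.
  have -> : (p' == q') = false by apply/eqP => E; rewrite E ltnn in pq.
  rewrite mul0r subr0 !mulr1 big1 ?addr0 // => i ip; rewrite big1 // => j ij.
  rewrite eq_sym (negbTE ip) mul0r sub0r.
  case: (eqVneq p' j) => [E|]; last by rewrite mul0r oppr0 mulr0.
  case: (eqVneq q' i) => [E'|]; last by rewrite mulr0 oppr0 mulr0.
  by move: ij; rewrite -E -E' ltnNge ltnW.
case: (ltngtP p q) => [lt|lt|/ord_inj eq]; first by rewrite main.
- rewrite W2 -(main _ _ lt) -sumrN; apply: eq_bigr => i _; rewrite -sumrN.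
  by apply: eq_bigr => j _; ring.
- rewrite -eq W1 big1 // => i _; rewrite big1 // => j _.
  by rewrite [(p == j)%:R * _]mulrC subrr mulr0.
Qed.

Lemma alternatingP W :
  (W \in <<[seq wedge (e x.1) (e x.2) | x : 'I_n * 'I_n]>>%VS) <-> alternating W.
Proof.
split=> [|aW].
  apply: span_ind => [|a u v|_ /imageP[x _ ->]].
  - exact: alternating0.
  - exact: alternatingD.
  - exact: wedge_alternating.
rewrite (alternating_decomp aW); apply: memv_suml => i _; apply: memv_suml => j _.
apply: memvZ; apply: memv_span; apply/imageP; by exists (i, j).
Qed.

End Alternating.

(** Grouping (i, j) with (j, i) turns the full double sum of a bracket into the sum over i < j that
    defines [d_2]. *)
Lemma sum_offdiag (V : zmodType) n (G : 'I_n -> 'I_n -> V) :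
  (forall i, G i i = 0) ->
  \sum_i \sum_j G i j = \sum_(i < n) \sum_(j < n | (i < j)%N) (G i j + G j i).
Proof.
move=> G0.
have -> : \sum_(i < n) \sum_(j < n | (i < j)%N) (G i j + G j i) =
    \sum_(i < n) \sum_(j < n | (i < j)%N) G i j
    + \sum_(i < n) \sum_(j < n | (j < i)%N) G i j.
  under eq_bigr => i _ do rewrite big_split /=.
  rewrite big_split /=; congr (_ + _).
  under eq_bigr => i _ do rewrite big_mkcond.
  rewrite exchange_big; apply: eq_bigr => i _; rewrite [RHS]big_mkcond.
  by apply: eq_bigr.
rewrite -big_split; apply: eq_bigr => i _ /=.
rewrite (bigD1 i) //= G0 add0r [X in _ = X + _]big_mkcond [X in _ = _ + X]big_mkcond.
rewrite -big_split big_mkcond; apply: eq_bigr => j _ /=.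
by rewrite -val_eqE /=; case: ltngtP; rewrite ?addr0 ?add0r.
Qed.

Lemma bracket_delta (R : comNzRingType) n (d : 'I_n -> 'I_n -> 'I_n -> R) (u : 'rV_n) i k :
  bracket d u (delta_mx 0 i) 0 k = \sum_l u 0 l * d l i k.
Proof.
rewrite mxE; apply: eq_bigr => l _; rewrite (bigD1 i) //= mxE !eqxx mulr1.
by rewrite big1 ?addr0 // => m mi; rewrite mxE (negbTE mi) andbF mulr0 mul0r.
Qed.

Lemma bracket_delta2 (R : comNzRingType) n (d : 'I_n -> 'I_n -> 'I_n -> R) i j k :
  bracket d (delta_mx 0 i) (delta_mx 0 j) 0 k = d i j k.
Proof.
rewrite bracket_delta (bigD1 i) //= mxE !eqxx mul1r big1 ?addr0 // => l li.
by rewrite mxE (negbTE li) andbF mul0r.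
Qed.

Section Homology.
Variables (K : closedFieldType) (T : vectType K) (alpha : nat -> 'Hom(T, K^o)).
Variables (n : nat) (phi : {ffun mindex alpha n -> K}).
Implicit Types (W : 'M[K]_n) (u v : 'rV[K]_n).
Local Notation c := (sc phi).
Local Notation e i := (delta_mx 0 i : 'rV[K]_n).

Lemma bracket_antisym u v : bracket c u v = - bracket c v u.
Proof.
apply/rowP => k; rewrite !mxE exchange_big -sumrN; apply: eq_bigr => i _.
by rewrite -sumrN; apply: eq_bigr => j _; rewrite sc_antisym; ring.
Qed.

Lemma bracket_sum u v :
  bracket c u v = \sum_i \sum_j (u 0 i * v 0 j) *: bracket c (e i) (e j).
Proof.
apply/rowP => k; rewrite mxE summxE; apply: eq_bigr => i _.
by rewrite summxE; apply: eq_bigr => j _; rewrite mxE bracket_delta2.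
Qed.

Lemma d_2_wedge u v : d_2 phi (wedge u v) = bracket c u v.
Proof.
rewrite bracket_sum sum_offdiag => [|i]; last first.
  by apply/rowP => k; rewrite mxE bracket_delta2 sc_diag !mxE mulr0.
apply: eq_bigr => i _; apply: eq_bigr => j _.
rewrite (bracket_antisym (e j)) scalerN -scalerBl wedgeE; congr (_ *: _); ring.
Qed.

Lemma d_2_linear : linear (d_2 phi).
Proof.
move=> a W W'; rewrite /d_2 scaler_sumr -big_split; apply: eq_bigr => i _ /=.
rewrite scaler_sumr -big_split; apply: eq_bigr => j _ /=.
by rewrite !mxE scalerDl scalerA.
Qed.

Lemma d_2D W W' : d_2 phi (W + W') = d_2 phi W + d_2 phi W'.
Proof. by rewrite -!(linfunE d_2_linear) linearD. Qed.

Lemma d_2_d_3 i j k : is_law phi -> d_2 phi (d_3 phi i j k) = 0.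
Proof.
move=> J; rewrite /d_3 2!d_2D !d_2_wedge; apply/rowP => l.
rewrite !mxE -[RHS](J i j k l) /jacobi.
have E i' j' k' : \sum_l' \sum_m bracket c (e i') (e j') 0 l' * (e k') 0 m * c l' m l
    = \sum_m c i' j' m * c m k' l.
  have := bracket_delta c (bracket c (e i') (e j')) k' l; rewrite mxE => ->.
  by apply: eq_bigr => m _; rewrite bracket_delta2.
by rewrite !E -!big_split.
Qed.

Lemma d_3E i j k p q :
  d_3 phi i j k p q =
    (c i j p * (q == k)%:R - (p == k)%:R * c i j q)
  + (c j k p * (q == i)%:R - (p == i)%:R * c j k q)
  + (c k i p * (q == j)%:R - (p == j)%:R * c k i q).
Proof.
rewrite /d_3 mxE [X in X + _]mxE !wedgeE !bracket_delta2.
by rewrite [in (_ : 'M_(1, n)) 0 _]/= !mxE.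
Qed.

Lemma d_3_weight (i j k p q : 'I_n) :
  alpha p + alpha q != alpha i + alpha j + alpha k -> d_3 phi i j k p q = 0.
Proof.
move=> h.
have z (a b d s t : 'I_n) :
    alpha s + alpha t != alpha a + alpha b + alpha d -> c a b s * (t == d)%:R = 0.
  move=> h'; case: eqP => [td|]; last by rewrite mulr0.
  rewrite sc_eq0 ?mul0r //; apply: contra h' => /eqP ->.
  by rewrite td.
have h2 : alpha p + alpha q != alpha j + alpha k + alpha i.
  by rewrite [X in _ != X]addrC addrA.
have h3 : alpha p + alpha q != alpha k + alpha i + alpha j.
  by rewrite -addrA addrC.
have sw (x : 'Hom(T, K^o)) : alpha p + alpha q != x -> alpha q + alpha p != x.
  by rewrite addrC.
rewrite d_3E ![(p == _)%:R * _]mulrC !z ?subrr ?addr0 //; exact: sw.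
Qed.

(** Projection onto the weight space of weight beta: the torus acts on the matrix unit (i, j) with
    weight alpha i + alpha j. *)
Definition weight_mask (beta : 'Hom(T, K^o)) W : 'M[K]_n :=
  \matrix_(i, j) if alpha i + alpha j == beta then W i j else 0.

Lemma weight_mask_linear beta : linear (weight_mask beta).
Proof.
by move=> a W W'; apply/matrixP => i j; rewrite !mxE; case: ifP; rewrite ?mulr0 ?addr0.
Qed.

Lemma weight_mask_d_3 beta (i j k : 'I_n) :
  weight_mask beta (d_3 phi i j k) =
  if alpha i + alpha j + alpha k == beta then d_3 phi i j k else 0.
Proof.
apply/matrixP => p q; rewrite [LHS]mxE.
have [e0|ne] := eqVneq (alpha p + alpha q) (alpha i + alpha j + alpha k).
  by rewrite e0; case: ifP; rewrite ?mxE.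
by rewrite d_3_weight //; case: ifP => _; case: ifP => _; rewrite ?d_3_weight ?mxE.
Qed.

(** The generators [d_3] are homogeneous: the projection fixes or kills each of them. *)
Lemma weight_mask_B_2 beta W : W \in B_2 phi -> weight_mask beta W \in B_2 phi.
Proof.
apply: (span_ind (P := fun W => weight_mask beta W \in B_2 phi))
  => [|a u v hu hv|_ /imageP[x _ ->]].
- by rewrite -(linfunE (weight_mask_linear beta)) linear0 mem0v.
- by rewrite weight_mask_linear memvD ?memvZ.
- rewrite weight_mask_d_3; case: ifP => _; rewrite ?mem0v //.
  by apply: memv_span; apply/imageP; exists x.
Qed.

Lemma d_3_alternating i j k : alternating (d_3 phi i j k).
Proof.
rewrite /d_3 -[_ + _ + _]scale1r -[1 *: _]addr0; apply: alternatingD => //; last first.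
  exact: alternating0.
rewrite -[wedge (bracket _ (e i) _) _]scale1r -[X in X + wedge _ (e j)]scale1r.
do 2![apply: alternatingD; last exact: wedge_alternating].
exact: wedge_alternating.
Qed.

Lemma wedge_actE t W i j :
  wedge_act alpha t W i j = ((alpha i t : K) + (alpha j t : K)) * W i j.
Proof. by rewrite /wedge_act /weight_act mxE mul_diag_mx mul_mx_diag !mxE; ring. Qed.

Lemma wedge_act_shift_linear (beta : 'Hom(T, K^o)) t :
  linear (fun W => wedge_act alpha t W - (beta t : K) *: W).
Proof.
move=> a W W'; apply/matrixP => i j.
by rewrite !(wedge_actE, mxE); ring.
Qed.

Lemma Z_2P W : W \in Z_2 phi <-> alternating W /\ d_2 phi W = 0.
Proof.
rewrite memv_cap memv_ker (linfunE d_2_linear); split.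
  by move=> /andP[/alternatingP aW /eqP].
by move=> [/alternatingP -> ->]; rewrite eqxx.
Qed.

Lemma Z_2_weightP beta W :
  W \in Z_2_weight phi beta <->
  [/\ alternating W, d_2 phi W = 0 &
    forall t, t \in vbasis {:T} ->
      wedge_act alpha t W - (beta t : K) *: W \in B_2 phi].
Proof.
have lin t := linfunE (wedge_act_shift_linear beta t).
rewrite memv_cap; split=> [/andP[/Z_2P[aW dW] /memv_bigcap_seq h]|[aW dW h]].
  by split=> // t /h; rewrite -memv_preim lin.
apply/andP; split; first by apply/Z_2P.
by apply/memv_bigcap_seq => t /h; rewrite -memv_preim lin.
Qed.

Lemma wedge_act_mask (beta gamma : 'Hom(T, K^o)) t W :
  weight_mask gamma (wedge_act alpha t W - (beta t : K) *: W) =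
  ((gamma t : K) - (beta t : K)) *: weight_mask gamma W.
Proof.
apply/matrixP => i j; rewrite !(wedge_actE, mxE).
case: eqP => [<-|_]; last by rewrite mulr0.
by rewrite lfunE /=; ring.
Qed.

Lemma weight_mask_decomp beta W :
  W = weight_mask beta W
      + \sum_(gamma <- undup [seq alpha x.1 + alpha x.2 | x : 'I_n * 'I_n]
              | gamma != beta) weight_mask gamma W.
Proof.
apply/matrixP => i j; rewrite mxE summxE !mxE.
set s := undup _.
have us : uniq s by apply: undup_uniq.
have ijs : alpha i + alpha j \in s.
  by rewrite mem_undup; apply/imageP; exists (i, j).
have [<-|ne] := eqVneq (alpha i + alpha j) beta.
  by rewrite big1 ?addr0 // => g ng; rewrite mxE eq_sym (negbTE ng).
rewrite add0r big_mkcond (bigD1_seq _ ijs us) /= ne mxE eqxx big1 ?addr0 // => g gij.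
by case: ifP => // _; rewrite mxE ifN // eq_sym.
Qed.

End Homology.

Lemma cocycle_lhs_combine (K : closedFieldType) (T : vectType K)
    (alpha : nat -> 'Hom(T, K^o)) (R : comNzRingType) n
    (c : 'I_n -> 'I_n -> 'I_n -> R) (x y : mindex alpha n.+1 -> R) r s t :
  cocycle_lhs c (new_part (fun b => r * x b + s * y b)) t =
  r * cocycle_lhs c (new_part x) t + s * cocycle_lhs c (new_part y) t.
Proof.
rewrite /cocycle_lhs !mulr_sumr -big_split; apply: eq_bigr => l _ /=.
by rewrite /new_part !sc_combine; ring.
Qed.

(** * Duality between the new Jacobi equations and the boundaries *)

Section FiberSystem.
Variables (K : closedFieldType) (T : vectType K) (alpha : nat -> 'Hom(T, K^o)).
Variables (n : nat).
Hypothesis alpha_neq0 : forall i, (i <= n)%N -> alpha i != 0.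
Hypothesis alpha_new : forall i j, (i < n)%N -> (j < n)%N ->
  alpha n <> alpha i - alpha j.
Variables (pq : mindex alpha n.+1) (pq_new : target pq = ord_max).
Variables (phi : {ffun mindex alpha n -> K}).
Local Notation c := (sc phi).
Local Notation M := (free_coords pq).

Definition new_coords : {set mindex alpha n.+1} := [set b | target b == ord_max].
Local Notation E := new_coords.

Lemma card_new_coords : #|E| = #|M|.+1.
Proof.
rewrite (cardsD1 pq) inE pq_new eqxx add1n; congr _.+1.
by apply: eq_card => b; rewrite !inE andbC.
Qed.

Definition new_of (v : 'rV[K]_#|E|) (b : mindex alpha n.+1) : K :=
  \sum_j v 0 j * (enum_val j == b)%:R.

Lemma new_of_enum_val v j : new_of v (enum_val j) = v 0 j.
Proof.
rewrite /new_of (bigD1 j) //= eqxx mulr1 big1 ?addr0 // => i ij.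
by rewrite (inj_eq enum_val_inj) (negbTE ij) mulr0.
Qed.

Lemma cocycle_new_of v t :
  cocycle_lhs c (new_part (new_of v)) t =
  \sum_j v 0 j * cocycle_coef c (enum_val j) t.
Proof.
rewrite cocycle_lhs_coef.
rewrite (eq_bigl (fun b => b \in E)) => [|b]; last by rewrite inE.
rewrite big_enum_val.
by apply: eq_bigr => j _; rewrite new_of_enum_val.
Qed.

(** Coordinates on the part of weight alpha_(n+1) of the second exterior power. Cochains and
    bivectors share the index set E, so that pairing a cocycle with a boundary is a dot product of
    rows. *)
Definition alt_matrix (v : 'rV[K]_#|E|) : 'M[K]_n :=
  \matrix_(i, j) new_part (new_of v) i j.

Lemma alt_matrix_linear : linear alt_matrix.
Proof.
move=> a u v; apply/matrixP => i j; rewrite !mxE /new_part -[X in _ = _ + X]mul1r.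
rewrite -sc_combine; apply: eq_sc => b; rewrite /new_of mul1r mulr_sumr -big_split.
by apply: eq_bigr => k _; rewrite !mxE /=; ring.
Qed.

Lemma new_coords_source (b : mindex alpha n.+1) : target b = ord_max ->
  exists i j : 'I_n, [/\ val b = (widen i, widen j, ord_max), (i < j)%N
    & alpha i + alpha j = alpha n].
Proof.
case: b => [[[i j] k] h]; rewrite /target /= => kE.
have := mindex_source_lt alpha_neq0 alpha_new (exist _ (i, j, k) h).
move=> /andP[/= hi hj]; exists (Ordinal hi), (Ordinal hj).
have /andP[/= ij /eqP s] := h; split=> //; last by rewrite /= s kE.
by rewrite kE; congr (_, _, _); apply: val_inj.
Qed.

Lemma new_part_source (R : comNzRingType) (z : mindex alpha n.+1 -> R) b (i j : 'I_n) :
  val b = (widen i, widen j, ord_max) -> new_part z i j = z b.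
Proof. by move=> e; rewrite /new_part -(sc_mindex z b) e. Qed.

Lemma new_coords_exists (i j : 'I_n) : (i < j)%N ->
  alpha i + alpha j = alpha n ->
  exists2 b : mindex alpha n.+1, target b = ord_max &
    val b = (widen i, widen j, ord_max).
Proof.
move=> ij s; have h : mindex_pred alpha (widen i, widen j, @ord_max n).
  by rewrite /mindex_pred /= ij s eqxx.
by exists (exist (@mindex_pred K T alpha n.+1) (widen i, widen j, ord_max) h).
Qed.

Definition new_alternating (W : 'M[K]_n) : Prop :=
  alternating W /\ forall i j : 'I_n, alpha i + alpha j != alpha n -> W i j = 0.

Lemma new_alternating_ext W W' : new_alternating W -> new_alternating W' ->
  (forall b i j, val b = (widen i, widen j, ord_max) :> 'I_n.+1 * 'I_n.+1 * 'I_n.+1 ->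
     (b : mindex alpha n.+1) \in E -> W i j = W' i j) -> W = W'.
Proof.
move=> [[W1 W2] W3] [[W1' W2'] W3'] h; apply/matrixP => i j.
have [s|s] := eqVneq (alpha i + alpha j) (alpha n); last by rewrite W3 ?W3'.
case: (ltngtP i j) => [ij|ji|/ord_inj <-]; last by rewrite W1 W1'.
  by have [b tb vb] := new_coords_exists ij s; apply: (h b); rewrite // inE tb.
rewrite addrC in s; have [b tb vb] := new_coords_exists ji s.
by rewrite W2 W2' (h b) // inE tb.
Qed.

Lemma alt_matrix_new v : new_alternating (alt_matrix v).
Proof.
split; first split=> [i|i j].
- by rewrite mxE new_part_diag.
- by rewrite !mxE new_part_antisym.
- by move=> i j h; rewrite mxE new_part_eq0.
Qed.

Lemma alt_matrix_source v b (i j : 'I_n) :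
  val b = (widen i, widen j, ord_max) -> alt_matrix v i j = new_of v b.
Proof. by move=> vb; rewrite mxE (new_part_source _ vb). Qed.

Lemma alt_matrix_inj : injective alt_matrix.
Proof.
move=> u v e; apply/rowP => k; rewrite -!new_of_enum_val.
have := enum_valP k; rewrite inE => /eqP /new_coords_source [i [j [vb _ _]]].
by rewrite -!(alt_matrix_source _ vb) e.
Qed.

Lemma alt_matrix_surj W : new_alternating W -> exists v, W = alt_matrix v.
Proof.
(* The source of the k-th new coordinate is not named: the indicator in the double sum selects
   it. *)
move=> hW; exists (\row_k \sum_p \sum_q
  W p q * ((widen p, widen q, ord_max) == val (enum_val k))%:R).
apply: new_alternating_ext => // [|b i j vb bE]; first exact: alt_matrix_new.
rewrite (alt_matrix_source _ vb) -(enum_rankK_in bE bE) new_of_enum_val mxE.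
rewrite enum_rankK_in // vb (bigD1 i) //= (bigD1 j) //= eqxx mulr1.
rewrite !big1 ?addr0 // => [p pi|q qj]; first apply: big1 => q _.
  by rewrite !xpair_eqE -!(inj_eq val_inj) /= (inj_eq val_inj) (negbTE pi) mulr0.
by rewrite !xpair_eqE -!(inj_eq val_inj) /= !(inj_eq val_inj) (negbTE qj) andbF mulr0.
Qed.

Definition coef_row (t : 'I_n * 'I_n * 'I_n) : 'rV[K]_#|E| :=
  \row_j cocycle_coef c (enum_val j) t.

(** The unit cochain at b is dual to e_i /\ e_j, so pairing it with the boundary of a basis 3-vector
    reads off an entry of that boundary. *)
Lemma cocycle_coefE (b : mindex alpha n.+1) (i j : 'I_n) t : val b = (widen i, widen j, ord_max) ->
  cocycle_coef c b t = d_3 phi t.1.1 t.1.2 t.2 i j.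
Proof.
move=> vb; have /andP[ij _] := valP b; rewrite vb /= in ij.
have X p q : new_part (fun b' => (b' == b)%:R : K) p q =
    ((p == i) && (q == j))%:R - ((p == j) && (q == i))%:R.
  rewrite /new_part /sc; case: insubP => [a _ va|na].
    rewrite -val_eqE va vb !xpair_eqE eqxx andbT -!val_eqE /=.
    move: (valP a) ij; rewrite va => /andP[/= pq' _] ij.
    case: (eqVneq (p : nat) j) => [pj|]; last by rewrite subr0.
    case: (eqVneq (q : nat) i) => [qi|]; last by rewrite subr0.
    by move: pq'; rewrite pj qi ltnNge ltnW.
  have -> : (p == i) && (q == j) = false.
    by apply/negP => /andP[/eqP pi /eqP qj]; move: na; rewrite pi qj -vb (valP b).
  rewrite sub0r; case: insubP => [a _ va|na'].
    by rewrite -val_eqE va vb !xpair_eqE eqxx andbT -!val_eqE /= andbC.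
  have -> : (p == j) && (q == i) = false.
    by apply/negP => /andP[/eqP pi /eqP qj]; move: na'; rewrite pi qj -vb (valP b).
  by rewrite oppr0.
rewrite /cocycle_coef d_3E /cocycle_lhs !big_split /=.
have S (a b' d : 'I_n) : \sum_l c a b' l * new_part (fun b' => (b' == b)%:R : K) l d =
    c a b' i * (j == d)%:R - (i == d)%:R * c a b' j.
  under eq_bigr => l _ do rewrite X.
  have ji : (j == i) = false by apply/eqP => eqx; rewrite eqx ltnn in ij.
  have ij' : (i == j) = false by rewrite eq_sym.
  rewrite (bigD1 i) //= (bigD1 j) ?ji //= !eqxx ij' /= big1 => [|l /andP[li lj]].
    by rewrite subr0 sub0r addr0 mulrN [d == j]eq_sym [d == i]eq_sym; ring.
  by rewrite (negbTE li) (negbTE lj) subrr mulr0.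
by rewrite !S.
Qed.

Lemma alt_matrix_coef_row (t : 'I_n * 'I_n * 'I_n) :
  alpha t.1.1 + alpha t.1.2 + alpha t.2 = alpha n ->
  alt_matrix (coef_row t) = d_3 phi t.1.1 t.1.2 t.2.
Proof.
move=> ht; apply: new_alternating_ext => [||b i j vb bE].
- exact: alt_matrix_new.
- split; first exact: d_3_alternating.
  by move=> i j h; apply: d_3_weight; rewrite ht.
- rewrite (alt_matrix_source _ vb) -(enum_rankK_in bE bE) new_of_enum_val mxE.
  by rewrite enum_rankK_in //; apply: cocycle_coefE.
Qed.

End FiberSystem.

(** * Dimension of the fiber *)

Section FiberDimension.
Variables (K : closedFieldType) (T : vectType K) (alpha : nat -> 'Hom(T, K^o)).
Variables (n : nat).
Hypothesis alpha_inj : injective alpha.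
Hypothesis alpha_neq0 : forall i, (i <= n)%N -> alpha i != 0.
Hypothesis alpha_new : forall i j, (i < n)%N -> (j < n)%N ->
  alpha n <> alpha i - alpha j.
Variables (pq : mindex alpha n.+1) (pq_new : target pq = ord_max).
Variables (phi : {ffun mindex alpha n -> K}).
Hypothesis phi_law : is_law phi.
Implicit Types W : 'M[K]_n.
Local Notation c := (sc phi).
Local Notation M := (free_coords pq).
Local Notation E := (new_coords alpha n).

Definition new_wedges : {vspace 'M[K]_n} := limg (linfun (@alt_matrix K T alpha n)).

Lemma new_wedgesP W : W \in new_wedges <-> new_alternating alpha W.
Proof.
have lin := linfunE (@alt_matrix_linear K T alpha n); split.
  by move=> /memv_imgP[v _ ->]; rewrite lin; apply: alt_matrix_new.
by move=> /alt_matrix_surj[v ->]; rewrite -lin memv_img ?memvf.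
Qed.

Lemma weight_mask_alternating beta W :
  alternating W -> alternating (weight_mask alpha beta W).
Proof.
move=> [W1 W2]; split=> [i|i j]; rewrite !mxE; first by rewrite W1 if_same.
by rewrite addrC W2; case: ifP; rewrite ?oppr0.
Qed.

Lemma weight_mask_new W : alternating W -> weight_mask alpha (alpha n) W \in new_wedges.
Proof.
move=> aW; apply/new_wedgesP; split; first exact: weight_mask_alternating.
by move=> i j /negbTE h; rewrite mxE h.
Qed.

Lemma new_alternating_mask W :
  new_alternating alpha W -> weight_mask alpha (alpha n) W = W.
Proof.
move=> [_ h]; apply/matrixP => i j; rewrite mxE; case: eqP => // /eqP ne.
by rewrite h.
Qed.

(** The image has weight alpha_(n+1) in K^n, where this weight does not occur because the weights
    are distinct. *)
Lemma d_2_new W : new_alternating alpha W -> d_2 phi W = 0.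
Proof.
move=> [_ hW]; apply: big1 => i _; apply: big1 => j _; apply/rowP => k.
rewrite mxE bracket_delta2 [RHS]mxE; have [s|s] := eqVneq (alpha i + alpha j) (alpha n).
  rewrite sc_eq0 ?mulr0 // s (inj_eq alpha_inj) neq_ltn (ltn_ord k) orbT //.
by rewrite hW ?mul0r.
Qed.

(** A component of weight g other than alpha_(n+1) is a boundary: for a basis vector t of T
    separating the two weights, its product by the nonzero scalar g(t) - alpha_(n+1)(t) is a
    component of a boundary. *)
Lemma Z_2_weight_new : Z_2_weight phi (alpha n) = (new_wedges + B_2 phi)%VS.
Proof.
apply/vspaceP => W; apply/idP/memv_addP => [/Z_2_weightP[aW dW hW]|].
  rewrite [W](weight_mask_decomp alpha (alpha n)).
  exists (weight_mask alpha (alpha n) W); first exact: weight_mask_new.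
  eexists; last by [].
  apply: memv_suml => g gn; have [t tb gt] : exists2 t, t \in vbasis {:T} & alpha n t != g t.
    case: (pselect (exists2 t, t \in vbasis {:T} & alpha n t != g t)) => // no.
    case/eqP: gn; apply: eq_lfun_vbasis => t tb; apply/eqP; rewrite eq_sym.
    by apply/negPn/negP => h; apply: no; exists t.
  have := weight_mask_B_2 g (hW t tb); rewrite wedge_act_mask.
  by rewrite rpredZeq subr_eq0 eq_sym (negbTE gt).
move=> [U /new_wedgesP hU [V hV ->]].
have ZU : U \in Z_2_weight phi (alpha n).
  apply/Z_2_weightP; split; [by case: hU | exact: d_2_new | move=> t _].
  suff -> : wedge_act alpha t U - (alpha n t : K) *: U = 0 by apply: mem0v.
  apply/matrixP => i j; rewrite !(wedge_actE, mxE).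
  have [s|s] := eqVneq (alpha i + alpha j) (alpha n); last by rewrite hU.2 //; ring.
  by rewrite -s lfunE /=; ring.
apply: memvD => //; move: V hV.
have sub : (B_2 phi <= Z_2_weight phi (alpha n))%VS.
  apply/span_subvP => _ /imageP[x _ ->].
  apply/Z_2_weightP; split; [exact: d_3_alternating | exact: d_2_d_3 | move=> t _].
  rewrite (_ : _ - _ = ((alpha x.1.1 t : K) + alpha x.1.2 t + alpha x.2 t - alpha n t)
      *: d_3 phi x.1.1 x.1.2 x.2).
    by apply/memvZ/memv_span/imageP; exists x.
  have hD := @d_3_weight K T alpha n phi x.1.1 x.1.2 x.2.
  move: (d_3 phi x.1.1 x.1.2 x.2) hD => D hD.
  apply/matrixP => i j; rewrite !(wedge_actE, mxE).
  have [s|s] := eqVneq (alpha i + alpha j) (alpha x.1.1 + alpha x.1.2 + alpha x.2);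
    last by rewrite hD //; ring.
  have := congr1 (fun f : 'Hom(T, K^o) => (f t : K)) s; rewrite /= !lfunE /= => s'.
  by rewrite s' !lfunE /=; ring.
by move=> V; apply: (subvP sub).
Qed.

Variables (x0 : mindex alpha n.+1 -> K) (x0_pq : x0 pq = 1).
Hypothesis x0_cocycle : forall t, cocycle_lhs c (new_part x0) t = 0.
Variable L1 : {set 'I_n * 'I_n * 'I_n}.
Hypothesis L1_min : min_subsystem phi pq L1.

Lemma cocycle_L1 (z : mindex alpha n.+1 -> K) :
  (forall t, t \in L1 -> cocycle_lhs c (new_part z) t = 0) ->
  forall t, cocycle_lhs c (new_part z) t = 0.
Proof.
move=> hz; have [_ eqv _] := L1_min.
(* The affine combination z + (1 - z_pq) x0 has coordinate 1 at pq. *)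
have h t : t \in Lambda alpha n -> cocycle_lhs c (new_part z) t = 0.
  move=> tL; pose X b := 1 * z b + (1 - z pq) * x0 b.
  have XB t' : B_lhs phi pq X t' = cocycle_lhs c (new_part z) t'.
    rewrite B_lhsE -[RHS]mul1r -[RHS]addr0 -[X in _ = _ + X](mulr0 (1 - z pq)).
    rewrite -(x0_cocycle t') -cocycle_lhs_combine.
    apply: eq_cocycle_lhs => // i j; apply: eq_sc => b.
    by case: eqP => [->|//]; rewrite x0_pq; ring.
  by rewrite -XB; apply: (eqv X).1 => // t' t'L; rewrite XB hz.
exact: cocycle_lhs_Lambda (@new_part_eq0 _ _ _ _ _ z) h.
Qed.

Definition free_matrix : 'M[K]_(#|L1|, #|M|) :=
  \matrix_(i, j) cocycle_coef c (enum_val j) (enum_val i).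

(** In a dependency with a nonzero coefficient at i, equation i follows from the others and could be
    dropped from L1. The constant terms obey the same dependency since x0 solves every equation. *)
Lemma free_matrix_free : row_free free_matrix.
Proof.
have [L1L eqv minL] := L1_min.
apply: inj_row_free => w wA; apply/rowP => i; rewrite mxE; apply/eqP.
apply/negPn/negP => wi; have iL1 := enum_valP i.
suff L2 : L1 :\ enum_val i = L1 by have := setD11 (enum_val i) L1; rewrite L2 iL1.
apply: minL; first exact: subD1set.
move=> X; split=> [hX|hX t /setD1P[_ tL]]; last by apply: hX; apply: (subsetP L1L).
apply: (eqv X).1 => t tL; have [->|ti] := eqVneq t (enum_val i); last first.
  by apply: hX; rewrite !inE ti.
(* Subtracting x0 makes [B_lhs] linear in the free coordinates: the coordinate at pq, equal to 1 in
   both, cancels. *)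
pose D (j : 'I_#|M|) := (X (enum_val j) - x0 (enum_val j)) : K.
have BD t' : B_lhs phi pq X t' =
    \sum_(j < #|M|) D j * cocycle_coef c (enum_val j) t'.
  rewrite B_lhsE -[LHS]subr0 -[X in _ - X](x0_cocycle t') !cocycle_lhs_coef !(sum_target_max pq_new).
  rewrite eqxx x0_pq opprD addrACA subrr add0r -sumrB.
  apply: eq_bigr => j _.
  by have /andP[_ /negbTE ->] := enum_val_free j; rewrite -mulrBl.
have : \sum_k w 0 k * B_lhs phi pq X (enum_val k) = 0.
  under eq_bigr => k _ do rewrite BD mulr_sumr.
  rewrite exchange_big big1 // => j _ /=.
  have := congr1 (fun v : 'rV_#|M| => D j * v 0 j) wA; rewrite !mxE mulr0 mulr_sumr => hh; rewrite -[RHS]hh.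
  by apply: eq_bigr => k _; rewrite mxE; ring.
rewrite (bigD1 i) //= big1 ?addr0 => [/eqP|k ki].
  by rewrite mulf_eq0 (negbTE wi) => /eqP.
by rewrite hX ?mulr0 // !inE enum_valP (inj_eq enum_val_inj) ki.
Qed.

(** A vector killed by the linear parts of L1, completed by 0 at pq, satisfies L1 and hence every
    cocycle equation. *)
Lemma free_matrix_ker (y : 'cV[K]_#|M|) : free_matrix *m y = 0 ->
  forall t, \sum_j y j 0 * cocycle_coef c (enum_val j) t = 0.
Proof.
move=> hy.
pose z b := \sum_j y j 0 * (enum_val j == b)%:R : K.
have ze j : z (enum_val j) = y j 0.
  rewrite /z (bigD1 j) //= eqxx mulr1 big1 ?addr0 // => k kj.
  by rewrite (inj_eq enum_val_inj) (negbTE kj) mulr0.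
have zpq : z pq = 0.
  by apply: big1 => j _; have /andP[_ /negbTE ->] := enum_val_free j; rewrite mulr0.
have zc t : cocycle_lhs c (new_part z) t =
    \sum_j y j 0 * cocycle_coef c (enum_val j) t.
  rewrite cocycle_lhs_coef (sum_target_max pq_new) zpq mul0r add0r.
  by apply: eq_bigr => j _; rewrite ze.
move=> t; rewrite -zc; apply: cocycle_L1 => t' t'L.
rewrite zc; have := congr1 (fun v : 'cV_#|L1| => v (enum_rank_in t'L t') 0) hy.
rewrite !mxE => hh; rewrite -[RHS]hh; apply: eq_bigr => j _.
by rewrite mxE enum_rankK_in // mulrC.
Qed.

Definition coef_matrix : 'M[K]_(#|L1|, #|E|) :=
  \matrix_i coef_row phi (enum_val i).

(** Deleting the column of pq gives [free_matrix], whose rows are already independent. *)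
Lemma coef_matrix_free : row_free coef_matrix.
Proof.
apply: inj_row_free => w wA; have free_inj := row_free_inj free_matrix_free.
apply: (free_inj 1%N); rewrite mul0mx; apply/rowP => j; rewrite !mxE.
have jE : enum_val j \in E by have /andP[h _] := enum_val_free j; rewrite inE.
have := congr1 (fun v : 'rV_#|E| => v 0 (enum_rank_in jE (enum_val j))) wA.
rewrite !mxE => hh; rewrite -[RHS]hh; apply: eq_bigr => k _.
by rewrite !mxE enum_rankK_in.
Qed.

(** Each column of the cokernel of the rows of L1 solves L1, hence equation t by [cocycle_L1]; so
    the row of t is in their span. *)
Lemma coef_row_sub t : (coef_row phi t <= coef_matrix)%MS.
Proof.
rewrite submxE; apply/eqP/matrixP => i j; rewrite [i]ord1 mxE.
pose v := (col j (cokermx coef_matrix))^T.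
have hv t' : cocycle_lhs c (new_part (new_of v)) t' =
    (coef_row phi t' *m cokermx coef_matrix) 0 j.
  rewrite cocycle_new_of mxE; apply: eq_bigr => k _.
  by rewrite !mxE mulrC.
have := cocycle_L1 (z := new_of v) _ t; rewrite hv mxE => ->; first by rewrite mxE.
move=> t' t'L; rewrite hv.
have := congr1 (fun A : 'M_(_, _) => A (enum_rank_in t'L t') j) (mulmx_coker coef_matrix).
rewrite [in RHS]mxE => hh; rewrite -[RHS]hh; rewrite !mxE; apply: eq_bigr => k _.
by rewrite !mxE enum_rankK_in.
Qed.

(** Projecting a boundary that already has weight alpha_(n+1) does not change it, and among the
    generators keeps only those of that weight, which are combinations of those of L1. *)
Lemma cap_new_B_2 :
  (new_wedges :&: B_2 phi)%VS = limg (linfun (fun v => alt_matrix (v *m coef_matrix))).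
Proof.
have lin := linfunE (@alt_matrix_linear K T alpha n).
have linc : linear (fun v : 'rV_#|L1| => alt_matrix (v *m coef_matrix)).
  by move=> a u v; rewrite mulmxDl -scalemxAl alt_matrix_linear.
apply/vspaceP => W; rewrite memv_cap; apply/andP/memv_imgP => [[/new_wedgesP nW WB]|].
  have : exists u, weight_mask alpha (alpha n) W = alt_matrix (u *m coef_matrix).
    move: W WB {nW}; apply: span_ind => [|a U V [u hu] [v hv]|_ /imageP[t _ ->]].
    - exists 0; rewrite mul0mx -(linfunE (weight_mask_linear alpha (alpha n))) -lin.
      by rewrite !linear0.
    - by exists (a *: u + v); rewrite linc -hu -hv weight_mask_linear.
    - rewrite weight_mask_d_3; case: eqP => [ht|_]; last first.
        by exists 0; rewrite mul0mx -lin linear0.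
      have /submxP[u hu] := coef_row_sub t; exists u; rewrite -hu.
      by rewrite alt_matrix_coef_row.
  by rewrite new_alternating_mask // => -[u ->]; exists u; rewrite ?memvf ?linfunE.
move=> [u _ ->]; rewrite linfunE //; split; first by apply/new_wedgesP/alt_matrix_new.
rewrite mulmx_sum_row -lin linear_sum memv_suml // => i _; rewrite linearZ memvZ //= lin.
rewrite rowK alt_matrix_coef_row.
  by apply/memv_span/imageP; exists (enum_val i).
by have [/subsetP /(_ _ (enum_valP i))] := L1_min; rewrite inE => /and3P[_ _ /eqP].
Qed.

(** With S the new wedges and B the boundaries, nu = dim (S + B) - dim B = dim S - dim (S :&: B) =
    |M| + 1 - |L1|, the 1 standing for the coordinate at pq. *)
Lemma dim_H_2_fiber : (dim_H_2_weight phi (alpha n) + #|L1| = #|M|.+1)%N.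
Proof.
have lin := linfunE (@alt_matrix_linear K T alpha n).
have linc : linear (fun v : 'rV_#|L1| => alt_matrix (v *m coef_matrix)).
  by move=> a u v; rewrite mulmxDl -scalemxAl alt_matrix_linear.
have dS : \dim new_wedges = #|E|.
  rewrite /new_wedges limg_dim_eq; first by rewrite dimvf; exact: mul1n.
  apply/eqP; rewrite -subv0; apply: subv_trans (capvSr _ _) _; rewrite subv0.
  by apply/lker0P => u v; rewrite !lin; apply: alt_matrix_inj.
have dC : \dim (new_wedges :&: B_2 phi) = #|L1|.
  rewrite cap_new_B_2 limg_dim_eq; first by rewrite dimvf; exact: mul1n.
  apply/eqP; rewrite -subv0; apply: subv_trans (capvSr _ _) _; rewrite subv0.
  apply/lker0P => u v; rewrite !(linfunE linc) => /alt_matrix_inj e.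
  by apply: (row_free_inj coef_matrix_free); apply: e.
have := dimv_sum_cap new_wedges (B_2 phi).
rewrite dS dC (card_new_coords pq_new) /dim_H_2_weight Z_2_weight_new => h.
have le : (\dim (B_2 phi) <= \dim (new_wedges + B_2 phi))%N.
  by apply: dimvS; apply: addvSr.
by apply/eqP; rewrite -(eqn_add2r (\dim (B_2 phi))) -h addnAC subnK // addnC.
Qed.

End FiberDimension.

(** * Linear systems over a local ring *)

Section LocalLinearSystem.
Variables (K : fieldType) (O : comUnitRingType).
Variables (rho : {rmorphism O -> K}) (iota : {rmorphism K -> O}).
Hypothesis iotaK : cancel iota rho.
Hypothesis rho_unit : forall x, rho x != 0 -> x \is a GRing.unit.

(** The added rows are a basis of a complement; [gen] abstracts its dimension, which is d only up to
    a proof. *)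
Lemma row_free_completion m d (A : 'M[K]_(m, m + d)) : row_free A ->
  exists N : 'M[K]_(d, m + d), col_mx A N \in unitmx.
Proof.
move=> fA; have e : \rank (A^C)%MS = d.
  by rewrite mxrank_compl (eqP fA) addKn.
have gen r : \rank (A^C)%MS = r -> exists N : 'M[K]_(r, m + d), (N :=: A^C)%MS.
  by move=> <-; exists (row_base (A^C)%MS); apply: eq_row_base.
have [N hN] := gen d e.
exists N; rewrite -row_full_unit -sub1mx -addsmxE.
by rewrite (submx_trans (submx1 _) _) // (adds_eqmx (eqmx_refl _) hN) sub1mx addsmx_compl_full.
Qed.

(* Completing the equations A x + b = 0 by coordinate functions N to a square
   system invertible over O parametrizes their solutions by N (x - x0). *)
Lemma local_linear_system m d k (hk : k = (m + d)%N) (A : 'M[O]_(m, k))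
    (b : 'cV[O]_m) (x0 : 'cV[K]_k) :
  row_free (map_mx rho A) -> map_mx rho A *m x0 + map_mx rho b = 0 ->
  exists (N : 'M[O]_(d, k)) (u : 'cV[O]_k) (v : 'M[O]_(k, d)),
  [/\ A *m u + b = 0, A *m v = 0, map_mx rho u = x0,
      N *m u = N *m map_mx iota x0 & N *m v = 1%:M] /\
  forall (B : comNzRingType) (h : {rmorphism O -> B}) (x : 'cV[B]_k),
    map_mx h A *m x + map_mx h b = 0 ->
    x = map_mx h u + map_mx h v *m (map_mx h N *m (x - map_mx h (map_mx iota x0))).
Proof.
subst k => fA hx0; have [N0 uN0] := row_free_completion fA.
pose N := map_mx iota N0; pose C := col_mx A N.
have rN : map_mx rho N = N0 by apply/matrixP => i j; rewrite !mxE iotaK.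
(* The residue of C is invertible by the choice of [N0], so its determinant is a unit. *)
have uC : C \in unitmx.
  rewrite unitmxE; apply: rho_unit; rewrite -det_map_mx map_col_mx rN.
  by rewrite unitmxE unitfE in uN0.
pose W1 := lsubmx (invmx C); pose W2 := rsubmx (invmx C).
have CW : col_mx A N *m row_mx W1 W2 = 1%:M by rewrite hsubmxK mulmxV.
move: (CW); rewrite mul_col_row -[1%:M]/(1%:M : 'M_(m + d)) scalar_mx_block.
move=> /eq_block_mx[AW1 AW2 NW1 NW2].
(* The solution of A u = - b with the same image under N as x0. *)
pose u := W1 *m (- b) + W2 *m (N *m map_mx iota x0).
have Au : A *m u + b = 0.
  by rewrite mulmxDr !mulmxA AW1 AW2 mul1mx !mul0mx addr0 addNr.
have Nu : N *m u = N *m map_mx iota x0.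
  by rewrite mulmxDr !mulmxA NW1 NW2 mul1mx !mul0mx add0r.
have main (B : comNzRingType) (h : {rmorphism O -> B}) (x : 'cV[B]_(m + d)) :
    map_mx h A *m x + map_mx h b = 0 ->
    x = map_mx h u + map_mx h W2 *m (map_mx h N *m (x - map_mx h (map_mx iota x0))).
  move=> hx; have WC : map_mx h (invmx C) *m map_mx h C = 1%:M.
    by rewrite -map_mxM mulVmx // map_scalar_mx rmorph1.
  rewrite -[LHS]mul1mx -[RHS]mul1mx -WC -!mulmxA; congr (_ *m _).
  rewrite map_col_mx !mul_col_mx; congr col_mx.
    rewrite mulmxDr mulmxA -!map_mxM AW2 map_mx0 mul0mx addr0.
    move/eqP: hx; rewrite addr_eq0 => /eqP ->.
    by move/eqP: Au; rewrite addr_eq0 => /eqP ->; rewrite map_mxN.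
  rewrite [RHS]mulmxDr [X in _ = _ + X]mulmxA -!map_mxM NW2 map_scalar_mx rmorph1 mul1mx Nu.
  by rewrite mulmxBr map_mxM addrC subrK.
exists N, u, W2; split=> //; split=> //.
(* Read over the residue field, where x0 itself is a solution, the parametrization identifies the
   residue of u. *)
have /= := main _ rho x0 hx0.
rewrite (_ : map_mx rho (map_mx iota x0) = x0); last first.
  by apply/matrixP => i j; rewrite !mxE iotaK.
by rewrite subrr !mulmx0 addr0.
Qed.

End LocalLinearSystem.

(** * Local rings *)

Lemma ideal_gen_vanish (A B : comNzRingType) (G : A -> Prop) (f : {rmorphism A -> B}) :
  (forall a, G a -> f a = 0) -> forall a, ideal_gen G a -> f a = 0.
Proof.
move=> fG a [s [sG ->]]; rewrite rmorph_sum big_seq big1 // => u us.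
by rewrite rmorphM (fG _ (sG u us)) mulr0.
Qed.

Lemma ideal_gen_mem (A : comNzRingType) (G : A -> Prop) a : G a -> ideal_gen G a.
Proof.
move=> Ga; exists [:: (1, a)]; rewrite big_seq1 mul1r; split=> // u.
by rewrite inE => /eqP ->.
Qed.

Section QuotientLocalizationMorphisms.
Variables (A : comNzRingType) (I M : A -> Prop) (O : comUnitRingType).
Variables (f : {rmorphism A -> O}) (fP : is_quotient_localization I M f).
Variable B : comUnitRingType.

(** Universal property, by choosing a fraction for each y. [hE] asks that s become a unit in both
    rings rather than that s avoid M, so that products of denominators qualify without M being known
    to be prime. *)
Lemma quotient_localization_lift (g : {rmorphism A -> B}) :
  (forall a, I a -> g a = 0) -> (forall s, ~ M s -> g s \is a GRing.unit) ->
  exists h : {rmorphism O -> B}, forall a, h (f a) = g a.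
Proof.
move=> gI gM; have [fM f_frac f_eq0] := fP.
have frac_ex (y : O) : exists w : A * A, ~ M w.2 /\ y = f w.1 / f w.2.
  by have [a [s h]] := f_frac y; exists (a, s).
have [w hw] := choice frac_ex.
pose h y := g (w y).1 / g (w y).2.
have hE y a s : f s \is a GRing.unit -> g s \is a GRing.unit ->
    y * f s = f a -> h y = g a / g s.
  move=> ufs ugs ya; have [Mw yw] := hw y.
  have ufw := fM _ Mw; have ugw := gM _ Mw.
  have /f_eq0[u [Mu /gI]] : f ((w y).1 * s - a * (w y).2) = 0.
    by rewrite rmorphB !rmorphM -ya {2}yw mulrAC divrK // subrr.
  rewrite rmorphM => /(canRL (mulKr (gM _ Mu))); rewrite mulr0 rmorphB !rmorphM.
  move=> /eqP; rewrite subr_eq0 => /eqP e.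
  by apply: (canRL (mulrK ugs)); rewrite /h mulrAC e mulrK.
have wK y : y * f (w y).2 = f (w y).1.
  by have [My ey] := hw y; rewrite {1}ey divrK ?fM.
have hf a : h (f a) = g a.
  by rewrite (hE _ a 1) ?rmorph1 ?unitr1 ?mulr1 ?divr1.
have hadd : zmod_morphism h.
  move=> x y; have [[Mx ex] [My ey]] := (hw x, hw y).
  rewrite (hE _ ((w x).1 * (w y).2 - (w y).1 * (w x).2) ((w x).2 * (w y).2)).
  - rewrite /h rmorphB !rmorphM invrM ?gM // mulrBl.
    congr (_ - _); first by rewrite mulrA mulrK ?gM.
    by rewrite [(g (w y).2)^-1 * _]mulrC mulrA mulrK ?gM.
  - by rewrite rmorphM unitrM !fM.
  - by rewrite rmorphM unitrM !gM.
  - rewrite rmorphB !rmorphM mulrBl mulrA wK; congr (_ - _).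
    by rewrite [f (w x).2 * _]mulrC mulrA wK.
have hmul : monoid_morphism h.
  split; first by rewrite -(rmorph1 f) hf rmorph1.
  move=> x y; have [[Mx ex] [My ey]] := (hw x, hw y).
  rewrite (hE _ ((w x).1 * (w y).1) ((w x).2 * (w y).2)).
  - by rewrite /h !rmorphM invrM ?gM // [X in _ * X = _]mulrC mulrACA.
  - by rewrite rmorphM unitrM !fM.
  - by rewrite rmorphM unitrM !gM.
  - by rewrite !rmorphM mulrACA !wK.
pose F : {rmorphism O -> B} := HB.pack h
  (GRing.isZmodMorphism.Build O B h hadd) (GRing.isMonoidMorphism.Build O B h hmul).
by exists F.
Qed.

Lemma quotient_localization_ext (g h : {rmorphism O -> B}) :
  (forall a, g (f a) = h (f a)) -> g =1 h.
Proof.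
move=> e y; have [fM f_frac _] := fP; have [a [s [Ms ->]]] := f_frac y.
by rewrite !rmorphM !rmorphV ?fM ?e.
Qed.

End QuotientLocalizationMorphisms.

(** M being the kernel of a map to a field, the numerator decides whether a fraction is a unit;
    membership in [max_ideal] becomes vanishing of rho. *)
Lemma residue_map (A : comNzRingType) (I M : A -> Prop) (O : comUnitRingType)
    (f : {rmorphism A -> O}) (K : fieldType) (ev : {rmorphism A -> K}) :
  is_quotient_localization I M f -> (forall a, I a -> ev a = 0) ->
  (forall a, M a <-> ev a = 0) ->
  exists rho : {rmorphism O -> K}, (forall a, rho (f a) = ev a) /\
    forall y, (y \is a GRing.unit) = (rho y != 0).
Proof.
move=> fP evI evM; have [|rho hrho] := quotient_localization_lift fP evI.
  by move=> s Ms; rewrite unitfE; apply/eqP => /evM.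
exists rho; split=> // y; apply/idP/idP => [uy|].
  by rewrite -unitfE rmorph_unit.
have [fM f_frac _] := fP; have [a [s [Ms ->]]] := f_frac y.
rewrite rmorphM mulf_eq0 negb_or hrho => /andP[ea _].
rewrite unitrM unitrV !fM // => /evM ea0; by rewrite ea0 eqxx in ea.
Qed.

Lemma mpoly_rmorph_ext n (R S : comNzRingType) (f g : {rmorphism {mpoly R[n]} -> S}) :
  (forall a, f a%:MP = g a%:MP) -> (forall i, f 'X_i = g 'X_i) -> f =1 g.
Proof.
move=> eC eX p; rewrite (mpolyE p) !rmorph_sum; apply: eq_bigr => m _ /=.
rewrite -mul_mpolyC !rmorphM eC mpolyXE_id !rmorph_prod; congr (_ * _).
by apply: eq_bigr => i _; rewrite !rmorphXn eX.
Qed.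

Section SchemePoints.
Variables (K : closedFieldType) (T : vectType K) (alpha : nat -> 'Hom(T, K^o)).
Variables (n : nat).
Local Notation coord_ring n := {mpoly K[#|{: mindex alpha n}|]}.

Section Morphism.
Variables (B : comNzRingType) (f : {rmorphism coord_ring n -> B}).
Variable A : {set mindex alpha n}.

Lemma jacobi_coordX i j k l :
  f (jacobi (sc (@coordX K T alpha n)) i j k l) =
  jacobi (sc (fun a => f (coordX a))) i j k l.
Proof. by rewrite jacobi_rmorph; apply: eq_jacobi => *; rewrite sc_rmorph. Qed.

Lemma scheme_eq_vanish :
  (forall i j k l, jacobi (sc (fun a => f (coordX a))) i j k l = 0) ->
  (forall a, a \in A -> f (coordX a) = 1) ->
  forall p, ideal_gen (scheme_eq A) p -> f p = 0.
Proof.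
move=> fJ fA; apply: ideal_gen_vanish => _ [i j k l|a aA].
  by rewrite jacobi_coordX.
by rewrite rmorphB rmorph1 fA // subrr.
Qed.

Lemma scheme_eq_point :
  (forall p, ideal_gen (scheme_eq A) p -> f p = 0) ->
  (forall i j k l, jacobi (sc (fun a => f (coordX a))) i j k l = 0) /\
  (forall a, a \in A -> f (coordX a) = 1).
Proof.
move=> h; split=> [i j k l|a aA].
  by rewrite -jacobi_coordX h //; apply: ideal_gen_mem; apply: JacobiEq.
apply/eqP; rewrite -subr_eq0 -(rmorph1 f) -rmorphB; apply/eqP.
by apply: h; apply: ideal_gen_mem; apply: OneEq.
Qed.

Lemma coord_ring_ext (g : {rmorphism coord_ring n -> B}) :
  (forall a, f a%:MP = g a%:MP) -> (forall a, f (coordX a) = g (coordX a)) ->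
  f =1 g.
Proof.
move=> eC eX; apply: mpoly_rmorph_ext => // i.
by have := eX (enum_val i); rewrite /coordX enum_valK.
Qed.

End Morphism.

Lemma coord_ring_eval (B : comNzRingType) (iota : {rmorphism K -> B})
    (x : mindex alpha n -> B) :
  exists f : {rmorphism coord_ring n -> B},
    (forall a, f a%:MP = iota a) /\ (forall a, f (coordX a) = x a).
Proof.
exists (mmap iota (fun i => x (enum_val i))); split=> a; first exact: mmapC.
by rewrite /coordX /= mmapX mmap1U enum_rankK.
Qed.

Lemma local_ring_residue (A : {set mindex alpha n}) (phi : {ffun mindex alpha n -> K})
    (O : comUnitRingType) (f : {rmorphism coord_ring n -> O}) :
  is_law_on A phi -> is_local_ring A phi f ->
  exists rho : {rmorphism O -> K},
  [/\ forall p, rho (f p) = p.@[fun i => phi (enum_val i)],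
      forall a, rho (f (coordX a)) = phi a
    & forall y, (y \is a GRing.unit) = (rho y != 0)].
Proof.
move=> [phiJ phiA] fP.
pose ev : {rmorphism coord_ring n -> K} := meval (fun i => phi (enum_val i)).
have evX a : ev (coordX a) = phi a by rewrite /ev /= mevalXU enum_rankK.
have [|rho [rhof rhoU]] := residue_map (ev := ev) fP _ (fun a => iff_refl _).
  apply: scheme_eq_vanish => [i j k l|a /phiA]; rewrite ?evX //.
  by rewrite -[RHS](phiJ i j k l); apply: eq_jacobi => *; apply: eq_sc => a; rewrite evX.
by exists rho; split=> // a; rewrite rhof evX.
Qed.

End SchemePoints.

Section OriginIdeal.
Variables (K : fieldType) (O : comUnitRingType) (rho : {rmorphism O -> K}).
Hypothesis rho_unit : forall y, (y \is a GRing.unit) = (rho y != 0).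
Variable d : nat.

(** Modulo the T_k a polynomial is its constant term, which is a non-unit exactly when its residue
    vanishes. Being the kernel of a map to a field, the ideal is prime. *)
Lemma origin_idealP (p : {mpoly O[d]}) :
  origin_ideal p <-> mmap rho (fun=> 0) p = 0.
Proof.
have [G0 GD GM] := ideal_gen_ideal (fun p : {mpoly O[d]} =>
  (exists2 c, max_ideal c & p = c%:MP) \/ (exists k, p = 'X_k)).
split=> [|p0].
  apply: ideal_gen_vanish => _ [[c mc ->]|[k ->]].
    by rewrite /= mmapC; apply/eqP; move: mc; rewrite /max_ideal rho_unit negbK.
  by rewrite /= mmapX mmap1U.
have H (q : {mpoly O[d]}) : origin_ideal (q - (q@_0%MM)%:MP).
  elim/mpolyind: q => [|c m q _ _ IH].
    by rewrite mcoeff0 mpolyC0 subrr.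
  rewrite mcoeffD mpolyCD opprD addrACA; apply: GD => //.
  have [->|m0] := eqVneq m 0%MM.
    by rewrite mcoeffZ mcoeffX eqxx mulr1 mpolyX0 -mul_mpolyC mulr1 subrr.
  rewrite mcoeffZ mcoeffX (negbTE m0) mulr0 mpolyC0 subr0.
  have [k mk] : exists k, m k != 0%N.
    case: (pselect (exists k, m k != 0%N)) => // no; case/eqP: m0; apply/mnmP => k.
    by rewrite mnm0E; apply/eqP/negPn/negP => h; apply: no; exists k.
  rewrite -mul_mpolyC mpolyXE_id (bigD1 k) //=.
  case: (m k) mk => // r _; rewrite exprS -mulrA ['X_k * _]mulrC mulrA.
  by apply: GM; apply: ideal_gen_mem; right; exists k.
rewrite -[p](subrK (p@_0%MM)%:MP); apply: GD; first exact: H.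
have : mmap rho (fun=> 0) (p - (p@_0%MM)%:MP) = 0.
  have := H p; apply: ideal_gen_vanish => _ [[c mc ->]|[k ->]].
    by rewrite /= mmapC; apply/eqP; move: mc; rewrite /max_ideal rho_unit negbK.
  by rewrite /= mmapX mmap1U.
rewrite mmapB p0 mmapC sub0r => /eqP; rewrite oppr_eq0 => c0.
apply: ideal_gen_mem; left; exists p@_0%MM => //.
by rewrite /max_ideal rho_unit c0.
Qed.

End OriginIdeal.

Section LocalRings.
Variables (K : closedFieldType) (T : vectType K) (alpha : nat -> 'Hom(T, K^o)).
Variables (n : nat).
Hypothesis alpha_neq0 : forall i, (i <= n)%N -> alpha i != 0.
Hypothesis alpha_new : forall i j, (i < n)%N -> (j < n)%N ->
  alpha n <> alpha i - alpha j.
Variables (pq : mindex alpha n.+1) (pq_new : target pq = ord_max).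
Variables (A : {set mindex alpha n}) (phi : {ffun mindex alpha n -> K}).
Hypothesis phi_law : is_law_on A phi.
Let A1 : {set mindex alpha n.+1} := pq |: [set mindex_widen b | b in A].
Variable phi1 : {ffun mindex alpha n.+1 -> K}.
Hypothesis phi1_law : is_law_on A1 phi1.
Hypothesis phi1_proj : law_proj phi1 = phi.

Local Notation coord_ring n := {mpoly K[#|{: mindex alpha n}|]}.
Local Notation M := (free_coords pq).

Variables (O O1 : comUnitRingType).
Variables (f : {rmorphism coord_ring n -> O}) (f1 : {rmorphism coord_ring n.+1 -> O1}).
Hypothesis fP : is_local_ring A phi f.
Hypothesis f1P : is_local_ring A1 phi1 f1.

Lemma phi1_widen a : phi1 (mindex_widen a) = phi a.
Proof. by rewrite -phi1_proj ffunE. Qed.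

Lemma phi1_pq : phi1 pq = 1.
Proof. by apply: phi1_law.2; rewrite !inE eqxx. Qed.

Lemma phi1_cocycle t : cocycle_lhs (sc phi) (new_part phi1) t = 0.
Proof.
rewrite -[RHS](cocycle_new alpha_neq0 alpha_new phi1_law.1 t).
apply: eq_cocycle_lhs => // i j k; apply: eq_sc => a.
by rewrite /old_part phi1_widen.
Qed.

Definition proj_comorph_rmorph : {rmorphism coord_ring n -> coord_ring n.+1} :=
  mmap (@mpolyC _ K) (fun i => coordX (mindex_widen (enum_val i))).

Lemma proj_comorphE p : proj_comorph p = proj_comorph_rmorph p.
Proof. by []. Qed.

Lemma proj_comorphC a : proj_comorph a%:MP = a%:MP :> coord_ring n.+1.
Proof. exact: mmapC. Qed.

Lemma proj_comorphX a : proj_comorph (@coordX K T alpha n a) = coordX (mindex_widen a).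
Proof. by rewrite /proj_comorph /coordX mmapX mmap1U enum_rankK. Qed.

(** The tautological point: the coordinate functions form a law with values in O1. *)
Lemma local_ring_point : let y b := f1 (coordX b) in
  [/\ forall i j k l, jacobi (sc (old_part y)) i j k l = 0,
      forall t, cocycle_lhs (sc (old_part y)) (new_part y) t = 0,
      y pq = 1 & forall a, a \in A -> y (mindex_widen a) = 1].
Proof.
move=> y; have [_ _ f1_eq0] := f1P.
have f1I p : ideal_gen (scheme_eq A1) p -> f1 p = 0.
  move=> hp; apply/f1_eq0; exists 1; rewrite mul1r; split=> //.
  by rewrite /point_ideal meval1; apply/eqP; rewrite oner_eq0.
have [J y1] := scheme_eq_point f1I; split.
- exact: jacobi_old.
- exact: cocycle_new.
- by apply: y1; rewrite !inE eqxx.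
- by move=> a aA; apply: y1; rewrite !inE imset_f ?orbT.
Qed.

(** A function nonzero at phi pulls back to one nonzero at phi1, as phi1 projects to phi; so the
    pullback extends to the localization. *)
Lemma local_ring_map : exists h : {rmorphism O -> O1},
  forall p, h (f p) = f1 (proj_comorph p).
Proof.
have [J C ypq yA] := local_ring_point.
pose g : {rmorphism coord_ring n -> O1} := f1 \o proj_comorph_rmorph.
have gX a : g (coordX a) = f1 (coordX (mindex_widen a)).
  by rewrite /g /= -proj_comorphE proj_comorphX.
have [|s Ms|h hh] := quotient_localization_lift (g := g) fP; last by exists h.
  apply: scheme_eq_vanish => [i j k l|a aA]; last by rewrite gX yA.
  by rewrite -[RHS](J i j k l); apply: eq_jacobi => *; apply: eq_sc => a; rewrite gX.
have [rho1 [rho1f _ rho1U]] := local_ring_residue phi1_law f1P.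
rewrite rho1U /g /= rho1f; apply/eqP => e; apply: Ms.
rewrite /point_ideal -[RHS]e.
pose ev1 : {rmorphism coord_ring n.+1 -> K} := meval (fun i => phi1 (enum_val i)).
pose ev : {rmorphism coord_ring n -> K} := meval (fun i => phi (enum_val i)).
pose ev1P : {rmorphism coord_ring n -> K} := ev1 \o proj_comorph_rmorph.
apply: (coord_ring_ext (f := ev) (g := ev1P)) => a.
  by rewrite /ev1P /= -proj_comorphE proj_comorphC /ev /ev1 /= !mevalC.
rewrite /ev1P /= -proj_comorphE proj_comorphX /ev /ev1 /= /coordX !mevalXU.
by rewrite !enum_rankK phi1_widen.
Qed.

End LocalRings.

(** * Presentation of the local ring of the extension *)

Section Presentation.
Variables (K : closedFieldType) (T : vectType K) (alpha : nat -> 'Hom(T, K^o)).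
Variables (n : nat).
Hypothesis alpha_neq0 : forall i, (i <= n)%N -> alpha i != 0.
Hypothesis alpha_new : forall i j, (i < n)%N -> (j < n)%N ->
  alpha n <> alpha i - alpha j.
Variables (pq : mindex alpha n.+1) (pq_new : target pq = ord_max).
Variables (A : {set mindex alpha n}) (phi : {ffun mindex alpha n -> K}).
Hypothesis phi_law : is_law_on A phi.
Let A1 : {set mindex alpha n.+1} := pq |: [set mindex_widen b | b in A].
Variable phi1 : {ffun mindex alpha n.+1 -> K}.
Hypothesis phi1_law : is_law_on A1 phi1.
Hypothesis phi1_proj : law_proj phi1 = phi.
Variable L1 : {set 'I_n * 'I_n * 'I_n}.
Hypothesis L1_min : min_subsystem phi pq L1.

Local Notation coord_ring n := {mpoly K[#|{: mindex alpha n}|]}.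
Local Notation M := (free_coords pq).

Variables (d : nat) (cardM : #|M| = (#|L1| + d)%N).
Variables (O O1 : comUnitRingType).
Variables (f : {rmorphism coord_ring n -> O}) (f1 : {rmorphism coord_ring n.+1 -> O1}).
Hypothesis fP : is_local_ring A phi f.
Hypothesis f1P : is_local_ring A1 phi1 f1.

Let x a : O := f (coordX a).
Let y b : O1 := f1 (coordX b).
Let iota : {rmorphism K -> O} := f \o @mpolyC #|{: mindex alpha n}| K.
Let Amx : 'M[O]_(#|L1|, #|M|) :=
  \matrix_(i, j) cocycle_coef (sc x) (enum_val j) (enum_val i).
Let bmx : 'cV[O]_#|L1| := \col_i cocycle_coef (sc x) pq (enum_val i).
Let x0 : 'cV[K]_#|M| := \col_j phi1 (enum_val j).
Let ymx : 'cV[O1]_#|M| := \col_j y (enum_val j).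

Variables (rho : {rmorphism O -> K}) (rho1 : {rmorphism O1 -> K}).
Hypothesis rhof : forall p, rho (f p) = p.@[fun i => phi (enum_val i)].
Hypothesis rhoX : forall a, rho (f (coordX a)) = phi a.
Hypothesis rhoU : forall z, (z \is a GRing.unit) = (rho z != 0).
Hypothesis rho1f : forall p, rho1 (f1 p) = p.@[fun i => phi1 (enum_val i)].
Hypothesis rho1X : forall b, rho1 (f1 (coordX b)) = phi1 b.
Hypothesis rho1U : forall z, (z \is a GRing.unit) = (rho1 z != 0).

Let phi1_cocycle' := phi1_cocycle alpha_neq0 alpha_new phi1_law phi1_proj.

Let phi1_pq' : phi1 pq = 1 := phi1_pq phi1_law.

Lemma iotaK : cancel iota rho.
Proof. by move=> a; rewrite /iota /= rhof mevalC. Qed.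

Lemma rho_sc i j k : rho (sc x i j k) = sc phi i j k.
Proof. by rewrite sc_rmorph; apply: eq_sc => a; rewrite rhoX. Qed.

Lemma rho_cocycle_coef (b : mindex alpha n.+1) t : rho (cocycle_coef (sc x) b t) = cocycle_coef (sc phi) b t.
Proof. by rewrite cocycle_coef_rmorph; apply: eq_cocycle_lhs => *; rewrite ?rho_sc. Qed.

Lemma rho_Amx : map_mx rho Amx = free_matrix pq phi L1.
Proof. by apply/matrixP => i j; rewrite !mxE rho_cocycle_coef. Qed.

Lemma cocycle_coef_phi1 t :
  cocycle_coef (sc phi) pq t
  + \sum_(j < #|M|) phi1 (enum_val j) * cocycle_coef (sc phi) (enum_val j) t = 0.
Proof.
by rewrite -[RHS](phi1_cocycle' t) cocycle_lhs_coef (sum_target_max pq_new) phi1_pq' mul1r.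
Qed.

Lemma x0_solution : map_mx rho Amx *m x0 + map_mx rho bmx = 0.
Proof.
apply/matrixP => i k; rewrite !mxE rho_cocycle_coef -[RHS](cocycle_coef_phi1 (enum_val i)).
rewrite addrC; congr (_ + _); apply: eq_bigr => j _.
by rewrite !mxE rho_cocycle_coef mulrC.
Qed.

Lemma Amx_free : row_free (map_mx rho Amx).
Proof.
by rewrite rho_Amx; apply: (free_matrix_free pq_new phi1_pq' phi1_cocycle' L1_min).
Qed.

Let rho_unit' z : rho z != 0 -> z \is a GRing.unit.
Proof. by rewrite rhoU. Qed.

Lemma system_solution :
  exists (N : 'M[O]_(d, #|M|)) (u : 'cV[O]_#|M|) (v : 'M[O]_(#|M|, d)),
  [/\ Amx *m u + bmx = 0, Amx *m v = 0, map_mx rho u = x0,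
      N *m u = N *m map_mx iota x0 & N *m v = 1%:M] /\
  forall (B : comNzRingType) (h : {rmorphism O -> B}) (z : 'cV[B]_#|M|),
    map_mx h Amx *m z + map_mx h bmx = 0 ->
    z = map_mx h u + map_mx h v *m (map_mx h N *m (z - map_mx h (map_mx iota x0))).
Proof. exact: (local_linear_system iotaK rho_unit' cardM Amx_free x0_solution). Qed.

Variables (N : 'M[O]_(d, #|M|)) (u : 'cV[O]_#|M|) (v : 'M[O]_(#|M|, d)).
Hypothesis Au : Amx *m u + bmx = 0.
Hypothesis Av : Amx *m v = 0.
Hypothesis rho_u : map_mx rho u = x0.
Hypothesis Nu : N *m u = N *m map_mx iota x0.
Hypothesis Nv : N *m v = 1%:M.
Hypothesis solE : forall (B : comNzRingType) (h : {rmorphism O -> B}) (z : 'cV[B]_#|M|),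
    map_mx h Amx *m z + map_mx h bmx = 0 ->
    z = map_mx h u + map_mx h v *m (map_mx h N *m (z - map_mx h (map_mx iota x0))).
Variable h : {rmorphism O -> O1}.
Hypothesis hf : forall p, h (f p) = f1 (proj_comorph p).

Local Notation B := {mpoly O[d]}.
Let cst : {rmorphism O -> B} := @mpolyC d O.

(** The universal solution of the equations of L1: over O_n[T], the free coordinates are u + v T. *)
Let Y (j : 'I_#|M|) : B := (u j 0)%:MP + \sum_k (v j k)%:MP * 'X_k.
Let X : mindex alpha n.+1 -> B := assemble (pq := pq) (fun a => (x a)%:MP) Y.

(** These are the c_0 and c_k of the presentation, obtained by substituting u + v T in the equation
    of index t. *)
Definition affine_c0 (t : 'I_n * 'I_n * 'I_n) : O :=
  cocycle_coef (sc x) pq t + \sum_j u j 0 * cocycle_coef (sc x) (enum_val j) t.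
Definition affine_c (t : 'I_n * 'I_n * 'I_n) (k : 'I_d) : O :=
  \sum_j v j k * cocycle_coef (sc x) (enum_val j) t.

Lemma old_part_X a : old_part X a = (x a)%:MP.
Proof. exact: assemble_old. Qed.

Lemma sc_old_X i j k : sc (old_part X) i j k = (sc x i j k)%:MP.
Proof. by rewrite (sc_rmorph cst); apply: eq_sc => a; rewrite old_part_X. Qed.

Lemma cocycle_X t : cocycle_lhs (sc (old_part X)) (new_part X) t =
  (affine_c0 t)%:MP + \sum_(k < d) (affine_c t k)%:MP * 'X_k.
Proof.
rewrite (eq_cocycle_lhs _ sc_old_X (fun _ _ => erefl)) (cocycle_assemble pq_new).
have cc (b : mindex alpha n.+1) : cocycle_coef (fun i j k => (sc x i j k)%:MP : B) b t
    = (cocycle_coef (sc x) b t)%:MP by rewrite (cocycle_coef_rmorph cst).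
rewrite cc /affine_c0 mpolyCD -addrA; congr (_ + _).
under [X in _ = _ + X]eq_bigr => k _.
  rewrite /affine_c (rmorph_sum cst) mulr_suml.
  over.
rewrite exchange_big (rmorph_sum cst) -big_split; apply: eq_bigr => j _ /=.
rewrite cc mulrDl mpolyCM mulr_suml; congr (_ + _); apply: eq_bigr => k _.
by rewrite mpolyCM mulrAC.
Qed.

Lemma affine_c0_L1 t : t \in L1 -> affine_c0 t = 0.
Proof.
move=> tL; have := congr1 (fun w : 'cV_#|L1| => w (enum_rank_in tL t) 0) Au.
rewrite !mxE enum_rankK_in // addrC => e; rewrite -[RHS]e; congr (_ + _).
by apply: eq_bigr => j _; rewrite !mxE enum_rankK_in // mulrC.
Qed.

Lemma affine_c_L1 t k : t \in L1 -> affine_c t k = 0.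
Proof.
move=> tL; have := congr1 (fun w : 'M_(#|L1|, d) => w (enum_rank_in tL t) k) Av.
rewrite !mxE => e; rewrite -[RHS]e.
by apply: eq_bigr => j _; rewrite !mxE enum_rankK_in // mulrC.
Qed.

(** The residue of u is given by phi1, which satisfies every equation and not only those of L1. *)
Lemma rho_affine_c0 t : rho (affine_c0 t) = 0.
Proof.
rewrite /affine_c0 rmorphD /= rho_cocycle_coef rmorph_sum -[RHS](cocycle_coef_phi1 t).
congr (_ + _); apply: eq_bigr => j _; rewrite rmorphM /= rho_cocycle_coef.
by have := congr1 (fun w : 'cV_#|M| => w j 0) rho_u; rewrite !mxE => ->.
Qed.

(** Each column of the residue of v solves the linear parts of L1, hence those of all equations. *)
Lemma rho_affine_c t k : rho (affine_c t k) = 0.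
Proof.
have hv : free_matrix pq phi L1 *m col k (map_mx rho v) = 0.
  by rewrite -rho_Amx colE mulmxA -map_mxM Av map_mx0 mul0mx.
rewrite -[RHS](free_matrix_ker pq_new phi1_pq' phi1_cocycle' L1_min hv t) rmorph_sum.
by apply: eq_bigr => j _; rewrite rmorphM /= rho_cocycle_coef !mxE.
Qed.

Lemma max_ideal_affine t : max_ideal (affine_c0 t) /\ forall k, max_ideal (affine_c t k).
Proof.
by split=> [|k]; rewrite /max_ideal rhoU ?rho_affine_c0 ?rho_affine_c eqxx.
Qed.

(** The images of the T_k, centred at phi1 so that they lie in the maximal ideal of O1. *)
Let tau : 'cV[O1]_d := map_mx h N *m (ymx - map_mx h (map_mx iota x0)).

Definition presentation_map : {rmorphism B -> O1} := mmap h (fun k => tau k 0).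
Local Notation g := presentation_map.

Lemma presentation_mapC c : g c%:MP = h c.
Proof. exact: mmapC. Qed.

Lemma presentation_mapX k : g 'X_k = tau k 0.
Proof. by rewrite /g /= mmapX mmap1U. Qed.

Let point1 := local_ring_point alpha_neq0 alpha_new f1P.

Lemma local_map_coord a : h (x a) = y (mindex_widen a).
Proof. by rewrite hf proj_comorphX. Qed.

Lemma ymx_solution : map_mx h Amx *m ymx + map_mx h bmx = 0.
Proof.
have [_ C ypq _] := point1.
apply/matrixP => i k; rewrite [k]ord1 !mxE -[RHS](C (enum_val i)).
rewrite cocycle_lhs_coef (sum_target_max pq_new) ypq mul1r addrC.
have cc (b : mindex alpha n.+1) t : h (cocycle_coef (sc x) b t)
    = cocycle_coef (sc (old_part (fun b => f1 (coordX b)))) b t.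
  rewrite cocycle_coef_rmorph; apply: eq_cocycle_lhs => // i' j' k'.
  by rewrite sc_rmorph; apply: eq_sc => a; rewrite local_map_coord.
rewrite cc; congr (_ + _); apply: eq_bigr => j _.
by rewrite !mxE cc mulrC.
Qed.

(** The tautological point solves the equations of L1, so [solE] writes it as u + v tau. *)
Lemma presentation_map_X b : g (X b) = y b.
Proof.
have [_ _ ypq _] := point1.
rewrite /X assemble_rmorph.
rewrite -(assembleK pq_new (z := y) alpha_neq0 alpha_new ypq b).
apply: eq_assemble => [a|j].
  by rewrite presentation_mapC local_map_coord.
rewrite /Y rmorphD rmorph_sum presentation_mapC.
have := congr1 (fun w : 'cV_#|M| => w j 0) (solE ymx_solution).
rewrite -/tau !mxE => ->; congr (_ + _); apply: eq_bigr => k _.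
by rewrite rmorphM presentation_mapC presentation_mapX !mxE.
Qed.

(** Substituting the universal solution for the coordinates turns every fraction of O1 into a
    fraction of images of elements of O_n[T]. *)
Lemma theta_exists : exists theta : {rmorphism coord_ring n.+1 -> B},
  [/\ forall a, theta a%:MP = (iota a)%:MP, forall b, theta (coordX b) = X b
    & forall p, g (theta p) = f1 p].
Proof.
have [theta [tC tX]] := coord_ring_eval (cst \o iota) X.
exists theta; split=> //.
pose gt : {rmorphism coord_ring n.+1 -> O1} := g \o theta.
apply: (coord_ring_ext (f := gt)) => [a|b]; rewrite /gt [LHS]/=; last first.
  by rewrite tX presentation_map_X.
have -> : theta a%:MP = (iota a)%:MP by exact: tC.
by rewrite presentation_mapC /iota /= hf proj_comorphC.
Qed.

Let ev0 : {rmorphism B -> K} := mmap rho (fun _ : 'I_d => 0 : K).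

Lemma rho1_h c : rho1 (h c) = rho c.
Proof.
pose rh : {rmorphism O -> K} := rho1 \o h.
apply: (quotient_localization_ext fP (g := rh)) => p.
pose r1 : {rmorphism coord_ring n -> K} := rh \o f.
pose r2 : {rmorphism coord_ring n -> K} := rho \o f.
apply: (coord_ring_ext (f := r1) (g := r2)) => a; rewrite /r1 /r2 /rh /= hf.
  by rewrite proj_comorphC rho1f rhof !mevalC.
by rewrite proj_comorphX rho1X rhoX (phi1_widen phi1_proj).
Qed.

Lemma rho1_g p : rho1 (g p) = ev0 p.
Proof.
pose r1 : {rmorphism B -> K} := rho1 \o g.
apply: (mpoly_rmorph_ext (f := r1)) => [a|k]; rewrite /r1 [LHS]/=.
  by rewrite presentation_mapC rho1_h /ev0 /= mmapC.
rewrite presentation_mapX /ev0 /= mmapX mmap1U /tau.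
have -> : rho1 ((map_mx h N *m (ymx - map_mx h (map_mx iota x0))) k 0)
    = (map_mx rho1 (map_mx h N) *m map_mx rho1 (ymx - map_mx h (map_mx iota x0))) k 0.
  by rewrite -map_mxM [RHS]mxE.
rewrite (_ : map_mx rho1 (_ - _) = 0) ?mulmx0 ?mxE //.
apply/matrixP => i j; rewrite !mxE rmorphB rho1X rho1_h iotaK subrr //.
Qed.

Lemma presentation_map_localization :
  is_quotient_localization
    (affine_ideal (Lambda alpha n :\: L1) affine_c0 affine_c)
    (@origin_ideal O d) g.
Proof.
have [theta [tC tX tg]] := theta_exists.
have originP := origin_idealP rhoU.
have unit_theta s : ~ point_ideal phi1 s -> ~ origin_ideal (theta s).
  by move=> Ms /originP e; apply: Ms; rewrite /point_ideal -rho1f -tg rho1_g.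
have gE t : g ((affine_c0 t)%:MP + \sum_(k < d) (affine_c t k)%:MP * 'X_k) = 0.
  have [_ C _ _] := point1.
  rewrite -cocycle_X cocycle_lhs_rmorph -[RHS](C t); apply: eq_cocycle_lhs => [i j k|i j].
    by rewrite sc_rmorph; apply: eq_sc => a; apply: presentation_map_X.
  by rewrite new_part_rmorph; apply: eq_sc => a; apply: presentation_map_X.
have gI p : affine_ideal (Lambda alpha n :\: L1) affine_c0 affine_c p -> g p = 0.
  by apply: ideal_gen_vanish => _ [t _ ->]; apply: gE.
have unit_g s : ~ origin_ideal s -> g s \is a GRing.unit.
  by move=> Ms; rewrite rho1U rho1_g; apply/eqP => e; apply: Ms; apply/originP.
split=> // [z|p].
  have [_ f1_frac _] := f1P; have [a [s [Ms ->]]] := f1_frac z.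
  by exists (theta a), (theta s); split; [apply: unit_theta | rewrite !tg].
split=> [gp0|[s [Ms /gI]]]; last first.
  rewrite rmorphM => /(canRL (mulKr (unit_g _ Ms))).
  by rewrite mulr0.
have [I0 ID IM] := ideal_gen_ideal (fun p : B => exists2 t,
  t \in Lambda alpha n :\: L1 &
  p = (affine_c0 t)%:MP + \sum_(k < d) (affine_c t k)%:MP * 'X_k).
(* The clause to prove says that p dies in this localization L; it suffices to factor [lam] through
   [g]. *)
have [||a b|L [lam lamP]] := @quotient_localization_exists B
    (affine_ideal (Lambda alpha n :\: L1) affine_c0 affine_c) (@origin_ideal O d) I0 ID IM.
- by move=> a aI; apply/originP; rewrite -[mmap _ _ _]rho1_g gI ?rmorph0.
- by move=> /originP /eqP; rewrite -[mmap _ _ _]/(ev0 1) rmorph1 oner_eq0.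
- move=> /originP /eqP; rewrite -[mmap _ _ _]/(ev0 (a * b)) rmorphM mulf_eq0.
  by case/orP => /eqP e; [left | right]; apply/originP.
have [lamU _ lam_eq0] := lamP; apply/lam_eq0.
have lamI q : affine_ideal (Lambda alpha n :\: L1) affine_c0 affine_c q -> lam q = 0.
  move=> hq; apply/lam_eq0; exists 1; rewrite mul1r; split=> //.
  by move=> /originP /eqP; rewrite -[mmap _ _ _]/(ev0 1) rmorph1 oner_eq0.
pose lt : {rmorphism coord_ring n.+1 -> L} := lam \o theta.
have ltX b : lt (coordX b) = lam (X b) by rewrite /lt [LHS]/= tX.
have fpt : (forall i j k l, jacobi (sc x) i j k l = 0) /\ (forall a, a \in A -> x a = 1).
  apply: scheme_eq_point => q hq; have [_ _ f_eq0] := fP; apply/f_eq0.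
  exists 1; rewrite mul1r; split=> //.
  by rewrite /point_ideal meval1; apply/eqP; rewrite oner_eq0.
(* The images in L of the coordinates X form a law: the equations of L1 hold identically, the others
   by construction of L. This law defines k from O1 to L. *)
have [|s Ms|k hk] := quotient_localization_lift (g := lt) f1P.
- apply: scheme_eq_vanish => [|b].
    apply: (jacobi_extension alpha_neq0 alpha_new) => [i j k l|t tL].
      have -> : jacobi (sc (old_part (fun b => lt (coordX b)))) i j k l =
          lam (cst (jacobi (sc x) i j k l)).
        rewrite !jacobi_rmorph; apply: eq_jacobi => i' j' k'.
        rewrite !sc_rmorph; apply: eq_sc => a.
        by rewrite /old_part ltX; congr (lam _); apply: old_part_X.
      by rewrite fpt.1 !rmorph0.
    have -> : cocycle_lhs (sc (old_part (fun b => lt (coordX b))))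
        (new_part (fun b => lt (coordX b))) t =
        lam (cocycle_lhs (sc (old_part X)) (new_part X) t).
      rewrite cocycle_lhs_rmorph; apply: eq_cocycle_lhs => *.
        by rewrite sc_rmorph; apply: eq_sc => a; apply: ltX.
      by rewrite new_part_rmorph; apply: eq_sc => a; apply: ltX.
    rewrite cocycle_X; have [tL1|tL1] := boolP (t \in L1).
      rewrite affine_c0_L1 // mpolyC0 add0r big1 ?rmorph0 // => k _.
      by rewrite affine_c_L1 // mpolyC0 mul0r.
    by apply: lamI; apply: ideal_gen_mem; exists t; rewrite // inE tL1.
  rewrite !inE ltX => /orP[/eqP ->|/imsetP[a aA ->]].
    by rewrite /X assemble_pq // rmorph1.
  by rewrite -[X _]/(old_part X a) old_part_X fpt.2 // mpolyC1 rmorph1.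
- by apply: lamU; apply: unit_theta.
have kg : k \o g =1 lam.
  have kh c : k (h c) = lam c%:MP.
    pose k1 : {rmorphism O -> L} := k \o h.
    pose k2 : {rmorphism O -> L} := lam \o cst.
    apply: (quotient_localization_ext fP (g := k1) (h := k2)) => q.
    rewrite /k1 /k2 [LHS]/= [RHS]/= hf hk.
    pose q1 : {rmorphism coord_ring n -> L} := lt \o proj_comorph_rmorph alpha n.
    pose q2 : {rmorphism coord_ring n -> L} := k2 \o f.
    apply: (coord_ring_ext (f := q1) (g := q2)) => a; rewrite /q1 /q2 [LHS]/= [RHS]/=.
      by rewrite -proj_comorphE proj_comorphC tC.
    by rewrite -proj_comorphE proj_comorphX tX -[X _]/(old_part X a) old_part_X.
  apply: mpoly_rmorph_ext => [c|i]; rewrite [LHS]/=; first by rewrite presentation_mapC kh.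
  (* On the variables the claim is N (u + v T - phi1) = T in L, which follows from [Nu] and [Nv]. *)
  rewrite presentation_mapX /tau.
  pose kap : {rmorphism O -> L} := lam \o cst.
  pose lX : 'cV[L]_d := \col_i lam 'X_i.
  have -> : k ((map_mx h N *m (ymx - map_mx h (map_mx iota x0))) i 0)
      = (map_mx k (map_mx h N *m (ymx - map_mx h (map_mx iota x0)))) i 0 by rewrite [RHS]mxE.
  rewrite map_mxM map_mxB.
  have mk m1 m2 (W : 'M[O]_(m1, m2)) : map_mx k (map_mx h W) = map_mx kap W.
    by apply/matrixP => a b; rewrite !mxE kh.
  have -> : map_mx k ymx = map_mx kap u + map_mx kap v *m lX.
    apply/matrixP => j b; rewrite [b]ord1 !mxE hk ltX /X assemble_free.
    rewrite /Y rmorphD rmorph_sum; congr (_ + _); apply: eq_bigr => l _.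
    by rewrite rmorphM !mxE.
  rewrite !mk mulmxBr mulmxDr mulmxA -!map_mxM Nu Nv map_scalar_mx rmorph1 mul1mx.
  by rewrite addrAC subrr add0r mxE.
by rewrite -kg /= gp0 rmorph0.
Qed.

End Presentation.

(** * Krull dimension of the fiber *)

Section FiberDirections.
Variables (K : closedFieldType) (T : vectType K) (alpha : nat -> 'Hom(T, K^o)).
Variables (n : nat) (pq : mindex alpha n.+1) (pq_new : target pq = ord_max).
Variable phi : {ffun mindex alpha n -> K}.
Variables (x0 : mindex alpha n.+1 -> K) (x0_pq : x0 pq = 1).
Hypothesis x0_cocycle : forall t, cocycle_lhs (sc phi) (new_part x0) t = 0.
Variable L1 : {set 'I_n * 'I_n * 'I_n}.
Hypothesis L1_min : min_subsystem phi pq L1.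
Local Notation M := (free_coords pq).
Variables (d : nat) (cardM : #|M| = (#|L1| + d)%N).

(** K is taken as its own residue field, and the constant terms are chosen so that the given point
    is a solution. *)
Lemma fiber_directions : exists (N : 'M[K]_(d, #|M|)) (v : 'M[K]_(#|M|, d)),
  N *m v = 1%:M /\
  forall t k, \sum_j v j k * cocycle_coef (sc phi) (enum_val j) t = 0.
Proof.
pose A := free_matrix pq phi L1; pose x := (\col_j x0 (enum_val j) : 'cV[K]_#|M|).
have idA m1 m2 (W : 'M[K]_(m1, m2)) : map_mx idfun W = W.
  by apply/matrixP => i j; rewrite !mxE.
have fA : row_free (map_mx idfun A).
  by rewrite idA; apply: (free_matrix_free pq_new x0_pq x0_cocycle L1_min).
have [//|z||N [u [v [[_ Av _ _ Nv] _]]]] := @local_linear_system K K idfun idfun _ _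
    _ _ _ cardM A (- (A *m x)) x fA.
- by rewrite unitfE.
- by rewrite !idA addrN.
exists N, v; split=> // t k.
have hv : A *m col k v = 0 by rewrite colE mulmxA Av mul0mx.
rewrite -[RHS](free_matrix_ker pq_new x0_pq x0_cocycle L1_min hv t).
by apply: eq_bigr => j _; rewrite mxE.
Qed.

(** For d = 0 the matrix of L1 is square with independent rows, hence injective on columns. *)
Lemma fiber_unique (z : mindex alpha n.+1 -> K) : d = 0%N ->
  z pq = 0 -> (forall t, cocycle_lhs (sc phi) (new_part z) t = 0) ->
  forall j, z (enum_val (A := M) j) = 0.
Proof.
move=> d0 z0 zc j.
have sq : #|M| = #|L1| by rewrite cardM d0 addn0.
pose A := free_matrix pq phi L1; pose w := (\col_j z (enum_val j) : 'cV[K]_#|M|).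
have Aw : A *m w = 0.
  apply/matrixP => i k; rewrite !mxE -[RHS](zc (enum_val i)) cocycle_lhs_coef.
  rewrite (sum_target_max pq_new) z0 mul0r add0r; apply: eq_bigr => l _.
  by rewrite !mxE mulrC.
have fA := free_matrix_free pq_new x0_pq x0_cocycle L1_min.
have ffA : row_full A.
  by rewrite /row_full -/A (eqP fA) sq.
have [W WA] := row_fullP ffA.
have /(congr1 (fun x : 'cV_#|M| => x j 0)) : w = 0.
  by rewrite -[w]mul1mx -WA -mulmxA Aw mulmx0.
by rewrite !mxE.
Qed.

End FiberDirections.

Section KrullDimension.
Variables (K : closedFieldType) (T : vectType K) (alpha : nat -> 'Hom(T, K^o)).
Variables (n : nat).
Hypothesis alpha_neq0 : forall i, (i <= n)%N -> alpha i != 0.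
Hypothesis alpha_new : forall i j, (i < n)%N -> (j < n)%N ->
  alpha n <> alpha i - alpha j.
Variables (pq : mindex alpha n.+1) (pq_new : target pq = ord_max).
Variables (A : {set mindex alpha n}) (phi : {ffun mindex alpha n -> K}).
Hypothesis phi_law : is_law_on A phi.
Let A1 : {set mindex alpha n.+1} := pq |: [set mindex_widen b | b in A].
Variable phi1 : {ffun mindex alpha n.+1 -> K}.
Hypothesis phi1_law : is_law_on A1 phi1.
Hypothesis phi1_proj : law_proj phi1 = phi.
Local Notation coord_ring n := {mpoly K[#|{: mindex alpha n}|]}.
Local Notation M := (free_coords pq).
Variables (d : nat) (N : 'M[K]_(d, #|M|)) (v : 'M[K]_(#|M|, d)).
Hypothesis Nv : N *m v = 1%:M.
Hypothesis v_cocycle :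
  forall t k, \sum_j v j k * cocycle_coef (sc phi) (enum_val j) t = 0.
Variables (O1 : comUnitRingType) (f1 : {rmorphism coord_ring n.+1 -> O1}).
Hypothesis f1P : is_local_ring A1 phi1 f1.

Local Notation S := {mpoly K[d]}.

(* The fiber contains the affine space through phi1 directed by the columns of
   v; the m-th point of the chain lives on its subspace T_1 = .. = T_m = 0. *)
Definition flag_var (m : nat) (k : 'I_d) : S := if (k < m)%N then 0 else 'X_k.
Definition flag_coord m (j : 'I_#|M|) : S :=
  (phi1 (enum_val j))%:MP + \sum_k (v j k)%:MP * flag_var m k.
Definition flag_point m : mindex alpha n.+1 -> S :=
  assemble (pq := pq) (fun a => (phi a)%:MP) (flag_coord m).

Lemma flag_point_cocycle m t :
  cocycle_lhs (sc (old_part (flag_point m))) (new_part (flag_point m)) t = 0.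
Proof.
pose cst : {rmorphism K -> S} := @mpolyC d K.
have e i j k : sc (old_part (flag_point m)) i j k = cst (sc phi i j k).
  by rewrite sc_rmorph; apply: eq_sc => a; rewrite [LHS]assemble_old.
rewrite (eq_cocycle_lhs _ e (fun _ _ => erefl)) (cocycle_assemble pq_new).
rewrite -(cocycle_coef_rmorph cst).
under eq_bigr => j _ do rewrite -(cocycle_coef_rmorph cst) mulrDl.
rewrite big_split addrA /= -[RHS](addr0 0); congr (_ + _).
  have := phi1_cocycle alpha_neq0 alpha_new phi1_law phi1_proj t.
  rewrite cocycle_lhs_coef (sum_target_max pq_new) (phi1_pq phi1_law) mul1r.
  move=> /(congr1 cst); rewrite rmorph0 rmorphD => h; rewrite -[RHS]h.
  by congr (_ + _); rewrite rmorph_sum; apply: eq_bigr => j _; rewrite rmorphM.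
under eq_bigr => j _ do rewrite mulr_suml.
rewrite exchange_big big1 // => k _ /=.
have := congr1 (fun x => cst x * flag_var m k) (v_cocycle t k).
rewrite rmorph0 mul0r rmorph_sum mulr_suml => h; rewrite -[RHS]h.
by apply: eq_bigr => j _; rewrite rmorphM mulrAC.
Qed.

Lemma flag_map_exists m : exists theta : {rmorphism coord_ring n.+1 -> S},
  (forall a, theta a%:MP = a%:MP) /\ (forall b, theta (coordX b) = flag_point m b).
Proof. exact: (coord_ring_eval (@mpolyC d K)). Qed.

(** The m-th ideal is the kernel of evaluation at the m-th flag point, with values in a fraction
    field: primality is automatic, and denominators, being nonzero at the origin, become
    invertible. *)
Lemma krull_dim_local_ring : krull_dim_ge O1 d.
Proof.
have [theta hth] := choice flag_map_exists.
have thC m a := (hth m).1 a; have thX m b := (hth m).2 b.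
have [f1U f1_frac _] := f1P.
have th0 m s : (theta m s).@[fun _ => 0] = s.@[fun i => phi1 (enum_val i)].
  pose e0 : {rmorphism S -> K} := meval (fun _ => 0).
  pose r1 : {rmorphism coord_ring n.+1 -> K} := e0 \o theta m.
  pose r2 : {rmorphism coord_ring n.+1 -> K} := meval (fun i => phi1 (enum_val i)).
  apply: (coord_ring_ext (f := r1) (g := r2)) => [a|b]; rewrite /r1 /r2 [LHS]/= [RHS]/=.
    by rewrite thC /e0 /= !mevalC.
  rewrite thX [RHS]mevalXU enum_rankK /flag_point assemble_rmorph.
  rewrite -[RHS](assembleK pq_new alpha_neq0 alpha_new (phi1_pq phi1_law)).
  apply: eq_assemble => [a|j]; first by rewrite /e0 /= mevalC /old_part (phi1_widen phi1_proj).
  rewrite /flag_coord rmorphD rmorph_sum /e0 /= mevalC big1 ?addr0 // => k _.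
  by rewrite mevalM /flag_var; case: ifP => _; rewrite ?meval0 ?mevalXU mulr0.
pose tf : {rmorphism S -> {fraction S}} := @tofrac S.
have tau_ex m : exists tau : {rmorphism O1 -> {fraction S}},
    forall p, tau (f1 p) = tf (theta m p).
  pose g : {rmorphism coord_ring n.+1 -> {fraction S}} := tf \o theta m.
  have gE p : g p = tf (theta m p) by [].
  have [|s Ms|tau htau] := quotient_localization_lift (g := g) f1P; last by exists tau.
    move=> p hp; rewrite gE (_ : theta m p = 0) ?rmorph0 //; move: p hp.
    apply: scheme_eq_vanish => [i j k l|b].
      rewrite (eq_jacobi (d := sc (flag_point m))) => [|i' j' k']; last first.
        by apply: eq_sc => b; rewrite thX.
      apply: (jacobi_extension alpha_neq0 alpha_new) => [i' j' k' l'|t _]; last first.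
        exact: flag_point_cocycle.
      rewrite -(rmorph0 (@mpolyC d K)) -(phi_law.1 i' j' k' l') jacobi_rmorph.
      apply: eq_jacobi => a b c; rewrite sc_rmorph; apply: eq_sc => e.
      by rewrite [LHS]assemble_old.
    rewrite !inE thX => /orP[/eqP ->|/imsetP[a aA ->]].
      exact: assemble_pq.
    rewrite -[flag_point m _]/(old_part (flag_point m) a) [LHS]assemble_old //.
    by rewrite phi_law.2 // mpolyC1.
  rewrite unitfE gE tofrac_eq0; apply/eqP => e; apply: Ms.
  by rewrite /point_ideal -(th0 m) e meval0.
have [tau htau] := choice tau_ex.
pose P m : {pred O1} := [pred z | tau m z == 0].
have PE m z : (z \in P m) = (tau m z == 0) by [].
have tau_frac m z : exists a s, [/\ z = f1 a / f1 s, ~ point_ideal phi1 s &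
    (tau m z == 0) = (theta m a == 0)].
  have [a [s [Ms ->]]] := f1_frac z; exists a, s; split=> //.
  rewrite rmorphM mulf_eq0 rmorphV ?f1U // invr_eq0 !htau !tofrac_eq0.
  rewrite [theta m s == 0](_ : _ = false) ?orbF //.
  by apply/eqP => e; apply: Ms; rewrite /point_ideal -(th0 m) e meval0.
exists P; split=> [m _|m md].
  split; first split.
  - by rewrite PE rmorph0.
  - by rewrite PE rmorph1 oner_eq0.
  - by move=> a x y /=; rewrite !PE rmorphD rmorphM => /eqP -> /eqP ->; rewrite mulr0 addr0.
  - by move=> x y; rewrite !PE rmorphM mulf_eq0.
split=> [z|].
  have [a [s [zE Ms zP]]] := tau_frac m z.
  change (tau m z == 0 -> tau m.+1 z == 0).
  rewrite zP => /eqP a0; rewrite zE rmorphM (htau m.+1 a).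
  suff -> : theta m.+1 a = 0 by rewrite rmorph0 mul0r.
  (* Passing from stage m to stage m + 1 of the flag kills the variable of index m, indices starting
     at 0. *)
  pose e : {rmorphism S -> S} :=
    mmap (@mpolyC d K) (fun k : 'I_d => if k == m :> nat then 0 else 'X_k).
  suff -> : theta m.+1 a = e (theta m a) by rewrite a0 rmorph0.
  pose r2 : {rmorphism coord_ring n.+1 -> S} := e \o theta m.
  apply: (coord_ring_ext (g := r2)) => [c|b]; rewrite /r2 [RHS]/=.
    by rewrite !thC /e /= mmapC.
  rewrite !thX /flag_point assemble_rmorph; apply: eq_assemble => [c|j].
    by rewrite /e /= mmapC.
  rewrite /flag_coord rmorphD rmorph_sum /e /= mmapC; congr (_ + _).
  apply: eq_bigr => k _; rewrite -[mmap _ _ _]/(e _) rmorphM /e /= mmapC; congr (_ * _).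
  rewrite /flag_var ltnS leq_eqVlt; case: (ltnP k m) => km.
    by rewrite orbT mmap0.
  by rewrite orbF mmapX mmap1U.
pose i := Ordinal md.
(* Row i of N applied to X - phi1. As N v = 1, it restricts to the variable of index i = m, which
   survives at stage m and vanishes at stage m + 1. *)
pose p : coord_ring n.+1 :=
  \sum_j (N i j)%:MP * (coordX (enum_val j) - (phi1 (enum_val j))%:MP).
have thp m' : theta m' p = flag_var m' i.
  rewrite /p rmorph_sum.
  transitivity (\sum_k (\sum_j N i j * v j k)%:MP * flag_var m' k).
    under [RHS]eq_bigr => k _ do rewrite (rmorph_sum (@mpolyC d K)) mulr_suml.
    rewrite exchange_big; apply: eq_bigr => j _ /=.
    rewrite rmorphM rmorphB !thC thX /flag_point (assemble_free) /flag_coord.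
    rewrite addrAC subrr add0r mulr_sumr; apply: eq_bigr => k _.
    by rewrite mpolyCM mulrA.
  have NvE k : \sum_j N i j * v j k = (i == k)%:R.
    by have := congr1 (fun W : 'M_d => W i k) Nv; rewrite !mxE.
  rewrite (bigD1 i) //= NvE eqxx mpolyC1 mul1r big1 ?addr0 // => k ki.
  by rewrite NvE eq_sym (negbTE ki) mpolyC0 mul0r.
exists (f1 p); rewrite PE htau tofrac_eq0 thp /flag_var /= ?ltnSn ?eqxx ?ltnn //.
apply/eqP => /(congr1 (meval (fun _ => 1))); rewrite mevalXU meval0.
by apply/eqP; rewrite oner_eq0.
Qed.

End KrullDimension.

(** * Rigidity *)

Section AdmissibleSets.
Variables (K : closedFieldType) (T : vectType K) (alpha : nat -> 'Hom(T, K^o)).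
Hypothesis alpha_inj : injective alpha.
Variables (n : nat) (psi : {ffun mindex alpha n -> K}).
Local Notation c := (sc psi).
Local Notation e i := (delta_mx 0 i : 'rV[K]_n).

Lemma bracketDl (R : comNzRingType) m (d : 'I_m -> 'I_m -> 'I_m -> R) a u v w :
  bracket d (a *: u + v) w = a *: bracket d u w + bracket d v w.
Proof.
apply/rowP => k; rewrite !mxE mulr_sumr -big_split; apply: eq_bigr => i _ /=.
rewrite mulr_sumr -big_split; apply: eq_bigr => j _ /=; rewrite !mxE; ring.
Qed.

Lemma bracketDr (R : comNzRingType) m (d : 'I_m -> 'I_m -> 'I_m -> R) a u v w :
  bracket d w (a *: u + v) = a *: bracket d w u + bracket d w v.
Proof.
apply/rowP => k; rewrite !mxE mulr_sumr -big_split; apply: eq_bigr => i _ /=.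
rewrite mulr_sumr -big_split; apply: eq_bigr => j _ /=; rewrite !mxE; ring.
Qed.

Lemma ce_diff_linear u v : linear (fun L : 'M[K]_n => ce_diff c L u v).
Proof.
move=> a L L'; rewrite /ce_diff !mulmxDr -!scalemxAr bracketDl bracketDr.
by rewrite opprD [X in X + _ = _]addrACA [LHS]addrACA -scalerDr -scalerBr.
Qed.

Lemma ce_coord_linear : linear (ce_coord psi).
Proof.
move=> a L L'; apply/ffunP => x.
rewrite [LHS]ffunE ce_diff_linear [LHS]mxE [X in X + _ = _]mxE.
by rewrite !ffunE.
Qed.

Lemma inv_cochain1P (L : 'M[K]_n) : L \in inv_cochain1 alpha n <->
  forall t, t \in vbasis {:T} -> L *m weight_act alpha n t = weight_act alpha n t *m L.
Proof.
have lin (t : T) : linear (fun L : 'M[K]_n =>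
    L *m weight_act alpha n t - weight_act alpha n t *m L).
  move=> a M M'; rewrite mulmxDl mulmxDr -scalemxAl -scalemxAr opprD scalerBr.
  by rewrite addrACA.
split=> [/memv_bigcap_seq h t /h|h]; last apply/memv_bigcap_seq => t tb.
  by rewrite memv_ker linfunE // subr_eq0 => /eqP.
by rewrite memv_ker linfunE // h // subrr.
Qed.

(** Commutation gives L i j * (alpha i - alpha j) = 0 on T, and the weights are distinct. *)
Lemma inv_cochain1_diag (L : 'M[K]_n) i j :
  L \in inv_cochain1 alpha n -> i != j -> L i j = 0.
Proof.
move=> /inv_cochain1P h ij; apply/eqP/negPn/negP => Lij; case/eqP: ij.
apply/val_inj/alpha_inj/eq_lfun_vbasis => t tb.
have := congr1 (fun M : 'M_n => M i j) (h t tb).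
rewrite /weight_act mul_mx_diag mul_diag_mx !mxE mulrC => /(mulIf Lij) /esym.
by [].
Qed.

Lemma ce_coord_diag (L : 'M[K]_n) i j k : (forall i j, i != j -> L i j = 0) ->
  ce_coord psi L (i, j, k) = c i j k * (L i i + L j j - L k k).
Proof.
move=> hL.
have eL i' : e i' *m L = L i' i' *: e i'.
  apply/rowP => l; rewrite -rowE !mxE eqxx /=.
  by have [->|li] := eqVneq l i'; rewrite ?mulr1 // mulr0 hL // eq_sym.
rewrite ffunE /ce_diff /= !eL.
rewrite -[_ *: e j]addr0 -[_ *: e i]addr0 bracketDl bracketDr.
have b0l u : bracket c 0 u = 0 by have := bracketDl c (-1) 0 0 u; rewrite scaler0 addr0 scaleN1r addNr.
have b0r u : bracket c u 0 = 0 by have := bracketDr c (-1) 0 0 u; rewrite scaler0 addr0 scaleN1r addNr.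
rewrite b0l b0r !addr0 mxE [X in X + _]mxE [X in X + _ + _]mxE [X in _ + X + _]mxE.
rewrite !bracket_delta2 [X in _ + X]mxE [X in _ - X]mxE (bigD1 k) //= big1 => [|l lk].
  by rewrite bracket_delta2; ring.
by rewrite hL ?mulr0.
Qed.

Lemma diag_derivation (x : 'rV[K]_n) :
  (forall i j k, c i j k * (x 0 i + x 0 j - x 0 k) = 0) -> is_derivation c (diag_mx x).
Proof.
move=> hx u v; apply/rowP => k; rewrite mul_mx_diag !mxE -big_split mulr_suml.
apply: eq_bigr => i _ /=; rewrite mulr_suml -big_split; apply: eq_bigr => j _ /=.
rewrite !mul_mx_diag !mxE; apply/eqP; rewrite -subr_eq0; apply/eqP.
rewrite -[RHS](mulr0 (- (u 0 i * v 0 j))) -(hx i j k); ring.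
Qed.

Lemma weight_act_linear : linear (weight_act alpha n).
Proof.
move=> a t t'; apply/matrixP => i j; rewrite !mxE linearP.
by case: eqP; rewrite ?mulr0n ?mulr1n ?mulr0 ?addr0.
Qed.

Lemma weight_act_scale (t : T) (i j k : 'I_n) :
  c i j k * ((alpha i t : K) + alpha j t - alpha k t) = 0.
Proof.
have [s|s] := eqVneq (alpha i + alpha j) (alpha k); last by rewrite sc_eq0 ?mul0r.
by rewrite -s lfunE /=; ring.
Qed.

Lemma diag_diagonalizable (x : 'rV[K]_n) : diagonalizable (diag_mx x).
Proof.
exists 1%:M; first exact: unitmx1.
change (is_diag_mx (conjmx 1%:M (diag_mx x))); rewrite conjumx ?unitmx1 // invmx1.
by rewrite mul1mx mulmx1; apply/is_diag_mxP => i j ij; rewrite mxE -val_eqE (negbTE ij).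
Qed.

(* As L |-> d_psi L restricted to A has the rank of the whole differential on
   invariant cochains, a diagonal L killed on A is a derivation. *)
Lemma admissible_weights (A : {set mindex alpha n}) (x : 'rV[K]_n) :
  Sigma psi -> admissible psi A ->
  (forall a, a \in A -> x 0 (val a).1.1 + x 0 (val a).1.2 = x 0 (val a).2) ->
  exists t : T, forall i : 'I_n, x 0 i = alpha i t.
Proof.
move=> [_ [_ maxT]] /minsetP[/eqP rankA _] hx.
pose L := diag_mx x; pose U := inv_cochain1 alpha n.
have LU : L \in U.
  by apply/inv_cochain1P => t _; rewrite /L /weight_act; apply: diag_mxC.
have Ldiag i j : i != j -> L i j = 0 by move=> ij; rewrite mxE (negbTE ij).
pose FA := fun L : 'M[K]_n =>
  [ffun a : mindex alpha n => if a \in A then ce_coord psi L (val a) else 0]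
    : {ffun mindex alpha n -> K^o}.
have FAlin : linear FA.
  move=> a M M'; apply/ffunP => b; rewrite [LHS]ffunE ce_coord_linear !ffunE.
  by case: ifP => _; rewrite ?scaler0 ?addr0.
have FAE := linfunE FAlin; have CE := linfunE ce_coord_linear.
pose F := linfun FA; pose C := linfun (ce_coord psi).
have sub : (C @: U <= B2 psi :&: inv_cochain2 alpha n)%VS.
  apply/subvP => _ /memv_imgP[M MU ->]; rewrite memv_cap memv_img ?memvf //=.
  have lin : linear (fun f : {ffun 'I_n * 'I_n * 'I_n -> K^o} =>
    [ffun x : 'I_n * 'I_n * 'I_n =>
      if alpha x.1.1 + alpha x.1.2 == alpha x.2 then 0 else f x]
      : {ffun 'I_n * 'I_n * 'I_n -> K^o}).
    move=> a g g'; apply/ffunP => y; rewrite !ffunE.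
    by case: ifP => _; rewrite ?scaler0 ?addr0.
  rewrite memv_ker linfunE // CE; apply/eqP/ffunP => [[[i j] k]].
  rewrite [LHS]ffunE [RHS]ffunE /=; case: eqP => // /eqP s.
  rewrite ce_coord_diag ?sc_eq0 ?mul0r // => i' j' ij'.
  exact: inv_cochain1_diag.
have kerCF : (U :&: lker C <= U :&: lker F)%VS.
  apply: capvS; first exact: subvv.
  apply/subvP => M; rewrite !memv_ker CE FAE => /eqP h; apply/eqP/ffunP => a.
  by rewrite ffunE h !ffunE if_same.
(* Rank-nullity on U: the rank of F is the dimension of the invariant coboundaries, which bounds the
   rank of C, so the kernel of F is no larger than that of C. *)
have : (U :&: lker C == U :&: lker F)%VS.
  rewrite eqEdim kerCF -(leq_add2r (\dim (F @: U))) limg_ker_dim -(limg_ker_dim C U).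
  by rewrite leq_add2l -/(forms_rank psi A) rankA dimvS.
move=> /eqP kerE.
have : L \in (U :&: lker F)%VS.
  rewrite memv_cap LU memv_ker FAE; apply/eqP/ffunP => a; rewrite [LHS]ffunE [RHS]ffunE.
  case: ifP => // aA; case E : (val a) => [[i j] k].
  rewrite ce_coord_diag // !mxE !eqxx !mulr1n.
  by have := hx a aA; rewrite E /= => ->; rewrite subrr mulr0.
rewrite -kerE memv_cap memv_ker CE => /andP[_ /eqP CL0].
have hL i j k : c i j k * (x 0 i + x 0 j - x 0 k) = 0.
  have := ce_coord_diag i j k Ldiag; rewrite CL0 !mxE !eqxx !mulr1n => <-.
  by rewrite ffunE.
have WE := linfunE weight_act_linear.
(* Adjoining L to the torus gives commuting diagonal derivations, so maximality forces L into the
   torus. *)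
pose V := (weight_torus alpha n + <[L]>)%VS.
have VP D : D \in V -> exists t a, D = diag_mx (\row_i ((alpha i t : K) + a * x 0 i)).
  move=> /memv_addP[_ /memv_imgP[t _ ->]] [_ /vlineP[a ->] ->]; exists t, a.
  rewrite WE; apply/matrixP => i j; rewrite !mxE.
  by case: eqP; rewrite ?mulr0n ?mulr0 ?addr0 // !mulr1n.
have torV : is_torus_of_der c V.
  split=> [D /VP[t [a ->]]|D D' /VP[t [a ->]] /VP[t' [a' ->]]].
    split; last exact: diag_diagonalizable.
    apply: diag_derivation => i j k; rewrite !mxE.
    rewrite -[RHS]addr0 -[X in _ = X + _](weight_act_scale t i j k).
    rewrite -[X in _ = _ + X](mulr0 a) -(hL i j k); ring.
  exact: diag_mxC.
have VT := maxT V torV (addvSl _ _).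
have : L \in weight_torus alpha n by rewrite -VT; apply: (subvP (addvSr _ _)); apply: memv_line.
move=> /memv_imgP[t _]; rewrite WE => hLt; exists t => i.
have := congr1 (fun M : 'M_n => M i i) hLt.
by rewrite !mxE eqxx !mulr1n.
Qed.

End AdmissibleSets.

(** * Formal power series *)

Section PowerSeries.
Variable K : comNzRingType.
Implicit Types f g h : fps K.

Lemma fpsD f g m : fps_coef (f + g) m = fps_coef f m + fps_coef g m.
Proof. by []. Qed.

Lemma fpsN f m : fps_coef (- f) m = - fps_coef f m.
Proof. by []. Qed.

Lemma fpsM f g m :
  fps_coef (f * g) m = \sum_(i < m.+1) fps_coef f i * fps_coef g (m - i)%N.
Proof. by []. Qed.

Lemma fps0 m : fps_coef (0 : fps K) m = 0.
Proof. by rewrite /= if_same. Qed.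

Lemma fps1 m : fps_coef (1 : fps K) m = (m == 0)%:R.
Proof. by rewrite /=; case: eqP. Qed.

Lemma fps_sum (I : Type) (r : seq I) (P : pred I) (F : I -> fps K) m :
  fps_coef (\sum_(i <- r | P i) F i) m = \sum_(i <- r | P i) fps_coef (F i) m.
Proof. by apply: (big_morph (fun f => fps_coef f m)) => //; apply: fps0. Qed.

Lemma fpsM0 f g : fps_coef (f * g) 0 = fps_coef f 0 * fps_coef g 0.
Proof. by rewrite fpsM big_ord1. Qed.

Lemma fpsM1 f g :
  fps_coef (f * g) 1 = fps_coef f 0 * fps_coef g 1 + fps_coef f 1 * fps_coef g 0.
Proof. by rewrite fpsM !big_ord_recl big_ord0 addr0. Qed.

(** For inductions on the order in t: at the lowest order of g, only the constant term of f is
    seen. *)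
Lemma fpsM_lead f g m : (forall l, (l < m)%N -> fps_coef g l = 0) ->
  fps_coef (f * g) m = fps_coef f 0 * fps_coef g m.
Proof.
move=> g0; rewrite fpsM big_ord_recl subn0 big1 ?addr0 // => i _.
by rewrite g0 ?mulr0 // ltn_subrL /= (leq_ltn_trans (leq0n i)) ?ltn_ord.
Qed.

Lemma fpsC_zmod : zmod_morphism (@fpsC K).
Proof.
move=> a b; apply/fpsP => m; rewrite fpsD fpsN /=.
by case: eqP; rewrite ?subrr.
Qed.

Lemma fpsC_monoid : monoid_morphism (@fpsC K).
Proof.
split=> // a b; apply/fpsP => m; rewrite fpsM big_ord_recl big1 ?addr0 => [|i _].
  by rewrite /= subn0; case: eqP; rewrite ?mulr0.
by rewrite /= mul0r.
Qed.

HB.instance Definition _ := GRing.isZmodMorphism.Build K (fps K) (@fpsC K) fpsC_zmod.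
HB.instance Definition _ :=
  GRing.isMonoidMorphism.Build K (fps K) (@fpsC K) fpsC_monoid.

Lemma fpsC0 (a : K) : fps_coef (fpsC a) 0 = a.
Proof. by []. Qed.

Lemma fpsCM a f m : fps_coef (fpsC a * f) m = a * fps_coef f m.
Proof.
rewrite fpsM big_ord_recl subn0 big1 ?addr0 // => i _.
by rewrite /= mul0r.
Qed.

Lemma fps_exp_small f k j : fps_coef f 0 = 0 -> (j < k)%N -> fps_coef (f ^+ k) j = 0.
Proof.
move=> f0; elim: k j => // k IH j jk; rewrite exprS fpsM big_ord_recl f0 mul0r add0r.
apply: big1 => i _; rewrite IH ?mulr0 //= /bump /= add1n.
rewrite (leq_trans _ (_ : j <= k)%N) // ltn_subrL /=.
by rewrite (leq_ltn_trans (leq0n i)) ?ltn_ord.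
Qed.

(* The inverse of 1 - e is the geometric series, of which only finitely many
   terms contribute to each coefficient. *)
Lemma fps_inv f : fps_coef f 0 = 1 -> exists g, f * g = 1.
Proof.
move=> f0; pose e := 1 - f.
have e0 : fps_coef e 0 = 0 by rewrite /e fpsD fpsN fps1 f0 subrr.
pose G m := \sum_(k < m.+1) e ^+ k.
pose g := Fps (fun m => fps_coef (G m) m); exists g.
have gG j m : (j <= m)%N -> fps_coef g j = fps_coef (G m) j.
  move=> jm; rewrite /= /G !fps_sum (big_ord_widen m.+1 (fun k => fps_coef (e ^+ k) j)) //.
  rewrite big_mkcond; apply: eq_bigr => k _; rewrite ltnS.
  by case: (leqP k j) => // jk; rewrite fps_exp_small.
apply/fpsP => m; transitivity (fps_coef (f * G m) m).
  by rewrite !fpsM; apply: eq_bigr => i _; rewrite (gG _ m) ?leq_subr.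
have -> : f * G m = 1 - e ^+ m.+1.
  by rewrite (_ : f = - (e - 1)) ?mulNr -?subrX1 ?opprB // /e; ring.
by rewrite fpsD fpsN fps_exp_small ?subr0.
Qed.

End PowerSeries.

(** * Conjugations commuting with the torus *)

Section DiagonalConjugation.
Variables (K : closedFieldType) (T : vectType K) (alpha : nat -> 'Hom(T, K^o)).
Variable n : nat.

Lemma sc_scale (R : comNzRingType) (D D' : 'I_n -> R) (x : mindex alpha n -> R) i j k :
  sc (fun b => D' (val b).1.1 * D' (val b).1.2 * x b * D (val b).2) i j k
  = D' i * D' j * sc x i j k * D k.
Proof.
rewrite /sc; case: insubP => [a _ ->|_] //.
case: insubP => [a _ ->|_] /=; last by rewrite mulr0 mul0r.
by rewrite mulrN mulNr [D' j * _]mulrC.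
Qed.

Lemma conj_law_diag (R : comNzRingType) (s s' : 'M[R]_n) (c : 'I_n -> 'I_n -> 'I_n -> R) i j k :
  (forall i j, i != j -> s i j = 0) -> (forall i j, i != j -> s' i j = 0) ->
  conj_law s s' c i j k = s' i i * s' j j * c i j k * s k k.
Proof.
move=> hs hs'; rewrite /conj_law mxE (bigD1 k) //= big1 ?addr0 => [|l lk]; last first.
  by rewrite hs ?mulr0.
congr (_ * _); rewrite mxE (bigD1 i) //= (bigD1 j) //= !mxE.
rewrite big1 ?addr0 => [|l lj]; last by rewrite !mxE (hs' j l) ?mulr0 ?mul0r // eq_sym.
rewrite big1 ?addr0 // => l li; rewrite big1 // => m _.
by rewrite !mxE (hs' i l) ?mul0r // eq_sym.
Qed.

Hypothesis alpha_inj : injective alpha.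

Lemma commuting_diag (s : 'M[fps K]_n) :
  (forall t, s *m map_mx (@fpsC K) (weight_act alpha n t)
             = map_mx (@fpsC K) (weight_act alpha n t) *m s) ->
  forall i j, i != j -> s i j = 0.
Proof.
move=> hs i j ij; apply/fpsP => m; rewrite fps0; apply/eqP/negPn/negP => sm.
case/eqP: ij; apply/val_inj/alpha_inj/lfunP => t.
have := congr1 (fun M : 'M_n => fps_coef (M i j) m) (hs t).
rewrite /weight_act map_diag_mx mul_mx_diag mul_diag_mx !mxE [s i j * _]mulrC !fpsCM.
by move=> /(mulIf sm) /esym.
Qed.

(* The weights being distinct, a matrix commuting with the torus is diagonal;
   here psi is the conjugate of phi by diag(D), with inverse diag(D'). *)
Definition diag_conjugate (phi : mindex alpha n -> K) (psi : mindex alpha n -> fps K)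
    (D D' : 'I_n -> fps K) : Prop :=
  [/\ forall i, D i * D' i = 1, forall i, fps_coef (D i) 0 = 1
    & forall b, psi b = D' (val b).1.1 * D' (val b).1.2 * fpsC (phi b) * D (val b).2].

Lemma diag_conjugateP (phi : {ffun mindex alpha n -> K}) (psi : {ffun mindex alpha n -> fps K}) :
  (exists s s' : 'M[fps K]_n,
      [/\ s *m s' = 1%:M /\ s' *m s = 1%:M,
          map_mx (fun f => fps_coef f 0) s = 1%:M,
          forall t, s *m map_mx (@fpsC K) (weight_act alpha n t)
                    = map_mx (@fpsC K) (weight_act alpha n t) *m s
        & forall i j k,
            conj_law s s' (sc (fun a => fpsC (phi a))) i j k = sc psi i j k]) <->
  exists D D', diag_conjugate phi psi D D'.
Proof.
split=> [[s [s' [[ss' s's] s0 sT sc_eq]]]|[D [D' [DD' D0 psiE]]]].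
  have sd := commuting_diag sT.
  (* The inverse commutes with the torus as well, so it is diagonal too. *)
  have s'T t : s' *m map_mx (@fpsC K) (weight_act alpha n t)
             = map_mx (@fpsC K) (weight_act alpha n t) *m s'.
    by rewrite -[LHS]mulmx1 -ss' !mulmxA -(mulmxA s') -sT mulmxA s's mul1mx.
  have s'd := commuting_diag s'T.
  exists (fun i => s i i), (fun i => s' i i); split=> [i|i|b].
  - have := congr1 (fun M : 'M_n => M i i) ss'; rewrite !mxE eqxx (bigD1 i) //=.
    by rewrite big1 ?addr0 // => j ji; rewrite sd ?mul0r // eq_sym.
  - by have := congr1 (fun M : 'M_n => M i i) s0; rewrite !mxE eqxx.
  - by rewrite -(sc_mindex psi) -sc_eq conj_law_diag // sc_mindex.
pose dm (E : 'I_n -> fps K) := diag_mx (\row_i E i).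
have dE E i j : i != j -> dm E i j = 0 by move=> ij; rewrite !mxE (negbTE ij).
have dd E i : dm E i i = E i by rewrite !mxE eqxx.
exists (dm D), (dm D'); split.
- have H E E' : (forall i, E i * E' i = 1) -> dm E *m dm E' = 1%:M.
    move=> EE; apply/matrixP => i j; rewrite mul_diag_mx !mxE.
    by case: eqP => _; rewrite ?mulr1n ?EE ?mulr0n ?mulr0.
  by split; apply: H => // i; rewrite mulrC.
- apply/matrixP => i j; rewrite !mxE; case: eqP => _; first by rewrite mulr1n D0.
  by rewrite mulr0n fps0.
- by move=> t; rewrite /weight_act map_diag_mx; apply: diag_mxC.
- move=> i j k; rewrite conj_law_diag //; try exact: dE.
  by rewrite !dd -(sc_scale D D'); apply: eq_sc => b; rewrite psiE.
Qed.

End DiagonalConjugation.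

(** * Rigidity of a unique extension *)

Section Rigidity.
Variables (K : closedFieldType) (T : vectType K) (alpha : nat -> 'Hom(T, K^o)).
Hypothesis alpha_inj : injective alpha.
Variables (n : nat).
Hypothesis alpha_neq0 : forall i, (i <= n)%N -> alpha i != 0.
Hypothesis alpha_new : forall i j, (i < n)%N -> (j < n)%N ->
  alpha n <> alpha i - alpha j.
Variables (pq : mindex alpha n.+1) (pq_new : target pq = ord_max).
Variables (A : {set mindex alpha n}) (phi : {ffun mindex alpha n -> K}).
Let A1 : {set mindex alpha n.+1} := pq |: [set mindex_widen b | b in A].
Variable phi1 : {ffun mindex alpha n.+1 -> K}.
Hypothesis phi1_law : is_law_on A1 phi1.
Hypothesis phi1_proj : law_proj phi1 = phi.

(** A deformation of phi1 projects to a deformation of phi, hence to a diagonal conjugate of phi. It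
    remains to choose the entry at e_(n+1) and to compare two cocycles of one law that agree at
    pq. *)
Lemma rigid_extension :
  (forall z : mindex alpha n.+1 -> K, z pq = 0 ->
     (forall t, cocycle_lhs (sc phi) (new_part z) t = 0) ->
     forall b, target b = ord_max -> z b = 0) ->
  rigid phi -> rigid phi1.
Proof.
move=> uniq rphi Psi PsiJ Psi0; apply/(diag_conjugateP alpha_inj).
pose psi := [ffun a => Psi (mindex_widen a)].
have psiE : psi =1 old_part Psi by move=> a; rewrite ffunE.
have [|a|s [s' hs]] := rphi psi.
- move=> i j k l; rewrite -[RHS](jacobi_old alpha_neq0 alpha_new PsiJ i j k l).
  by apply: eq_jacobi => *; apply: eq_sc.
- by rewrite ffunE Psi0 (phi1_widen phi1_proj).
have [D [D' [DD' D0 psiD]]] : exists D D', diag_conjugate phi psi D D'.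
  by apply/(diag_conjugateP alpha_inj); exists s, s'.
have [p [q [vpq _ _]]] := new_coords_source alpha_neq0 alpha_new pq_new.
have phi1pq := phi1_pq phi1_law.
(* The entry at e_(n+1), forced at pq: there phi1 is 1, so the conjugate has coordinate D'_p D'_q
   sg, to be equal to Psi_pq. *)
pose sg := Psi pq * D p * D q.
have sg0 : fps_coef sg 0 = 1 by rewrite /sg !fpsM0 Psi0 phi1pq !D0 !mulr1.
have [sg' sgV] := fps_inv sg0.
pose ext (E : 'I_n -> fps K) (e : fps K) (i : 'I_n.+1) :=
  if insub (i : nat) is Some i' then E i' else e.
have extw E e i : ext E e (widen i) = E i by rewrite /ext /= valK.
have extm E e : ext E e ord_max = e by rewrite /ext insubN //= ltnn.
exists (ext D sg), (ext D' sg').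
pose y b := ext D' sg' (val b).1.1 * ext D' sg' (val b).1.2 * fpsC (phi1 b)
  * ext D sg (val b).2.
have y_old a : Psi (mindex_widen a) = y (mindex_widen a).
  by have := psiD a; rewrite ffunE /y !extw (phi1_widen phi1_proj).
have y_pq : y pq = Psi pq.
  rewrite /y vpq !extw extm phi1pq rmorph1 mulr1 /sg.
  rewrite (_ : _ * _ = Psi pq * (D p * D' p) * (D q * D' q)); last by ring.
  by rewrite !DD' !mulr1.
have y_new i j : new_part y i j = D' i * D' j * new_part (fun b => fpsC (phi1 b)) i j * sg.
  by rewrite /new_part sc_scale !extw extm.
have scpsi i j k : sc psi i j k = D' i * D' j * fpsC (sc phi i j k) * D k.
  by rewrite sc_rmorph -sc_scale; apply: eq_sc => b; rewrite psiD.
(* Conjugation rescales the equation: D_l cancels D'_l in each term, leaving the common factor D'_i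
   D'_j D'_k sg. *)
have y_cocycle t : cocycle_lhs (sc psi) (new_part y) t = 0.
  have := congr1 (@fpsC K) (phi1_cocycle alpha_neq0 alpha_new phi1_law phi1_proj t).
  rewrite cocycle_lhs_rmorph rmorph0.
  move=> /(congr1 (fun f => D' t.1.1 * D' t.1.2 * D' t.2 * sg * f)); rewrite mulr0 => h.
  rewrite -[RHS]h mulr_sumr; apply: eq_bigr => l _.
  have E a b d e g : a * b * d * D l * (D' l * e * g * sg) = a * b * e * sg * (d * g).
    rewrite (_ : _ * _ = D l * D' l * (a * b * e * sg * (d * g))); last by ring.
    by rewrite DD' mul1r.
  rewrite !scpsi !y_new !E -!(new_part_rmorph (@fpsC K)); ring.
pose w b := 1 * Psi b + (-1) * y b.
have w_cocycle t : cocycle_lhs (sc psi) (new_part w) t = 0.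
  rewrite cocycle_lhs_combine y_cocycle mulr0 addr0 mul1r.
  rewrite -[RHS](cocycle_new alpha_neq0 alpha_new PsiJ t).
  by apply: eq_cocycle_lhs => // i j k; apply: eq_sc.
(* If w vanishes below order m, the coefficient of t^m in its cocycle equation involves psi only
   through the constant term phi, so uniqueness over K applies. *)
have w0 m b : target b = ord_max -> fps_coef (w b) m = 0.
  elim/ltn_ind: m b => m IH; apply: uniq; first by rewrite /w y_pq mul1r mulN1r subrr fps0.
  have wl l i j : fps_coef (new_part w i j) l = new_part (fun b => fps_coef (w b) l) i j.
    rewrite /new_part /sc; case: insub => [//|]; case: insub => [//|]; exact: fps0.
  have small l i j : (l < m)%N -> fps_coef (new_part w i j) l = 0.
    move=> lm; rewrite wl /new_part /sc; case: insubP => [a _ va|_].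
      by rewrite (IH l) // /target va.
    by case: insubP => [a _ va|//]; rewrite (IH l) ?oppr0 // /target va.
  move=> t; have := congr1 (fun f => fps_coef f m) (w_cocycle t).
  rewrite fps0 fps_sum => h; rewrite -[RHS]h; apply: eq_bigr => l _.
  have psi0 i j k : fps_coef (sc psi i j k) 0 = sc phi i j k.
    by rewrite scpsi !fpsM0 fpsC0 !D0 mulr1 -[RHS]mul1r -(mulr1 1); do 2![congr (_ * _)];
      have := congr1 (fun f => fps_coef f 0) (DD' i); have := congr1 (fun f => fps_coef f 0) (DD' j);
      rewrite !fpsM0 !D0 !mul1r fps1.
  rewrite !fpsD !fpsM_lead; try by move=> *; apply: small.
  by rewrite !psi0 !wl.
split=> [i|i|b].
- have [->|[i' ->]] := ord_max_or_widen i; last by rewrite !extw.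
  by rewrite !extm.
- have [->|[i' ->]] := ord_max_or_widen i; last by rewrite !extw.
  by rewrite !extm.
have [tb|tb] := eqVneq (target b) ord_max; last first.
  by have [a ->] := mindex_cases alpha_neq0 alpha_new tb; apply: y_old.
apply/eqP; rewrite -subr_eq0; apply/eqP/fpsP => m; rewrite fps0.
by have := w0 m b tb; rewrite /w mul1r mulN1r.
Qed.

End Rigidity.

(** * Non-rigidity along a line of the fiber *)

Section NonRigidity.
Variables (K : closedFieldType) (T : vectType K) (alpha : nat -> 'Hom(T, K^o)).
Hypothesis alpha_inj : injective alpha.
Variables (n : nat).
Hypothesis alpha_neq0 : forall i, (i <= n)%N -> alpha i != 0.
Hypothesis alpha_new : forall i j, (i < n)%N -> (j < n)%N ->
  alpha n <> alpha i - alpha j.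
Variable pq : mindex alpha n.+1.
Variables (A : {set mindex alpha n}) (phi : {ffun mindex alpha n -> K}).
Hypothesis phi_law : is_law_on A phi.
Let A1 : {set mindex alpha n.+1} := pq |: [set mindex_widen b | b in A].
Variable phi1 : {ffun mindex alpha n.+1 -> K}.
Hypothesis phi1_law : is_law_on A1 phi1.
Hypothesis phi1_proj : law_proj phi1 = phi.
Variable psi : {ffun mindex alpha n.+1 -> K}.
Hypothesis psi_Sigma : Sigma psi.
Hypothesis psi_admissible : admissible psi A1.

(* Were the line phi1 + t z of laws trivial to first order, the coboundary of a
   diagonal matrix vanishing on A1 would give z; by admissibility such a matrix
   lies in the torus, whose coboundary is zero. *)
Lemma not_rigid_direction (z : mindex alpha n.+1 -> K) b0 :
  z pq = 0 -> (forall a, z (mindex_widen a) = 0) ->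
  (forall t, cocycle_lhs (sc phi) (new_part z) t = 0) -> z b0 != 0 ->
  ~ rigid phi1.
Proof.
move=> zpq zold zc zb0 rphi1.
pose tt : fps K := Fps (fun m => (m == 1%N)%:R).
pose Psi := [ffun b => 1 * fpsC (phi1 b) + tt * fpsC (z b)] : {ffun mindex alpha n.+1 -> fps K}.
have tt0 f : fps_coef (tt * f) 0 = 0 by rewrite fpsM0 /= mul0r.
have tt1 a : fps_coef (tt * fpsC a) 1 = a by rewrite fpsM1 /= mul0r add0r mul1r.
have PsiE b : Psi b = 1 * fpsC (phi1 b) + tt * fpsC (z b) by rewrite ffunE.
have scC t : cocycle_lhs (fun i j k => fpsC (sc phi i j k)) (new_part Psi) t = 0.
  have -> : cocycle_lhs (fun i j k => fpsC (sc phi i j k)) (new_part Psi) t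
    = cocycle_lhs (fun i j k => fpsC (sc phi i j k))
       (new_part (fun b => 1 * fpsC (phi1 b) + tt * fpsC (z b))) t.
    by apply: eq_cocycle_lhs => // i j; apply: eq_sc.
  rewrite cocycle_lhs_combine.
  have lift (x : mindex alpha n.+1 -> K) : (forall t, cocycle_lhs (sc phi) (new_part x) t = 0) ->
      cocycle_lhs (fun i j k => fpsC (sc phi i j k)) (new_part (fun b => fpsC (x b))) t = 0.
    move=> /(_ t)/(congr1 (@fpsC K)); rewrite cocycle_lhs_rmorph rmorph0 => h.
    rewrite -[RHS]h; apply: eq_cocycle_lhs => // i j.
    by rewrite (new_part_rmorph (@fpsC K)).
  rewrite !lift ?mulr0 ?addr0 //.
  exact: (phi1_cocycle alpha_neq0 alpha_new phi1_law phi1_proj).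
have oldE a : old_part Psi a = fpsC (phi a).
  by rewrite /old_part PsiE zold mul1r (rmorph0 (@fpsC K)) mulr0 addr0 (phi1_widen phi1_proj).
have sc_old i j k : sc (old_part Psi) i j k = fpsC (sc phi i j k).
  by rewrite sc_rmorph; apply: eq_sc => a; apply: oldE.
have PsiJ : is_law Psi.
  apply: (jacobi_extension alpha_neq0 alpha_new) => [i j k l|t _].
    rewrite (eq_jacobi (d := fun i j k => fpsC (sc phi i j k))) //.
    by rewrite -(jacobi_rmorph (@fpsC K)) phi_law.1 rmorph0.
  by rewrite (eq_cocycle_lhs (d := fun i j k => fpsC (sc phi i j k)) (Y := new_part Psi)).
have [|D [D' [DD' D0 PsiD]]] := (diag_conjugateP alpha_inj phi1 Psi).1 (rphi1 Psi PsiJ _).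
  by move=> a; rewrite PsiE fpsD tt0 addr0 mul1r.
pose x i := fps_coef (D i) 1.
(* The coefficient of t in Psi_b D_i D_j = phi1_b D_k, where b = (i, j, k). *)
have zE b : z b = phi1 b * (x (val b).2 - x (val b).1.1 - x (val b).1.2).
  case E : (val b) => [[i j] k] /=.
  have : Psi b * D i * D j = fpsC (phi1 b) * D k.
    rewrite PsiD E /= (_ : _ * D j = (D i * D' i) * (D j * D' j) * (fpsC (phi1 b) * D k)); last by ring.
    by rewrite !DD' !mul1r.
  move=> /(congr1 (fun f => fps_coef f 1)).
  rewrite fpsCM !fpsM1 !fpsM0 !D0 PsiE !fpsD tt0 tt1 !mul1r -/(x i) -/(x j) -/(x k) /=.
  by move=> h; rewrite !mulrBr -h; ring.
(* On A1 one has z = 0 and phi1 = 1, so x is additive along A1. This condition involves A1 alone, so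
   admissibility at [psi] applies even if [psi] differs from phi1. *)
have [t xt] : exists t : T, forall i : 'I_n.+1, (\row_i x i) 0 i = alpha i t.
  apply: (admissible_weights alpha_inj psi_Sigma psi_admissible) => a aA1.
  have /esym/eqP := zE a; rewrite (phi1_law.2 a aA1) mul1r !mxE.
  have -> : z a = 0 by move: aA1; rewrite !inE => /orP[/eqP ->|/imsetP[a' _ ->]].
  by rewrite -addrA -opprD subr_eq0 => /eqP.
case/eqP: zb0; rewrite zE.
have xt' i : x i = alpha i t by rewrite -xt mxE.
have /andP[_ /eqP s] := valP b0.
by rewrite !xt' -s lfunE /=; ring.
Qed.

End NonRigidity.

(** * Fibers of a direct filiation *)

Section WeightPaths.
Variables (K : closedFieldType) (charK : [pchar K] =i pred0).
Variables (T : vectType K) (alpha : nat -> 'Hom(T, K^o)) (n0 : nat).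
Hypothesis hpath : simple_path alpha n0.

Lemma ratr_neq0 (q : rat) : 0 < q -> (ratr q : K) != 0.
Proof.
move=> q0.
have int_neq0 (m : int) : m != 0 -> (m%:~R : K) != 0.
  have nat_eq0 := (pcharf0P K).1 charK.
  case: m => m m0; first by rewrite -[_%:~R]/(m%:R) nat_eq0.
  by rewrite -[_%:~R]/(- m.+1%:R) oppr_eq0 nat_eq0.
rewrite /ratr mulf_neq0 ?invr_eq0 ?int_neq0 ?denq_neq0 //.
by rewrite numq_eq0 Order.POrderTheory.gt_eqF.
Qed.

Lemma simple_path_inj : injective alpha.
Proof. by have [_] := hpath. Qed.

(** An empty spanning family would make the dual of T zero and all weights equal. *)
Lemma weight_path_init_gt0 : (0 < n0)%N.
Proof.
have [[span0 _ _ _] inj] := hpath; rewrite lt0n; apply/eqP => n00.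
suff : 0%N = 1%N by []; apply: inj.
have hom0 (g : 'Hom(T, K^o)) : g = 0.
  have : g \in fullv by apply: memvf.
  by rewrite -span0 n00 span_nil memv0 => /eqP.
by rewrite [RHS]hom0; apply: hom0.
Qed.

(** An initial weight takes a positive rational value, nonzero in characteristic 0; a later zero
    weight would be the excluded difference of the first weight with itself. *)
Lemma weight_path_neq0 i : alpha i != 0.
Proof.
have [[_ [t ht] _ new] _] := hpath; have n0_gt0 := weight_path_init_gt0.
have [lt|le] := ltnP i n0; apply/eqP => e.
  have [q q0 qE] := ht i lt; have := ratr_neq0 q0.
  by rewrite -qE e lfunE /= eqxx.
by apply: (new i le 0 0); rewrite ?(leq_trans n0_gt0) // e subrr.
Qed.

Lemma weight_path_new n : (n0 <= n)%N -> forall i j, (i < n)%N -> (j < n)%N ->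
  alpha n <> alpha i - alpha j.
Proof. by have [[_ _ _ new] _] := hpath; apply: new. Qed.

End WeightPaths.

(** A minimal subsystem also serves the claims whose statement mentions none. *)
Lemma min_subsystem_exists (K : closedFieldType) (T : vectType K)
    (alpha : nat -> 'Hom(T, K^o)) n (phi : {ffun mindex alpha n -> K}) a :
  exists L1, min_subsystem phi a L1.
Proof.
have [|L1 /minsetP[/asboolP eqv minL] sub] := @minset_exists _
    (fun L => `[< B_equiv phi a L >]) (Lambda alpha n).
  by apply/asboolP => X.
exists L1; split=> // L2 sL2 eqv2; apply: minL => //; exact/asboolP.
Qed.

Section FiberTheorem.
Variables (K : closedFieldType) (T : vectType K) (alpha : nat -> 'Hom(T, K^o)).
Hypothesis alpha_inj : injective alpha.
Variables (n : nat).
Hypothesis alpha_neq0 : forall i, (i <= n)%N -> alpha i != 0.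
Hypothesis alpha_new : forall i j, (i < n)%N -> (j < n)%N ->
  alpha n <> alpha i - alpha j.
Variables (pq : mindex alpha n.+1) (pq_new : target pq = ord_max).
Variables (A : {set mindex alpha n}) (phi : {ffun mindex alpha n -> K}).
Hypothesis phi_law : is_law_on A phi.
Let A1 : {set mindex alpha n.+1} := pq |: [set mindex_widen b | b in A].
Variable phi1 : {ffun mindex alpha n.+1 -> K}.
Hypothesis phi1_law : is_law_on A1 phi1.
Hypothesis phi1_proj : law_proj phi1 = phi.

Local Notation coord_ring n := {mpoly K[#|{: mindex alpha n}|]}.
Local Notation M := (free_coords pq).
Local Notation nu := (dim_H_2_weight phi (alpha n)).

Let x0_pq := phi1_pq phi1_law.
Let x0_cocycle := phi1_cocycle alpha_neq0 alpha_new phi1_law phi1_proj.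

(** Independent linear parts give |L1| <= |M|, so the dimension formula leaves nu > 0: a point in
    the fiber excludes nu = 0. *)
Lemma card_free_coords L1 : min_subsystem phi pq L1 ->
  (0 < nu)%N /\ #|M| = (#|L1| + nu.-1)%N.
Proof.
move=> minL; have := dim_H_2_fiber alpha_inj alpha_neq0 alpha_new pq_new
  phi_law.1 x0_pq x0_cocycle minL.
have := free_matrix_free pq_new x0_pq x0_cocycle minL.
rewrite /row_free => /eqP rk; have := rank_leq_col (free_matrix pq phi L1); rewrite rk.
case: nu => [|m] le; first by rewrite add0n => e; rewrite e ltnn in le.
by rewrite addSn => -[<-]; rewrite addnC.
Qed.

Lemma cocycle_unique : nu = 1%N -> forall z : mindex alpha n.+1 -> K, z pq = 0 ->
  (forall t, cocycle_lhs (sc phi) (new_part z) t = 0) ->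
  forall b, target b = ord_max -> z b = 0.
Proof.
move=> nu1 z zpq zc b tb; have [L1 minL] := min_subsystem_exists phi pq.
have [_ card] := card_free_coords minL.
have [->//|bpq] := eqVneq b pq.
have bM : b \in M by rewrite inE tb eqxx bpq.
rewrite -(enum_rankK_in bM bM).
by apply: (fiber_unique pq_new x0_pq x0_cocycle minL card) => //; rewrite nu1.
Qed.

Lemma fiber_point_unique (phi2 : {ffun mindex alpha n.+1 -> K}) : nu = 1%N ->
  is_law_on A1 phi2 -> law_proj phi2 = phi -> phi2 = phi1.
Proof.
move=> nu1 law2 proj2; pose z b := 1 * phi2 b + (-1) * phi1 b.
have zc t : cocycle_lhs (sc phi) (new_part z) t = 0.
  rewrite cocycle_lhs_combine x0_cocycle.
  by rewrite (phi1_cocycle alpha_neq0 alpha_new law2 proj2) !mulr0 addr0.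
have zpq : z pq = 0 by rewrite /z x0_pq (phi1_pq law2); ring.
apply/ffunP => b; have [tb|tb] := eqVneq (target b) ord_max.
  have := cocycle_unique nu1 zpq zc tb; rewrite /z mul1r mulN1r => /eqP.
  by rewrite subr_eq0 => /eqP.
have [a ->] := mindex_cases alpha_neq0 alpha_new tb.
by rewrite (phi1_widen phi1_proj) (phi1_widen proj2).
Qed.

Lemma not_rigid_fiber (psi : {ffun mindex alpha n.+1 -> K}) : (1 < nu)%N ->
  Sigma psi -> admissible psi A1 -> ~ rigid phi1.
Proof.
move=> nu1 psiS psiA; have [L1 minL] := min_subsystem_exists phi pq.
have [_ card] := card_free_coords minL.
have [N [v [Nv vc]]] := fiber_directions pq_new x0_pq x0_cocycle minL card.
have d_gt0 : (0 < nu.-1)%N by case: nu nu1 => [|[]].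
pose k := Ordinal d_gt0.
(* The first direction of the fiber, extended by 0 to pq and to the old coordinates; it is nonzero
   because N v = 1. *)
pose z (b : mindex alpha n.+1) := \sum_(j < #|M|) v j k * (enum_val j == b)%:R.
have ze j : z (enum_val j) = v j k.
  rewrite /z (bigD1 j) //= eqxx mulr1 big1 ?addr0 // => i ij.
  by rewrite (inj_eq enum_val_inj) (negbTE ij) mulr0.
have zpq : z pq = 0.
  by apply: big1 => j _; have /andP[_ /negbTE ->] := enum_val_free j; rewrite mulr0.
have zold a : z (mindex_widen a) = 0.
  apply: big1 => j _; have /andP[t _] := enum_val_free j.
  rewrite (_ : _ == _ = false) ?mulr0 //.
  by apply/eqP => e; have := target_widen a; rewrite -e t.
have zc t : cocycle_lhs (sc phi) (new_part z) t = 0.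
  rewrite cocycle_lhs_coef (sum_target_max pq_new) zpq mul0r add0r -[RHS](vc t k).
  by apply: eq_bigr => j _; rewrite ze.
have [j vj] : exists j, v j k != 0.
  case: (pselect (exists j, v j k != 0)) => // no.
  have := congr1 (fun W : 'M_(nu.-1) => W k k) Nv; rewrite !mxE eqxx big1 => [/esym/eqP|j _].
    by rewrite oner_eq0.
  rewrite (_ : v j k = 0) ?mulr0 //; apply/eqP/negPn/negP => h; apply: no.
  by exists j.
apply: (not_rigid_direction alpha_inj alpha_neq0 alpha_new phi_law phi1_law phi1_proj
  psiS psiA zpq zold zc (b0 := enum_val j)).
by rewrite ze.
Qed.

Variables (O O1 : comUnitRingType).
Variables (f : {rmorphism coord_ring n -> O}) (f1 : {rmorphism coord_ring n.+1 -> O1}).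
Hypothesis fP : is_local_ring A phi f.
Hypothesis f1P : is_local_ring A1 phi1 f1.

Lemma local_ring_presentation L1 : min_subsystem phi pq L1 ->
  exists (h : {rmorphism O -> O1}) (c0 : 'I_n * 'I_n * 'I_n -> O)
         (c : 'I_n * 'I_n * 'I_n -> 'I_nu.-1 -> O)
         (g : {rmorphism {mpoly O[nu.-1]} -> O1}),
  [/\ forall p, h (f p) = f1 (proj_comorph p), forall a, g a%:MP = h a,
      forall t, max_ideal (c0 t) /\ forall k, max_ideal (c t k)
    & is_quotient_localization (affine_ideal (Lambda alpha n :\: L1) c0 c)
        (@origin_ideal O nu.-1) g].
Proof.
move=> minL; have [_ card] := card_free_coords minL.
have [h hf] := local_ring_map alpha_neq0 alpha_new phi1_law phi1_proj fP f1P.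
have [rho [rhof rhoX rhoU]] := local_ring_residue phi_law fP.
have [rho1 [rho1f rho1X rho1U]] := local_ring_residue phi1_law f1P.
have [N [u [v [[Au Av rho_u Nu Nv] solE]]]] := system_solution alpha_neq0 alpha_new
  pq_new phi1_law phi1_proj minL card rhof rhoX rhoU.
exists h, (affine_c0 f u), (affine_c f v), (presentation_map phi1 f f1 N h); split=> //.
- exact: presentation_mapC.
- exact: (max_ideal_affine alpha_neq0 alpha_new pq_new phi1_law phi1_proj minL
    rhoX rhoU Av rho_u).
- exact: (presentation_map_localization alpha_neq0 alpha_new pq_new phi1_proj fP f1P
    rhof rhoX rhoU rho1f rho1X rho1U Au Av Nu Nv solE hf).
Qed.

(** Without variables every element of O_n[T] is constant, and a constant outside the origin ideal
    is a unit of O_n; so each fraction comes from O_n. *)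
Lemma local_ring_quotient : nu = 1%N -> exists h : {rmorphism O -> O1},
  (forall p, h (f p) = f1 (proj_comorph p)) /\ forall y, exists x, h x = y.
Proof.
move=> nu1; have [L1 minL] := min_subsystem_exists phi pq.
have [h [c0 [c [g [hf gC _ gP]]]]] := local_ring_presentation minL.
exists h; split=> // y; have [gU g_frac _] := gP; have [a [s [Ms ->]]] := g_frac y.
have const (p : {mpoly O[nu.-1]}) : p = (p@_0%MM)%:MP.
  apply/mpolyP => m; rewrite mcoeffC (_ : m = 0%MM) ?eqxx ?mulr1 //.
  apply/mnmP => i; have d0 : nu.-1 = 0%N by rewrite nu1.
  by have := ltn_ord i; rewrite [X in (_ < X)%N]d0.
have us : s@_0%MM \is a GRing.unit.
  apply/negPn/negP => ns; apply: Ms; rewrite [s]const.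
  by apply: ideal_gen_mem; left; exists s@_0%MM.
exists (a@_0%MM / s@_0%MM).
by rewrite [in RHS](const a) [in RHS](const s) !gC rmorphM rmorphV.
Qed.

Lemma krull_dim_fiber : krull_dim_ge O1 nu.-1.
Proof.
have [L1 minL] := min_subsystem_exists phi pq.
have [_ card] := card_free_coords minL.
have [N [v [Nv vc]]] := fiber_directions pq_new x0_pq x0_cocycle minL card.
exact: (krull_dim_local_ring alpha_neq0 alpha_new pq_new phi_law phi1_law phi1_proj Nv vc f1P).
Qed.

End FiberTheorem.

Theorem theorem5p3 (K : closedFieldType) (charK : [pchar K] =i pred0)
  (T : vectType K) (alpha : nat -> 'Hom(T, K^o)) (n0 n : nat)
  (hpath : simple_path alpha n0) (hn : (n0 <= n)%N)
  (An : {set mindex alpha n}) (An1 : {set mindex alpha n.+1})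
  (pq : mindex alpha n.+1) (hfil : direct_filiation An An1 pq)
  (phin : {ffun mindex alpha n -> K}) (hphin : is_law_on An phin) :
  let nu := dim_H_2_weight phin (alpha n) in
  let in_fiber phi1 := is_law_on An1 phi1 /\ law_proj phi1 = phin in
  (nu = 0%N -> forall phi1, ~ in_fiber phi1) /\
  forall phin1, in_fiber phin1 ->
    (nu = 1%N -> forall phi1, in_fiber phi1 -> phi1 = phin1) /\
    (nu = 1%N -> rigid phin -> rigid phin1) /\
    ((1 < nu)%N -> ~ rigid phin1) /\
    forall (On On1 : comUnitRingType)
      (fn : {rmorphism {mpoly K[#|{: mindex alpha n}|]} -> On})
      (fn1 : {rmorphism {mpoly K[#|{: mindex alpha n.+1}|]} -> On1}),
      is_local_ring An phin fn -> is_local_ring An1 phin1 fn1 ->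
      (nu = 1%N ->
        exists h : {rmorphism On -> On1},
          (forall p, h (fn p) = fn1 (proj_comorph p)) /\
          (forall y, exists x, h x = y)) /\
      ((1 < nu)%N ->
        krull_dim_ge On1 nu.-1 /\
        forall L1, min_subsystem phin pq L1 ->
          exists (c0 : 'I_n * 'I_n * 'I_n -> On)
                 (c : 'I_n * 'I_n * 'I_n -> 'I_nu.-1 -> On)
                 (g : {rmorphism {mpoly On[nu.-1]} -> On1}),
            [/\ forall x, x \in Lambda alpha n :\: L1 ->
                  max_ideal (c0 x) /\ forall k, max_ideal (c x k),
                forall p, g (fn p)%:MP = fn1 (proj_comorph p)
              & is_quotient_localization
                  (affine_ideal (Lambda alpha n :\: L1) c0 c)
                  (@origin_ideal On nu.-1) g]).
Proof.
move=> nu in_fiber.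
have inj := simple_path_inj hpath.
have neq0 i : (i <= n)%N -> alpha i != 0 by move=> _; apply: (weight_path_neq0 charK hpath).
have new := weight_path_new hpath hn.
have [pq_new A1E _ _ [phi [psi [_ [psiS psiA] _ _]]]] := hfil.
rewrite A1E in in_fiber hfil psiA *.
split=> [nu0 phi1 [law1 proj1]|phin1 [law1 proj1]].
  have [L1 minL] := min_subsystem_exists phin pq.
  have [] := card_free_coords inj neq0 new pq_new hphin law1 proj1 minL.
  by rewrite -/nu nu0.
split; last split; last split.
- by move=> nu1 phi1 [law2 proj2]; apply: (fiber_point_unique inj neq0 new pq_new hphin law1).
- move=> nu1; apply: (rigid_extension inj neq0 new pq_new law1 proj1).
  exact: (cocycle_unique inj neq0 new pq_new hphin law1 proj1 nu1).
- by move=> nu1; apply: (not_rigid_fiber inj neq0 new pq_new hphin law1 proj1 nu1 psiS psiA).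
move=> On On1 fn fn1 fnP fn1P; split=> [nu1|nu1].
  exact: (local_ring_quotient inj neq0 new pq_new hphin law1 proj1 fnP fn1P nu1).
split; first exact: (krull_dim_fiber inj neq0 new pq_new hphin law1 proj1 fn1P).
move=> L1 minL; have [h [c0 [c [g [hf gC mc gP]]]]] :=
  local_ring_presentation inj neq0 new pq_new hphin law1 proj1 fnP fn1P minL.
by exists c0, c, g; split=> // p; rewrite gC hf.
Qed.
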